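(* Let $(X_t)_{t\in\mathbb{Z}}$ be a regularly varying, strictly stationary time series with tail process $(Y_t)_{t\in\mathbb{Z}}$ whose finite-dimensional distributions are denoted by $(\mu_I)_{I\subset\mathbb{Z}}$. Let $t\in\mathbb{N}_0$, $N\in\mathbb{N}$, and let $A_0,\ldots,A_N\subset[0,\infty)\times(1,\infty)\times[0,\infty)^t$ be continuity sets with respect to $\mu:=\mu_{\{-1,\ldots,t\}}$ with $\mu(A_0)>0$. Assume that Condition (M) (see context) holds with threshold sequence $(u_n)_{n\in\mathbb{N}}$, that the $\alpha$-mixing coefficients satisfy $\alpha_n\in\mathcal{O}(n^{-\delta})$ for some $\delta\ge2$, and that $$\lim_{n\to\infty}n^{\delta/(4+\delta)}\,\mathbb{P}(X_0>u_n)=\infty\quad\text{if }\delta>2,$$ or $$\lim_{n\to\infty}n^{1/2}\,\frac{\mathbb{P}(X_0>u_n)^{3/2}}{|\log(\mathbb{P}(X_0>u_n))|}=\infty\quad\text{if }\delta=2.$$ Then, as $n\to\infty$, $$\sqrt{n\,\mathbb{P}(X_0>u_n)}\left(\widehat{R}_{n,u_n}(A_j,A_0)-\frac{\mathbb{P}((X_i)_{i=-1}^t\in u_nA_j)}{\mathbb{P}((X_i)_{i=-1}^t\in u_nA_0)}\right)_{j=1,\ldots,N}\longrightarrow_d\mathcal{N}\big(\mathbf{0},\,\mu(A_0)^{-4}F\Sigma F^\top\big),$$ where $F$ is the $N\times(N+1)$ matrix $$F=\begin{pmatrix}-\mu(A_1)&\mu(A_0)&0&\ldots&0\\-\mu(A_2)&0&\mu(A_0)&\ldots&0\\\vdots&\vdots&\vdots&\ddots&\vdots\\-\mu(A_N)&0&0&\ldots&\mu(A_0)\end{pmatrix}$$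 and $\Sigma=(\sigma_{jl})_{0\le j,l\le N}$ with $$\sigma_{jl}=\mu(A_j\cap A_l)+\sum_{h=1}^\infty\mathbb{P}\big((Y_i)_{i=-1}^t\in A_j,\,(Y_i)_{i=h-1}^{h+t}\in A_l\big)+\sum_{h=1}^\infty\mathbb{P}\big((Y_i)_{i=-1}^t\in A_l,\,(Y_i)_{i=h-1}^{h+t}\in A_j\big).$$ If, in addition, $$\lim_{n\to\infty}\sqrt{n\,\mathbb{P}(X_0>u_n)}\left[\frac{\mathbb{P}((X_i)_{i=-1}^t\in u_nA_j)}{\mathbb{P}((X_i)_{i=-1}^t\in u_nA_0)}-\frac{\mu(A_j)}{\mu(A_0)}\right]=0\qquad\text{for }j=1,\ldots,N,$$ then $$\sqrt{n\,\mathbb{P}(X_0>u_n)}\left(\widehat{R}_{n,u_n}(A_j,A_0)-\frac{\mu(A_j)}{\mu(A_0)}\right)_{j=1,\ldots,N}\longrightarrow_d\mathcal{N}\big(\mathbf{0},\,\mu(A_0)^{-4}F\Sigma F^\top\big).$$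
   Context: Standing assumptions: the time series $(X_t)_{t\in\mathbb{Z}}$ is strictly stationary, its marginal distribution function has a finite lower endpoint and lies in the max-domain of attraction of the $\alpha$-Fréchet distribution $\Phi_\alpha(x)=\exp(-x^{-\alpha})$, $x>0$, for some $\alpha>0$. A random vector $\mathbf{X}$ in $\mathbb{R}^d$ is multivariate regularly varying with index $\alpha>0$ if for some norm $\|\cdot\|$ there is a probability measure $\sigma$ on $\{\mathbf{x}\in[0,\infty)^d:\|\mathbf{x}\|=1\}$ such that, for $r>0$, $\mathbb{P}(\|\mathbf{X}\|>rx,\ \mathbf{X}/\|\mathbf{X}\|\in\cdot)/\mathbb{P}(\|\mathbf{X}\|>x)$ converges weakly to $r^{-\alpha}\sigma(\cdot)$ as $x\to\infty$. The time series is regularly varying if all its finite-dimensional margins are multivariate regularly varying; equivalently, there is a process $Y=(Y_t)_{t\in\mathbb{Z}}$, called the tail process, with $\mathbb{P}(Y_0>y)=y^{-\alpha}$ for $y\ge1$ such that for all integers $s<t$ the conditional law of $(X_s/x,\ldots,X_t/x)$ given $X_0>x$ converges weakly to the law of $(Y_s,\ldots,Y_t)$ as $x\to\infty$. For $I\subset\mathbb{Z}$, $\mu_I$ is the law of $(Y_i)_{i\in I}$. A Borel set $A$ is a continuity set with respect to $\mu_{\{-1,\ldots,t\}}$ if $\mu_{\{-1,\ldots,t\}}(\partial A)=0$, with $\partial A$ the topological boundary in $\mathbb{R}^{t+2}$. The $\alpha$-mixing coefficients are $$\alpha_h=\sup_{A,B\in\mathcal{B}(\mathbb{R}^{\mathbb{N}})}\big|\mathbb{P}((X_s)_{s\le0}\in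 A,\,(X_s)_{s\ge h}\in B)-\mathbb{P}((X_s)_{s\le0}\in A)\,\mathbb{P}((X_s)_{s\ge h}\in B)\big|,\quad h\ge0.$$ Condition (M): there exist a sequence $(u_n)_{n\in\mathbb{N}}\subset\mathbb{R}$ of thresholds and an intermediate sequence $(r_n)_{n\in\mathbb{N}}\subset\mathbb{N}$ with $u_n\to\infty$, $r_n\to\infty$, $n\mathbb{P}(X_0>u_n)\to\infty$ and $r_n\mathbb{P}(X_0>u_n)\to0$ as $n\to\infty$, such that $$\lim_{n\to\infty}\frac1{\mathbb{P}(X_0>u_n)}\sum_{h=r_n}^\infty\alpha_h=0\quad\text{and}\quad\lim_{k\to\infty}\limsup_{n\to\infty}\sum_{h=k}^{r_n}\mathbb{P}(X_h>u_n\mid X_0>u_n)=0.$$ Based on observations $X_{-1},\ldots,X_n$ and a threshold $u$, the estimators are $$\widehat{P}_{n,u}(A)=\frac1n\sum_{k=1}^{n-t}\mathbf{1}_{\{(X_i)_{i=k-1}^{k+t}\in uA\}},\qquad\widehat{R}_{n,u}(A,A_0)=\frac{\widehat{P}_{n,u}(A)}{\widehat{P}_{n,u}(A_0)},$$ where $uA=\{ua:a\in A\}$ (the ratio is given an arbitrary fixed value when its denominator vanishes). *)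

(* Defs.v *)
From HB Require Import structures.
From mathcomp Require Import all_boot all_order all_algebra.
From mathcomp Require Import all_classical all_reals all_analysis.
Set Implicit Arguments.
Unset Strict Implicit.
Unset Printing Implicit Defensive.
Import Order.TTheory GRing.Theory Num.Theory.
Import numFieldNormedType.Exports.
Local Open Scope classical_set_scope.
Local Open Scope ring_scope.

(* R^m is 'rV[R]_m with its product topology; the library puts no sigma-algebra
   on it. *)
Definition borel_rV (R : realType) (m : nat) :=
  g_sigma_algebraType (@open 'rV[R]_m).

Definition borel_set (R : realType) (m : nat) (B : set 'rV[R]_m) : Prop :=
  <<s @open 'rV[R]_m >> B.

Definition boundary (R : realType) (m : nat) (A : set 'rV[R]_m) :
  set 'rV[R]_m := closure A `\` A°.

(* A finite measure on R^m is given by its integration functional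
   f |-> \int f, so that laws, conditional laws and normalized restrictions are
   treated uniformly. *)
Definition weak_cvg (R : realType) (m : nat) (I : Type) (F : set_system I)
    (L : I -> ('rV[R]_m -> R) -> R) (L0 : ('rV[R]_m -> R) -> R) : Prop :=
  forall f : 'rV[R]_m -> R, continuous f -> [bounded f x | x in setT] ->
    L i f @[i --> F] --> L0 f.

Section Probability.
Context {d : measure_display} {T : measurableType d} {R : realType}.
Variable P : probability T R.

Definition pr (E : set T) : R := fine (P E).

Definition cond_pr (E C : set T) : R := pr (E `&` C) / pr C.

Definition mean (g : T -> R) : R := \int[P]_w g w.

Definition cond_mean (g : T -> R) (C : set T) : R :=
  (\int[P]_(w in C) g w) / pr C.

End Probability.

(* The library's [normal_prob m 0] is not the point mass at [m]. *)
Definition normal_law (R : realType) (m v : R) : set R -> \bar R :=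
  if v == 0 then \d_m else normal_prob m (Num.sqrt v).

(* N(m, C), possibly degenerate: every linear form x |-> x c is univariate
   normal. *)
Definition gaussian_law (R : realType) (N : nat) (m : 'rV[R]_N) (C : 'M[R]_N)
    (nu : probability (borel_rV R N) R) : Prop :=
  C^T = C /\
  forall c : 'cV[R]_N,
    let v := (c^T *m C *m c) 0 0 in
    0 <= v /\
    forall B : set R, measurable B ->
      nu [set x : 'rV[R]_N | B ((x *m c) 0 0)] = normal_law ((m *m c) 0 0) v B.

Definition cvg_to_gaussian d (T : measurableType d) (R : realType)
    (P : probability T R) (N : nat) (V : nat -> T -> 'rV[R]_N)
    (m : 'rV[R]_N) (C : 'M[R]_N) : Prop :=
  exists nu : probability (borel_rV R N) R,
    gaussian_law m C nu /\
    weak_cvg \oo (fun n f => mean P (fun w => f (V n w)))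
                 (fun f => \int[nu]_x f x).

Definition is_norm (R : realType) (m : nat) (nm : 'rV[R]_m -> R) : Prop :=
  [/\ forall x y, nm (x + y) <= nm x + nm y,
      forall (a : R) x, nm (a *: x) = `|a| * nm x &
      forall x, nm x = 0 -> x = 0].

(* The first functional below is integration against the measure
   P(nm V > r x, V / nm V \in .) / P(nm V > x). *)
Definition mv_regularly_varying d (T : measurableType d) (R : realType)
    (P : probability T R) (m : nat) (alpha : R) (V : T -> 'rV[R]_m) : Prop :=
  exists nm : 'rV[R]_m -> R, is_norm nm /\
  exists sigma : probability (borel_rV R m) R,
    sigma [set x : 'rV[R]_m | (forall i, 0 <= x 0 i) /\ nm x = 1] = 1%E /\
    forall r : R, 0 < r ->
      weak_cvg +oo
        (fun x f =>
           (\int[P]_(w in [set w | r * x < nm (V w)])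
               f ((nm (V w))^-1 *: V w))
           / pr P [set w | x < nm (V w)])
        (fun f => r `^ (- alpha) * \int[sigma]_x f x).

Definition frechet_cdf (R : realType) (alpha x : R) : R :=
  if 0 < x then expR (- (x `^ (- alpha))) else 0.

Section TimeSeries.
Context {d : measure_display} {T : measurableType d} {R : realType}.
Context {P : probability T R}.
Variable X : int -> {RV P >-> R}.

Definition margin (m : nat) (s : 'I_m -> int) (w : T) : 'rV[R]_m :=
  \row_(i < m) X (s i) w.

(* (X_a, ..., X_(a+m-1)) *)
Definition window (a : int) (m : nat) : T -> 'rV[R]_m :=
  margin (fun i : 'I_m => a + i%:Z).

Definition strictly_stationary : Prop :=
  forall (m : nat) (s : 'I_m -> int) (h : int) (B : set 'rV[R]_m),
    borel_set B ->
    P (margin (fun i => s i + h) @^-1` B) = P (margin s @^-1` B).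

Definition finite_lower_endpoint : Prop :=
  has_lbound [set x | (0 < cdf (X 0) x)%E].

Definition in_frechet_domain (alpha : R) : Prop :=
  exists a b : nat -> R, (forall n, 0 < a n) /\
    forall x : R, fine (cdf (X 0) (a n * x + b n)) ^+ n @[n --> \oo]
                  --> frechet_cdf alpha x.

Definition regularly_varying (alpha : R) : Prop :=
  forall (m : nat) (s : 'I_m.+1 -> int), injective s ->
    mv_regularly_varying P alpha (margin s).

Definition past (w : T) : nat -> R := fun n => X (- n%:Z) w.
Definition future (h : nat) (w : T) : nat -> R := fun n => X (h%:Z + n%:Z) w.

(* The product sigma-algebra, generated by the coordinate maps. *)
Definition borel_seq : set_system (nat -> R) :=
  <<s [set C | exists (n : nat) (B : set R),
         measurable B /\ C = (fun x : nat -> R => x n) @^-1` B] >>.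

Definition alpha_mixing (h : nat) : R :=
  sup [set c | exists A B, [/\ borel_seq A, borel_seq B &
    c = `|pr P (past @^-1` A `&` future h @^-1` B)
          - pr P (past @^-1` A) * pr P (future h @^-1` B)|]].

Definition exceed (h : nat) (u : R) : set T := [set w | u < X h%:Z w].

Definition condition_M (u : nat -> R) : Prop :=
  let p n := pr P (exceed 0 (u n)) in
  exists r : nat -> nat,
    [/\ u n @[n --> \oo] --> +oo,
        r n @[n --> \oo] --> \oo,
        n%:R * p n @[n --> \oo] --> +oo &
        (r n)%:R * p n @[n --> \oo] --> 0] /\
    ((p n)^-1%:E * \sum_(r n <= h <oo) (alpha_mixing h)%:E)%E @[n --> \oo]
      --> 0%E /\
    limn_esup (fun n => (\sum_(k <= h < (r n).+1)
                 cond_pr P (exceed h (u n)) (exceed 0 (u n)))%:E) @[k --> \oo]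
      --> 0%E.

Definition scaled_set (m : nat) (u : R) (A : set 'rV[R]_m) : set 'rV[R]_m :=
  [set u *: a | a in A].

(* P((X_(-1), ..., X_t) \in uA), for A in R^(t+2) *)
Definition block_pr (t : nat) (u : R) (A : set 'rV[R]_t.+2) : R :=
  pr P (window (-1) t.+2 @^-1` scaled_set u A).

Definition P_hat (t n : nat) (u : R) (A : set 'rV[R]_t.+2) (w : T) : R :=
  n%:R^-1 * \sum_(1 <= k < (n - t).+1)
    \1_(scaled_set u A) (window (k%:Z - 1) t.+2 w).

(* [c] is the value given to the ratio when the denominator vanishes. *)
Definition R_hat (c : R) (t n : nat) (u : R) (A A0 : set 'rV[R]_t.+2) (w : T) :
    R :=
  if P_hat n u A0 w == 0 then c else P_hat n u A w / P_hat n u A0 w.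

End TimeSeries.

Section TailProcess.
Context {d d' : measure_display} {T : measurableType d}.
Context {T' : measurableType d'} {R : realType}.
Context {P : probability T R} {P' : probability T' R}.
Variables (X : int -> {RV P >-> R}) (Y : int -> {RV P' >-> R}).

(* The window X_s, ..., X_t with s < t has length m.+2 for some m. *)
Definition is_tail_process (alpha : R) : Prop :=
  (forall y : R, 1 <= y -> pr P' [set w | y < Y 0 w] = y `^ (- alpha)) /\
  forall (s : int) (m : nat),
    weak_cvg +oo
      (fun x f => cond_mean P (fun w => f (x^-1 *: window X s m.+2 w))
                              [set w | x < X 0 w])
      (fun f => mean P' (fun w => f (window Y s m.+2 w))).

(* mu_{-1,...,t} *)
Definition tail_law (t : nat) (A : set 'rV[R]_t.+2) : R :=
  pr P' (window Y (-1) t.+2 @^-1` A).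

Definition tail_continuity_set (t : nat) (A : set 'rV[R]_t.+2) : Prop :=
  borel_set A /\ tail_law (boundary A) = 0.

Definition in_extreme_region (t : nat) (A : set 'rV[R]_t.+2) : Prop :=
  forall x, A x -> forall i : 'I_t.+2,
    if val i == 1%N then 1 < x 0 i else 0 <= x 0 i.

Definition sigma_entry (t : nat) (A B : set 'rV[R]_t.+2) : \bar R :=
  let cross (h : nat) (C D : set 'rV[R]_t.+2) :=
    P' (window Y (-1) t.+2 @^-1` C `&` window Y (h%:Z - 1) t.+2 @^-1` D) in
  ((tail_law (A `&` B))%:E + \sum_(1 <= h <oo) cross h A B
                           + \sum_(1 <= h <oo) cross h B A)%E.

(* [sigma_entry] is an extended real because its series are not finite a
   priori; [fine] reads it as a real number. *)
Definition Sigma_mx (t N : nat) (A : 'I_(1 + N) -> set 'rV[R]_t.+2) :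
    'M[R]_(1 + N) :=
  \matrix_(j, l) fine (sigma_entry (A j) (A l)).

Definition F_mx (t N : nat) (A : 'I_(1 + N) -> set 'rV[R]_t.+2) :
    'M[R]_(N, 1 + N) :=
  row_mx (\col_(i < N) - tail_law (A (rshift 1 i)))
         (tail_law (A ord0))%:M.

End TailProcess.

(* Main.v *)
Require Import Defs.
From mathcomp Require Import all_boot all_order all_algebra.
From mathcomp Require Import all_classical all_reals all_analysis.
From mathcomp Require Import measurable_realfun zify ring lra.
Set Implicit Arguments.
Unset Strict Implicit.
Unset Printing Implicit Defensive.
Import Order.TTheory GRing.Theory Num.Theory.
Import numFieldNormedType.Exports.
Local Open Scope classical_set_scope.
Local Open Scope ring_scope.

Section TrigTaylor.
Context {R : realType}.
Implicit Types x s : R.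

Lemma ge0_of_deriv (f f' : R -> R) : (forall x, is_derive x 1 f (f' x)) ->
  (forall x, 0 <= x -> 0 <= f' x) -> f 0 = 0 -> forall x, 0 <= x -> 0 <= f x.
Proof.
move=> df f'0 f0 x x0; have [z /andP[]] : exists2 c, 0 <= c <= x & f x - f 0 = f' c * (x - 0).
  have [z] := @MVT_segment R f f' 0 x x0 (fun z _ => df z) (derivable_within_continuous (fun z _ => @ex_derive _ _ _ _ _ _ _ (df z))).
  by rewrite in_itv/= => zx h; exists z.
by move=> z0 _; rewrite f0 !subr0 => ->; rewrite mulr_ge0// f'0.
Qed.

Lemma sin_le_id x : 0 <= x -> sin x <= x.
Proof.
rewrite -[sin x <= x]subr_ge0; move: x; have d1 (x : R) : is_derive x 1 (fun x : R => x - sin x) (1 - cos x).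
  by apply: is_derive_eq; rewrite /GRing.scale/=; field.
have d2 (x : R) : 0 <= x -> 0 <= 1 - cos x.
  move=> x0; by rewrite subr_ge0 cos_le1.
have d3 : (fun x : R => x - sin x) 0 = 0.
  by rewrite sin0 subrr.
exact: ge0_of_deriv d1 d2 d3.
Qed.

Lemma cos_ge_quadratic x : 0 <= x -> 0 <= cos x - 1 + x ^+ 2 / 2.
Proof.
move: x; have d1 (x : R) : is_derive x 1 (fun x : R => cos x - 1 + x ^+ 2 / 2) (x - sin x).
  by apply: is_derive_eq; rewrite /GRing.scale/=; field.
have d2 (x : R) : 0 <= x -> 0 <= x - sin x.
  move=> x0; by rewrite subr_ge0 sin_le_id.
have d3 : (fun x : R => cos x - 1 + x ^+ 2 / 2) 0 = 0.
  by rewrite cos0 expr0n/=; lra.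
exact: ge0_of_deriv d1 d2 d3.
Qed.

Lemma sin_ge_cubic x : 0 <= x -> 0 <= sin x - x + x ^+ 3 / 6.
Proof.
move: x; have d1 (x : R) : is_derive x 1 (fun x : R => sin x - x + x ^+ 3 / 6) (cos x - 1 + x ^+ 2 / 2).
  by apply: is_derive_eq; rewrite /GRing.scale/=; field.
have d2 (x : R) : 0 <= x -> 0 <= cos x - 1 + x ^+ 2 / 2.
  move=> x0; exact: cos_ge_quadratic.
have d3 : (fun x : R => sin x - x + x ^+ 3 / 6) 0 = 0.
  by rewrite sin0 expr0n/=; lra.
exact: ge0_of_deriv d1 d2 d3.
Qed.

Lemma one_sub_cos_le x : 0 <= x -> 0 <= x - 1 + cos x.
Proof.
move: x; have d1 (x : R) : is_derive x 1 (fun x : R => x - 1 + cos x) (1 - sin x).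
  by apply: is_derive_eq; rewrite /GRing.scale/=; field.
have d2 (x : R) : 0 <= x -> 0 <= 1 - sin x.
  move=> x0; by rewrite subr_ge0 sin_le1.
have d3 : (fun x : R => x - 1 + cos x) 0 = 0.
  by rewrite cos0; lra.
exact: ge0_of_deriv d1 d2 d3.
Qed.

Lemma id_sub_sin_le x : 0 <= x -> 0 <= x ^+ 2 / 2 - x + sin x.
Proof.
move: x; have d1 (x : R) : is_derive x 1 (fun x : R => x ^+ 2 / 2 - x + sin x) (x - 1 + cos x).
  by apply: is_derive_eq; rewrite /GRing.scale/=; field.
have d2 (x : R) : 0 <= x -> 0 <= x - 1 + cos x.
  move=> x0; exact: one_sub_cos_le.
have d3 : (fun x : R => x ^+ 2 / 2 - x + sin x) 0 = 0.
  by rewrite sin0 expr0n/=; lra.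
exact: ge0_of_deriv d1 d2 d3.
Qed.

Lemma cos_le_cubic x : 0 <= x -> 0 <= x ^+ 3 / 6 - (cos x - 1 + x ^+ 2 / 2).
Proof.
move: x; have d1 (x : R) : is_derive x 1 (fun x : R => x ^+ 3 / 6 - (cos x - 1 + x ^+ 2 / 2)) (x ^+ 2 / 2 - x + sin x).
  by apply: is_derive_eq; rewrite /GRing.scale/=; field.
have d2 (x : R) : 0 <= x -> 0 <= x ^+ 2 / 2 - x + sin x.
  move=> x0; exact: id_sub_sin_le.
have d3 : (fun x : R => x ^+ 3 / 6 - (cos x - 1 + x ^+ 2 / 2)) 0 = 0.
  by rewrite cos0 !expr0n/=; lra.
exact: ge0_of_deriv d1 d2 d3.
Qed.

Lemma norm_sin_le x : `|sin x| <= `|x|.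
Proof.
wlog x0 : x / 0 <= x => [h|].
  have [/h//|/ltW x0] := leP 0 x.
  by rewrite -normrN -sinN -[leRHS]normrN h// oppr_ge0.
rewrite (ger0_norm x0) ler_norml sin_le_id// andbT.
have := sin_ge_cubic x0; have := id_sub_sin_le x0; have := cos_ge_quadratic x0.
have [x2|x2] := leP x 2.
  have [->|xn0] := eqVneq x 0; first by rewrite sin0 oppr0.
  move=> _ _ _; rewrite (@le_trans _ _ 0)// ?oppr_le0//.
  by apply: sin_ge0_pi; rewrite x0 (le_trans x2)// pi_ge2.
by have := sin_geN1 x; lra.
Qed.

Lemma cos_lip x y : `|cos x - cos y| <= `|x - y|.
Proof.
have [s [t [-> ->]]] : exists s t, x = s + t /\ y = s - t.
  by exists ((x + y) / 2), ((x - y) / 2); split; field.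
rewrite cosB cosD (_ : _ - _ = - (2 * sin s * sin t)); last by ring.
rewrite (_ : s + t - (s - t) = 2 * t); last by ring.
rewrite normrN -mulrA !normrM ler_pM2l ?normr_gt0//.
apply: le_trans (norm_sin_le t).
by rewrite ler_piMl// sin_max.
Qed.

Lemma cos_taylor2 x s :
  `|cos (x + s) - (cos x - s * sin x - s ^+ 2 / 2 * cos x)| <= `|s| ^+ 3.
Proof.
have -> : cos (x + s) - (cos x - s * sin x - s ^+ 2 / 2 * cos x) =
    cos x * (cos s - 1 + s ^+ 2 / 2) + sin x * (s - sin s).
  by rewrite cosD; ring.
have h : `|cos s - 1 + s ^+ 2 / 2| <= `|s| ^+ 3 / 6 /\ `|s - sin s| <= `|s| ^+ 3 / 6.
  wlog s0 : s / 0 <= s => [h|].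
    have [/h//|/ltW s0] := leP 0 s.
    have := h (- s); rewrite oppr_ge0 => /(_ s0).
    by rewrite cosN sinN sqrrN normrN -opprD normrN.
  rewrite (ger0_norm s0) (ger0_norm (cos_ge_quadratic s0)) ger0_norm ?subr_ge0 ?sin_le_id//.
  by have := cos_le_cubic s0; have := sin_ge_cubic s0; split; lra.
case: h => h1 h2; have s3 : 0 <= `|s| ^+ 3 by rewrite exprn_ge0.
rewrite (le_trans (ler_normD _ _))// !normrM.
apply: (@le_trans _ _ (`|s| ^+ 3 / 6 + `|s| ^+ 3 / 6)); last by lra.
by rewrite lerD// -[leRHS]mul1r ler_pM// ?cos_max ?sin_max.
Qed.

End TrigTaylor.

Section BoundedMean.
Context {d : measure_display} {T : measurableType d} {R : realType}.
Variable P : probability T R.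
Implicit Types f g : T -> R.

Definition bmf f := measurable_fun setT f /\ exists M, forall x, `|f x| <= M.

Lemma bmf_integrable f : bmf f -> P.-integrable setT (EFin \o f).
Proof.
move=> [mf [M Mf]]; apply: (@le_integrable _ _ _ _ _ _ _ (EFin \o cst M)) => //.
- exact/measurable_EFinP.
- by move=> x _ /=; rewrite lee_fin (le_trans (Mf x))// ler_norm.
- exact: finite_measure_integrable_cst.
Qed.

Lemma bmf_cst (k : R) : bmf (cst k).
Proof. by split => //; exists `|k|. Qed.

Lemma bmfD f g : bmf f -> bmf g -> bmf (fun x => f x + g x).
Proof.
move=> [mf [M Mf]] [mg [N Ng]]; split; first exact: measurable_funD.
by exists (M + N) => x; rewrite (le_trans (ler_normD _ _))// lerD.
Qed.

Lemma bmfM f g : bmf f -> bmf g -> bmf (fun x => f x * g x).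
Proof.
move=> [mf [M Mf]] [mg [N Ng]]; split; first exact: measurable_funM.
by exists (M * N) => x; rewrite normrM ler_pM.
Qed.

Lemma bmfZ (k : R) f : bmf f -> bmf (fun x => k * f x).
Proof. by move=> bf; apply: bmfM => //; exact: bmf_cst. Qed.

Lemma bmfN f : bmf f -> bmf (fun x => - f x).
Proof.
by move=> bf; under eq_fun do rewrite -mulN1r; exact: bmfZ.
Qed.

Lemma bmfB f g : bmf f -> bmf g -> bmf (fun x => f x - g x).
Proof. by move=> bf bg; apply: bmfD => //; exact: bmfN. Qed.

Lemma bmf_norm f : bmf f -> bmf (fun x => `|f x|).
Proof.
move=> [mf [M Mf]]; split; last by exists M => x; rewrite normr_id.
exact: measurableT_comp.
Qed.

Lemma bmf_sum (I : Type) (s : seq I) (q : pred I) (F : I -> T -> R) :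
  (forall i, q i -> bmf (F i)) -> bmf (fun x => \sum_(i <- s | q i) F i x).
Proof.
move=> h; elim: s => [|i s ih].
  by under eq_fun do rewrite big_nil; exact: bmf_cst.
under eq_fun do rewrite big_cons.
case: (boolP (q i)) => qi; last exact: ih.
by apply: bmfD => //; exact: h.
Qed.

Lemma bmf_indic (E : set T) : measurable E -> bmf (\1_E : T -> R).
Proof.
move=> mE; split; first exact: measurable_indic.
by exists 1 => x; rewrite indicE; case: (_ \in _); rewrite ?normr1// normr0.
Qed.

Lemma bmf_comp (h : R -> R) f : continuous h ->
  (exists M, forall x, `|h x| <= M) -> measurable_fun setT f ->
  bmf (fun x => h (f x)).
Proof.
move=> ch [M Mh] mf; split; last by exists M.
by apply: measurableT_comp => //; exact: continuous_measurable_fun.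
Qed.

Lemma bmf_cos f : measurable_fun setT f -> bmf (fun x => cos (f x)).
Proof.
apply: bmf_comp; first exact: continuous_cos.
by exists 1 => x; exact: cos_max.
Qed.

Lemma bmf_sin f : measurable_fun setT f -> bmf (fun x => sin (f x)).
Proof.
apply: bmf_comp; first exact: continuous_sin.
by exists 1 => x; exact: sin_max.
Qed.

Lemma meanD f g : bmf f -> bmf g ->
  mean P (fun x => f x + g x) = mean P f + mean P g.
Proof. by move=> /bmf_integrable bf /bmf_integrable bg; exact: RintegralD. Qed.

Lemma meanB f g : bmf f -> bmf g ->
  mean P (fun x => f x - g x) = mean P f - mean P g.
Proof. by move=> /bmf_integrable bf /bmf_integrable bg; exact: RintegralB. Qed.

Lemma meanZ k f : bmf f -> mean P (fun x => k * f x) = k * mean P f.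
Proof. by move=> /bmf_integrable bf; exact: RintegralZl. Qed.

Lemma mean_cst k : mean P (fun=> k) = k.
Proof.
rewrite /mean -[X in Rintegral _ _ X]/(cst k) Rintegral_cst//.
by have /= -> := @probability_setT _ _ _ P; rewrite /= mulr1.
Qed.

Lemma meanN f : bmf f -> mean P (fun x => - f x) = - mean P f.
Proof.
move=> bf; rewrite -[RHS]mulN1r -meanZ//; congr mean.
by apply/funext => x; rewrite mulN1r.
Qed.

Lemma le_mean f g : bmf f -> bmf g -> (forall x, f x <= g x) ->
  mean P f <= mean P g.
Proof.
by move=> /bmf_integrable bf /bmf_integrable bg fg; exact: le_Rintegral.
Qed.

Lemma mean_ge0 f : (forall x, 0 <= f x) -> 0 <= mean P f.
Proof. by move=> h; apply: Rintegral_ge0. Qed.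

Lemma mean_norm f : bmf f -> `|mean P f| <= mean P (fun x => `|f x|).
Proof. by move=> /bmf_integrable bf; exact: le_normr_Rintegral. Qed.

Lemma mean_norm_le f M : bmf f -> (forall x, `|f x| <= M) -> `|mean P f| <= M.
Proof.
move=> bf h; rewrite (le_trans (mean_norm bf))// -[leRHS]mean_cst.
by apply: le_mean => //; [exact: bmf_norm|exact: bmf_cst].
Qed.

Lemma mean_sum (I : Type) (s : seq I) (q : pred I) (F : I -> T -> R) :
  (forall i, q i -> bmf (F i)) ->
  mean P (fun x => \sum_(i <- s | q i) F i x) = \sum_(i <- s | q i) mean P (F i).
Proof.
move=> h; elim: s => [|i s ih].
  by rewrite big_nil -[RHS]mean_cst; under eq_fun do rewrite big_nil.
rewrite big_cons -ih; under eq_fun do rewrite big_cons.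
case: (boolP (q i)) => // qi; rewrite meanD//; first exact: h.
exact: bmf_sum.
Qed.

Lemma pr_ge0 (E : set T) : 0 <= pr P E.
Proof. by rewrite /pr fine_ge0. Qed.

Lemma pr_set0 : pr P set0 = 0.
Proof. by rewrite /pr measure0. Qed.

Lemma pr_fin (E : set T) : measurable E -> P E \is a fin_num.
Proof. by move=> mE; exact: fin_num_measure. Qed.

Lemma prE (E : set T) : measurable E -> P E = (pr P E)%:E.
Proof. by move=> mE; rewrite /pr fineK// pr_fin. Qed.

Lemma pr_le1 (E : set T) : measurable E -> pr P E <= 1.
Proof. by move=> mE; rewrite -lee_fin -prE// probability_le1. Qed.

Lemma mean_indic (E : set T) : measurable E -> mean P \1_E = pr P E.
Proof. by move=> mE; rewrite /mean /Rintegral integral_indic// setIT. Qed.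

Lemma le_pr (E F : set T) : measurable E -> measurable F -> E `<=` F ->
  pr P E <= pr P F.
Proof.
by move=> mE mF EF; rewrite -lee_fin -!prE//; apply: le_measure; rewrite ?inE.
Qed.

Lemma pr_setU (E F : set T) : measurable E -> measurable F ->
  pr P (E `|` F) <= pr P E + pr P F.
Proof.
move=> mE mF; rewrite -lee_fin EFinD -!prE//; last exact: measurableU.
exact: measureU2.
Qed.

Lemma pr_setC (E : set T) : measurable E -> pr P (~` E) = 1 - pr P E.
Proof.
move=> mE; apply: EFin_inj; rewrite -prE; last exact: measurableC.
by rewrite probability_setC// prE.
Qed.

Lemma mean_setI f (E : set T) : bmf f -> measurable E ->
  \int[P]_(w in E) f w = mean P (fun w => f w * \1_E w).
Proof.
move=> bf mE; rewrite Rintegral_mkcond; apply: eq_Rintegral => x _.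
by rewrite patchE indicE; case: (_ \in _); rewrite ?mulr1// mulr0.
Qed.

(** Jensen for the square, obtained by expanding [(|f| - t)^2 >= 0]. *)
Lemma mean_norm_sqr f : bmf f ->
  mean P (fun x => `|f x|) <= Num.sqrt (mean P (fun x => f x ^+ 2)).
Proof.
move=> bf; set a := mean P (fun x => `|f x|).
have a0 : 0 <= a by apply: mean_ge0.
rewrite -(ler_pXn2r (n:=2)) ?nnegrE ?sqrtr_ge0// sqr_sqrtr; last first.
  by apply: mean_ge0 => x; rewrite sqr_ge0.
have bf2 : bmf (fun x => f x ^+ 2).
  by under eq_fun do rewrite expr2; exact: bmfM.
have bfa := bmf_norm bf.
have : 0 <= mean P (fun x => (`|f x| - a) ^+ 2).
  by apply: mean_ge0 => x; rewrite sqr_ge0.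
have -> : (fun x => (`|f x| - a) ^+ 2) =
    (fun x => (f x ^+ 2 - (2 * a) * `|f x|) + a ^+ 2).
  apply/funext => x; rewrite -[f x ^+ 2]real_normK ?num_real//; ring.
rewrite meanD//; [|apply: bmfB => //; exact: bmfZ|exact: bmf_cst].
rewrite meanB//; last exact: bmfZ.
rewrite meanZ// mean_cst -/a => h; rewrite -subr_ge0.
by apply: le_trans h _; rewrite le_eqVlt; apply/orP; left; apply/eqP; ring.
Qed.

End BoundedMean.

Section Rows.
Context {R : realType} {m : nat}.
Implicit Types x y : 'rV[R]_m.

Lemma row_normlt x e : 0 < e -> (`|x| < e) <-> (forall i, `|x 0 i| < e).
Proof.
move=> e0; have := @mx_norm_ball R 1 m; move/(congr1 (fun B => B 0 e x)).
rewrite /ball_ /= sub0r normrN => <-; split => [[_ h] i|h].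
  by have := h 0 i; rewrite /ball_ /= /ball /= mxE sub0r normrN.
split => // i j; rewrite ord1; have := h j.
by rewrite /ball /= mxE sub0r normrN.
Qed.

Lemma coord_le_norm x i : `|x 0 i| <= `|x|.
Proof.
rewrite leNgt; apply/negP => h.
have x0 : 0 < `|x 0 i| by apply: le_lt_trans h.
by have := (row_normlt x x0).1 h i; rewrite ltxx.
Qed.

Lemma row_norm_le x e : 0 <= e -> (forall i, `|x 0 i| <= e) -> `|x| <= e.
Proof.
move=> e0 h; apply/ler_addgt0Pr => z z0; apply/ltW/row_normlt => [|i].
  by rewrite ltr_wpDl.
by rewrite (le_lt_trans (h i))// ltrDl.
Qed.

Lemma openP (U : set 'rV[R]_m) x : open U -> U x ->
  exists2 e, 0 < e & forall y, `|y - x| < e -> U y.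
Proof.
move=> oU Ux; have : nbhs x U by exact: open_nbhs_nbhs.
move=> /nbhs_ballP[e /= e0 xe]; exists e => // y yx; apply: xe.
by rewrite mx_norm_ball /ball_/= distrC.
Qed.

Lemma measurable_row_open d (T : measurableType d) (f : T -> 'rV[R]_m) :
  (forall i, measurable_fun setT (fun w => f w 0 i)) ->
  forall U, open U -> measurable (f @^-1` U).
Proof.
move=> mf U oU.
pose box (q : 'rV[rat]_m * nat) : set 'rV[R]_m :=
  [set x | forall i, `|x 0 i - ratr (q.1 0 i)| < q.2.+1%:R^-1].
pose F q := if pselect (box q `<=` U) then f @^-1` box q else set0.
suff -> : f @^-1` U = \bigcup_q F q.
  apply: countable_bigcupT_measurable => [|q]; first exact: countableP.
  rewrite /F; case: pselect => sub /=; last exact: measurable0.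
  have -> : f @^-1` box q =
      \bigcap_(i in [set: 'I_m]) ((fun w => f w 0 i) @^-1`
        [set t | `|t - ratr (q.1 0 i)| < q.2.+1%:R^-1]).
    by apply/seteqP; split => w /= h i; [move=> _; exact: h|exact: (h i)].
  apply: fin_bigcap_measurable => // i _.
  rewrite -[X in measurable X]setTI; apply: mf => //.
  apply: open_measurable.
  rewrite (_ : mkset _ = ball (ratr (q.1 0 i) : R) q.2.+1%:R^-1).
    by apply: ball_open; rewrite invr_gt0 ltr0n.
  by apply/seteqP; split => t /=; rewrite /ball /= distrC.
apply/seteqP; split => [w /= Uw|w [q _]].
  have [e e0 he] := openP oU Uw.
  pose k := Num.truncn (2 / e).
  have ke : 2 * k.+1%:R^-1 < e.
    rewrite ltr_pdivrMr ?ltr0n// mulrC -ltr_pdivrMr//.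
    by have := truncnS_gt (2/e).
  have k0 : (0 : R) < k.+1%:R^-1 by rewrite invr_gt0 ltr0n.
  have hq i : exists r : rat, `|f w 0 i - ratr r| < k.+1%:R^-1.
    have [r] : exists r : rat, ratr r \in `](f w 0 i - k.+1%:R^-1), (f w 0 i + k.+1%:R^-1)[.
      by apply: rat_in_itvoo; rewrite ltrBlDr -addrA ltrDl addr_gt0.
    by rewrite in_itv/= => h; exists r; rewrite ltr_distlC.
  have [r hr] := choice hq.
  exists (\row_i r i, k) => //; rewrite /F; case: pselect => [h i|]/=.
    by rewrite mxE.
  case; move=> x /= hx; apply: he; apply/row_normlt => // i.
  rewrite !mxE; have := hx i; rewrite mxE => h; have h' := hr i.
  rewrite (le_lt_trans _ ke)//; apply: (@le_trans _ _ (`|x 0 i - ratr (r i)| + `|ratr (r i) - f w 0 i|)).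
    by rewrite (le_trans _ (ler_normD _ _))// addrA subrK.
  by rewrite [X in _ + X]distrC mulr_natl mulr2n lerD// ltW.
by rewrite /F; case: pselect => // h /h.
Qed.

Lemma measurable_row d (T : measurableType d) (f : T -> 'rV[R]_m) :
  (forall i, measurable_fun setT (fun w => f w 0 i)) ->
  measurable_fun setT (f : T -> borel_rV R m).
Proof.
move=> mf; apply: (@measurability _ _ T (borel_rV R m) setT f (@open 'rV[R]_m) erefl).
by move=> _ [U oU <-]; rewrite setTI; exact: measurable_row_open.
Qed.

Lemma measurable_preimage_row d (T : measurableType d) (f : T -> 'rV[R]_m) B :
  (forall i, measurable_fun setT (fun w => f w 0 i)) -> borel_set B ->
  measurable (f @^-1` B).
Proof.
by move=> /measurable_row mf mB; rewrite -[X in measurable X]setTI; exact: mf.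
Qed.

Lemma continuous_measurable_row (g : 'rV[R]_m -> R) : continuous g ->
  measurable_fun setT (g : borel_rV R m -> R).
Proof.
move=> cg; apply: (measurability _ (RGenOpens.measurableE R)).
move=> _ [_ [a [b ->]] <-]; rewrite setTI; apply: sub_sigma_algebra.
by move/continuousP : cg; apply; exact: interval_open.
Qed.

Lemma measurable_coord i : measurable_fun setT (fun x : borel_rV R m => (x : 'rV[R]_m) 0 i).
Proof. by apply: continuous_measurable_row; exact: coord_continuous. Qed.

Lemma open_borel (U : set 'rV[R]_m) : open U -> borel_set U.
Proof. exact: sub_sigma_algebra. Qed.

Lemma closed_borel (U : set 'rV[R]_m) : closed U -> borel_set U.
Proof.
move=> cU; rewrite -[U]setCK.
apply: (@measurableC _ (borel_rV R m)); apply: open_borel.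
by rewrite openC.
Qed.

Lemma bmf_row d (T : measurableType d) (f : T -> 'rV[R]_m) (g : 'rV[R]_m -> R) :
  (forall i, measurable_fun setT (fun w => f w 0 i)) -> continuous g ->
  [bounded g x | x in setT] -> bmf (fun w => g (f w)).
Proof.
move=> /measurable_row mf cg bg; split.
  apply: (@measurableT_comp _ _ _ _ (borel_rV R m) _ g _ f) => //.
  exact: continuous_measurable_row.
have [M [_ hM]] := bg; exists (M + 1) => x.
by apply: (hM (M + 1)) => //; rewrite ltrDl.
Qed.

Lemma lipschitz_continuous_row (g : 'rV[R]_m -> R) (K : R) :
  (forall x y, `|g x - g y| <= K * `|x - y|) -> continuous g.
Proof.
move=> h x A /nbhs_ballP[e /= e0 eA].
have K0 : 0 < `|K| + 1 by rewrite ltr_wpDl.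
change (nbhs x (g @^-1` A)).
apply/nbhs_ballP; exists (e / (`|K| + 1)) => /=; first exact: divr_gt0.
move=> y; rewrite mx_norm_ball /ball_/= => xy; apply: eA => /=.
apply: (le_lt_trans (h _ _)).
apply: (@le_lt_trans _ _ ((`|K| + 1) * `|x - y|)).
  by rewrite ler_wpM2r// (le_trans (ler_norm _))// lerDl.
by rewrite mulrC -ltr_pdivlMr.
Qed.

(** Distance to a set, and its cone-shaped majorant of the indicator. *)
Definition setdist (K : set 'rV[R]_m) x : R := inf [set `|x - a| | a in K].

Lemma setdist_ge0 K x : 0 <= setdist K x.
Proof.
have [->|/set0P[a Ka]] := eqVneq K set0; first by rewrite /setdist image_set0 inf0.
by apply: lb_le_inf; [exists `|x - a|, a|move=> _ [b _ <-]].
Qed.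

Lemma setdist_lip K x y : `|setdist K x - setdist K y| <= `|x - y|.
Proof.
have [->|/set0P[a Ka]] := eqVneq K set0.
  by rewrite /setdist !image_set0 inf0 subrr normr0.
suff h u v : setdist K u - setdist K v <= `|u - v|.
  by rewrite ler_norml lerNl opprB h distrC h.
rewrite lerBlDr -lerBlDl; apply: lb_le_inf; first by exists `|v - a|, a.
move=> _ [b Kb <-]; rewrite lerBlDl.
apply: (@le_trans _ _ `|u - b|).
  by apply: ge_inf; [exists 0 => _ [c _ <-]|exists b].
by rewrite (le_trans _ (ler_normD _ _))// addrA subrK.
Qed.

Lemma setdist0 K x : K x -> setdist K x = 0.
Proof.
move=> Kx; apply/eqP; rewrite eq_le setdist_ge0 andbT.
apply: ge_inf; first by exists 0 => _ [c _ <-].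
by exists x => //; rewrite subrr normr0.
Qed.

Lemma setdist_lt K x e : K !=set0 -> setdist K x < e -> exists2 a, K a & `|x - a| < e.
Proof.
move=> [a Ka] h; have [|_ [b Kb <-] hb] := inf_lt _ h; first by exists `|x - a|, a.
by exists b.
Qed.

Lemma closed_setdist K x : closed K -> K !=set0 -> ~ K x -> 0 < setdist K x.
Proof.
move=> cK K0 nKx; rewrite lt_neqAle setdist_ge0 andbT eq_sym.
apply/eqP => h0; apply: nKx.
rewrite -[K]setCK => nKx; move/closed_openC : cK => /openP/(_ nKx)[e e0 he].
have [|a Ka] := @setdist_lt K x e K0; first by rewrite h0.
by rewrite distrC => /he.
Qed.

Definition cone (K : set 'rV[R]_m) (n : nat) x : R :=
  Num.max 0 (1 - n.+1%:R * setdist K x).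

Lemma cone_ge0 K n x : 0 <= cone K n x. Proof. by rewrite le_max lexx. Qed.

Lemma cone_le1 K n x : cone K n x <= 1.
Proof. by rewrite ge_max ler01/= gerBl mulr_ge0// setdist_ge0. Qed.

Lemma cone_bounded K n : [bounded cone K n x | x in setT].
Proof.
exists 1; split => // M M1 x _ /=; rewrite ger0_norm ?cone_ge0//.
by rewrite (le_trans (cone_le1 _ _ _))// ltW.
Qed.

Lemma cone_continuous K n : continuous (cone K n).
Proof.
apply: (@lipschitz_continuous_row _ n.+1%:R) => x y.
have := setdist_lip K x y; rewrite /cone.
set a := setdist K x; set b := setdist K y => h.
have {h} h : `|n.+1%:R * a - n.+1%:R * b| <= n.+1%:R * `|x - y|.
  by rewrite -mulrBr normrM ger0_norm// ler_pM2l ?ltr0n.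
apply: le_trans h; move: (n.+1%:R * a) (n.+1%:R * b) => s t.
by rewrite !maxEle; do 2 case: ifPn => ?; rewrite ler_norml; apply/andP; split;
  case: (ler0P (s - t)); lra.
Qed.

Lemma cone1 K n x : K x -> cone K n x = 1.
Proof. by move=> Kx; rewrite /cone setdist0// mulr0 subr0; apply/max_idPr. Qed.

Lemma cone_gt0 K n x : K !=set0 -> 0 < cone K n x ->
  exists2 a, K a & `|x - a| < n.+1%:R^-1.
Proof.
move=> K0; rewrite lt_max ltxx/= subr_gt0 => h; apply: setdist_lt => //.
by rewrite -[ltRHS]mul1r ltr_pdivlMr ?ltr0n// mulrC.
Qed.

Lemma cone_cvg K x : closed K -> K !=set0 -> cone K n x @[n --> \oo] --> (\1_K x : R).
Proof.
move=> cK K0; rewrite indicE; case: (boolP (x \in K)) => [/set_mem Kx|/negP nKx].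
  under eq_fun do rewrite cone1//; exact: cvg_cst.
have d0 : 0 < setdist K x.
  by apply: closed_setdist => // Kx; apply: nKx; exact: mem_set.
apply: cvg_near_cst; near=> n.
apply/max_idPl; rewrite subr_le0 -ler_pdivrMr// mul1r.
near: n; exists (Num.truncn (setdist K x)^-1) => // n /= hn.
rewrite ltW// (lt_le_trans (truncnS_gt _))// ler_nat ltnS//.
Unshelve. all: by end_near. Qed.

End Rows.

Section TrigAlgebra.
Context {R : realType} {N : nat}.
Implicit Types (f g h : 'rV[R]_N -> R) (c : 'cV[R]_N).

Inductive trig_poly : ('rV[R]_N -> R) -> Prop :=
| trig_cos k c b : trig_poly (fun x => k * cos ((x *m c) 0 0 + b))
| trig_add f g : trig_poly f -> trig_poly g -> trig_poly (fun x => f x + g x).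

Lemma trig_scale k f : trig_poly f -> trig_poly (fun x => k * f x).
Proof.
elim=> [l c b|{}f g _ ihf _ ihg].
  by under eq_fun do rewrite mulrA; exact: trig_cos.
by under eq_fun do rewrite mulrDr; exact: trig_add.
Qed.

Lemma trig_cst k : trig_poly (fun=> k).
Proof.
have := trig_cos k 0 0; congr trig_poly; apply/funext => x.
by rewrite mulmx0 mxE addr0 cos0 mulr1.
Qed.

Lemma trig_mul f g : trig_poly f -> trig_poly g -> trig_poly (fun x => f x * g x).
Proof.
elim=> [k c b|{}f f' _ ihf _ ihf'] hg; last first.
  under eq_fun do rewrite mulrDl; apply: trig_add; [exact: ihf|exact: ihf'].
elim: hg => [l e b'|{}g g' _ ihg _ ihg']; last first.
  by under eq_fun do rewrite mulrDr; apply: trig_add.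
have := trig_add (trig_cos (k * l / 2) (c + e) (b + b'))
                 (trig_cos (k * l / 2) (c - e) (b - b')).
congr trig_poly; apply/funext => x.
rewrite mulmxDr mulmxBr; move: (x *m c) (x *m e) => X Y.
rewrite !mxE; move: (X 0 0) (Y 0 0) => s t.
rewrite (_ : s + t + (b + b') = (s + b) + (t + b')); last by ring.
rewrite (_ : s - t + (b - b') = (s + b) - (t + b')); last by ring.
by rewrite cosD cosB; field.
Qed.

Lemma linform_lip c (x y : 'rV[R]_N) :
  `|(x *m c) 0 0 - (y *m c) 0 0| <= (\sum_j `|c j 0|) * `|x - y|.
Proof.
rewrite !mxE -sumrB (le_trans (ler_norm_sum _ _ _))// mulr_suml.
apply: ler_sum => j _; rewrite -mulrBl normrM mulrC ler_wpM2l//.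
by have := coord_le_norm (x - y) j; rewrite !mxE.
Qed.

Lemma continuous_linform c : continuous (fun x : 'rV[R]_N => (x *m c) 0 0).
Proof. exact: lipschitz_continuous_row (linform_lip c). Qed.

Lemma trig_lip f : trig_poly f ->
  exists K : R, forall x y : 'rV[R]_N, `|f x - f y| <= K * `|x - y|.
Proof.
elim=> [k c b|{}f g _ [K ihf] _ [K' ihg]].
  exists (`|k| * \sum_j `|c j 0|) => x y; rewrite -mulrBr normrM -mulrA ler_wpM2l//.
  rewrite (le_trans (cos_lip _ _))// opprD addrACA subrr addr0; exact: linform_lip.
exists (K + K') => x y; rewrite opprD addrACA (le_trans (ler_normD _ _))//.
by rewrite mulrDl lerD.
Qed.

Lemma trig_continuous f : trig_poly f -> continuous f.
Proof. by move=> /trig_lip[K h]; exact: lipschitz_continuous_row h. Qed.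

Lemma trig_bounded f : trig_poly f -> exists M : R, forall x, `|f x| <= M.
Proof.
elim=> [k c b|{}f g _ [M ihf] _ [M' ihg]]; last first.
  by exists (M + M') => x; rewrite (le_trans (ler_normD _ _))// lerD.
exists `|k| => x; rewrite normrM ler_piMr//; exact: cos_max.
Qed.

(** Uniform closure of the trigonometric polynomials. *)
Definition trig_lim f := forall e : R, 0 < e ->
  exists2 g, trig_poly g & forall x, `|f x - g x| <= e.

Lemma trig_lim_poly f : trig_poly f -> trig_lim f.
Proof. by move=> tf e e0; exists f => // x; rewrite subrr normr0 ltW. Qed.

Lemma trig_lim_bounded f : trig_lim f -> exists2 M : R, 0 < M & forall x, `|f x| <= M.
Proof.
move=> /(_ _ ltr01)[g /trig_bounded[M gM] fg]; exists (`|M| + 1) => [|x].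
  by rewrite ltr_wpDl.
rewrite -(subrK (g x) (f x)) addrC (le_trans (ler_normD _ _))// lerD//.
by rewrite (le_trans (gM x))// ler_norm.
Qed.

Lemma trig_limD f g : trig_lim f -> trig_lim g -> trig_lim (fun x => f x + g x).
Proof.
move=> hf hg e e0; have e20 : 0 < e / 2 by rewrite divr_gt0.
have [f' tf' ff'] := hf _ e20; have [g' tg' gg'] := hg _ e20.
exists (fun x => f' x + g' x); first exact: trig_add.
move=> x; rewrite opprD addrACA (le_trans (ler_normD _ _))// (splitr e) lerD//.
Qed.

Lemma trig_limM f g : trig_lim f -> trig_lim g -> trig_lim (fun x => f x * g x).
Proof.
move=> hf hg e e0; have [M M0 fM] := trig_lim_bounded hf.
have e20 : 0 < e / 2 by rewrite divr_gt0.
have [g' tg' gg'] := hg (e / 2 / M) (divr_gt0 e20 M0).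
have [M' g'M] := trig_bounded tg'.
have M'0 : 0 < `|M'| + 1 by rewrite ltr_wpDl.
have [f' tf' ff'] := hf (e / 2 / (`|M'| + 1)) (divr_gt0 e20 M'0).
exists (fun x => f' x * g' x); first exact: trig_mul.
move=> x; rewrite (_ : _ - _ = f x * (g x - g' x) + (f x - f' x) * g' x); last by ring.
rewrite (le_trans (ler_normD _ _))// (splitr e) !normrM lerD//.
  rewrite -(@divfK _ M (lt0r_neq0 M0) (e / 2)) mulrC ler_pM//.
rewrite -(@divfK _ (`|M'| + 1) (lt0r_neq0 M'0) (e / 2)) ler_pM//.
by rewrite (le_trans (g'M x))// (le_trans (ler_norm _))// lerDl.
Qed.

Lemma trig_lim_cst k : trig_lim (fun=> k).
Proof. exact/trig_lim_poly/trig_cst. Qed.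

Lemma trig_limZ k f : trig_lim f -> trig_lim (fun x => k * f x).
Proof. by move=> hf; apply: trig_limM => //; exact: trig_lim_cst. Qed.

Lemma trig_lim_closed f :
  (forall e : R, 0 < e -> exists2 g, trig_lim g & forall x, `|f x - g x| <= e) ->
  trig_lim f.
Proof.
move=> h e e0; have e20 : 0 < e / 2 by rewrite divr_gt0.
have [g tg fg] := h _ e20; have [g' tg' gg'] := tg _ e20.
exists g' => // x; rewrite -(subrKA (g x)) (le_trans (ler_normD _ _))//.
by rewrite (splitr e) lerD.
Qed.

(* Polynomials converging uniformly to |t| on [-1, 1]: if
   [e_k = |t| - abs_poly k t] then [e_(k+1) = e_k (1 - (|t| + abs_poly k t) / 2)]. *)
Fixpoint abs_poly (k : nat) (t : R) : R :=
  if k is k'.+1 then abs_poly k' t + (t ^+ 2 - abs_poly k' t ^+ 2) / 2 else 0.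

Lemma abs_poly_error k t : `|t| <= 1 ->
  0 <= abs_poly k t <= `|t| /\ `|t| - abs_poly k t <= 2 / k.+2%:R.
Proof.
move=> t1; elim: k => [|k [/andP[p0 pt] ih]] /=.
  by rewrite lexx normr_ge0 subr0 divff.
rewrite -[t ^+ 2]real_normK ?num_real//.
move: p0 pt ih t1 (normr_ge0 t); set p := abs_poly k t; set s := `|t|.
move=> p0 pt ih s1 s0.
have k2 : (2 : R) <= k.+2%:R by rewrite ler_nat.
split.
  apply/andP; split; first by rewrite addr_ge0// divr_ge0// subr_ge0 ler_pXn2r.
  rewrite -subr_ge0 (_ : _ - _ = (s - p) * (1 - (s + p) / 2)); last by field.
  by rewrite mulr_ge0 ?subr_ge0//; lra.
rewrite (_ : _ - _ = (s - p) * (1 - (s + p) / 2)); last by field.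
set e := s - p in ih *; have e0 : 0 <= e by rewrite subr_ge0.
apply: (@le_trans _ _ (e * (1 - e / 2))); first by apply: ler_wpM2l => //; rewrite /e; lra.
have -> : (k.+3%:R : R) = k.+2%:R + 1 by rewrite -natr1.
move: k2 ih; set q : R := k.+2%:R => q2 ih.
have q0 : 0 < q by lra.
have q10 : 0 < q + 1 by lra.
apply: (@le_trans _ _ ((2 / q) * (1 - (2 / q) / 2))).
  have e1 : e <= 1 by rewrite /e; lra.
  have a1 : 2 / q <= 1 by rewrite ler_pdivrMr// mul1r.
  move: ih a1; set a := 2 / q => ea a1.
  rewrite -subr_ge0 (_ : _ - _ = (a - e) * (1 - (a + e) / 2)); last by field.
  by rewrite mulr_ge0 ?subr_ge0//; lra.
rewrite -subr_ge0 (_ : _ - _ = 2 / (q ^+ 2 * (q + 1))); last by field; rewrite !gt_eqF.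
by rewrite divr_ge0// mulr_ge0 ?sqr_ge0// ltW.
Qed.

Lemma trig_lim_abs_poly k f : trig_lim f -> trig_lim (fun x => abs_poly k (f x)).
Proof.
move=> hf; elim: k => [|k ih] /=; first exact: trig_lim_cst.
have := trig_limD ih (trig_limZ (1 / 2) (trig_limD (trig_limM hf hf)
  (trig_limZ (-1) (trig_limM ih ih)))).
by congr trig_lim; apply/funext => x; field.
Qed.

Lemma trig_lim_norm f : trig_lim f -> trig_lim (fun x => `|f x|).
Proof.
move=> hf; have [M M0 fM] := trig_lim_bounded hf.
suff : trig_lim (fun x => `|M^-1 * f x|).
  move=> /(trig_limZ M); congr trig_lim; apply/funext => x.
  by rewrite normrM gtr0_norm ?invr_gt0// mulrA mulfV ?mul1r// gt_eqF.
have f1 x : `|M^-1 * f x| <= 1.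
  by rewrite normrM gtr0_norm ?invr_gt0// mulrC ler_pdivrMr// mul1r.
apply: trig_lim_closed => e e0; pose k := Num.truncn (2 / e).
exists (fun x => abs_poly k (M^-1 * f x)).
  exact/trig_lim_abs_poly/trig_limZ.
move=> x; have [/andP[_ h1] h2] := abs_poly_error k (f1 x).
rewrite ger0_norm ?subr_ge0// (le_trans h2)// ler_pdivrMr ?ltr0n//.
rewrite mulrC -ler_pdivrMr// ltW// (lt_le_trans (truncnS_gt _))//.
by rewrite ler_nat.
Qed.

Lemma trig_lim_min f g : trig_lim f -> trig_lim g ->
  trig_lim (fun x => Num.min (f x) (g x)).
Proof.
move=> hf hg.
have hfg : trig_lim (fun x => f x - g x).
  by under eq_fun do rewrite -mulN1r; apply: trig_limD => //; exact: trig_limZ.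
have := trig_limZ (1 / 2) (trig_limD (trig_limD hf hg) (trig_limZ (-1) (trig_lim_norm hfg))).
congr trig_lim; apply/funext => x; rewrite minEle.
by case: ifPn => [|/negbTE] h; case: (ler0P (f x - g x)) => ?; lra.
Qed.

Lemma trig_lim_max f g : trig_lim f -> trig_lim g ->
  trig_lim (fun x => Num.max (f x) (g x)).
Proof.
move=> hf hg.
have := trig_limZ (-1) (trig_lim_min (trig_limZ (-1) hf) (trig_limZ (-1) hg)).
congr trig_lim; apply/funext => x.
by rewrite minEle maxEle; do 2 case: ifPn => ?; lra.
Qed.

End TrigAlgebra.

Section Levy.
Context {R : realType} {N : nat}.
Implicit Types (f g h : 'rV[R]_N -> R) (c : 'cV[R]_N).

(** The periodic functions [sin ((x_i - a_i) / L)] separate the points of a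
    box of side at most [L]. *)
Definition sin_dist (L : R) (a x : 'rV[R]_N) : R :=
  \sum_i `|sin ((x 0 i - a 0 i) / L)|.

Lemma sin_dist_self L a : sin_dist L a a = 0.
Proof. by rewrite /sin_dist big1// => i _; rewrite subrr mul0r sin0 normr0. Qed.

Lemma sin_dist_ge0 L a x : 0 <= sin_dist L a x.
Proof. by apply: sumr_ge0 => i _. Qed.

Lemma trig_lim_sum (I : Type) (s : seq I) (F : I -> 'rV[R]_N -> R) :
  (forall i, trig_lim (F i)) -> trig_lim (fun x => \sum_(i <- s) F i x).
Proof.
move=> hF; elim: s => [|i s ih].
  by under eq_fun do rewrite big_nil; exact: trig_lim_cst.
by under eq_fun do rewrite big_cons; exact: trig_limD.
Qed.

Lemma trig_lim_sin_dist L a : trig_lim (sin_dist L a).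
Proof.
apply: trig_lim_sum => i; apply/trig_lim_norm/trig_lim_poly.
have := trig_cos (1 : R) (L^-1 *: delta_mx i 0) (- (a 0 i / L) - pi / 2).
congr trig_poly; apply/funext => x; rewrite mul1r addrA cosBpihalf.
congr sin; rewrite mulrBl; congr (_ - _); rewrite -scalemxAr mxE mulrC.
congr (_ * _); rewrite mxE (bigD1 i)//= mxE !eqxx mulr1 big1 ?addr0// => j ji.
by rewrite mxE (negbTE ji)/= mulr0.
Qed.

Lemma sin_dist_lip (L : R) (a x y : 'rV[R]_N) : 0 < L ->
  `|sin_dist L a x - sin_dist L a y| <= (N%:R / L) * `|x - y|.
Proof.
move=> L0; rewrite -sumrB (le_trans (ler_norm_sum _ _ _))//.
apply: (@le_trans _ _ (\sum_(i < N) (L^-1 * `|x - y|))); last first.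
  by rewrite sumr_const card_ord -mulrA mulr_natl.
apply: ler_sum => i _; rewrite (le_trans (ler_dist_dist _ _))//.
rewrite -!cosBpihalf (le_trans (cos_lip _ _))//.
rewrite [X in `|X| <= _](_ : _ = (x 0 i - y 0 i) / L); last by ring.
rewrite normrM (gtr0_norm (x := L^-1)) ?invr_gt0// mulrC ler_pM2l ?invr_gt0//.
by have := coord_le_norm (x - y) i; rewrite !mxE.
Qed.

Lemma sin_dist_far (L B r : R) : 0 < B -> 0 < r -> L = 2 * B ->
  exists2 k : R, 0 < k & forall a x : 'rV[R]_N, `|a| <= B -> `|x| <= B ->
    r <= `|x - a| -> k <= sin_dist L a x.
Proof.
move=> B0 r0 LE; have L0 : 0 < L by rewrite LE mulr_gt0.
pose y := Num.min (r / L) 1.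
have y0 : 0 < y by rewrite lt_min divr_gt0//=.
have y1 : y <= 1 by rewrite ge_min lexx orbT.
have p1 := @pihalf_ge1 R.
exists (sin y) => [|a x aB xB rx].
  by apply: sin_gt0_pihalf; rewrite y0/= (le_lt_trans y1)// lt_neqAle p1 andbT;
    apply/eqP => h; have := @cos_pihalf R; rewrite -h => h1; have := @cos1_gt0 R; rewrite h1 ltxx.
have [i hi] : exists i, r <= `|x 0 i - a 0 i|.
  apply: contrapT => h; move: rx; apply/negP; rewrite -ltNge.
  apply/row_normlt => // i; rewrite ltNge; apply/negP => hi; apply: h.
  by exists i; rewrite !mxE in hi.
rewrite /sin_dist (bigD1 i)//= -[leLHS]addr0 lerD ?sumr_ge0//.
set z := (x 0 i - a 0 i) / L.
have zy : y <= `|z|.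
  rewrite /z normrM (gtr0_norm (x := L^-1)) ?invr_gt0// ge_min.
  by rewrite ler_pM2r ?invr_gt0// hi.
have z1 : `|z| <= 1.
  rewrite /z normrM (gtr0_norm (x := L^-1)) ?invr_gt0// ler_pdivrMr// mul1r LE.
  rewrite (le_trans (ler_normB _ _))//.
  have := le_trans (coord_le_norm x i) xB; have := le_trans (coord_le_norm a i) aB.
  lra.
have -> : `|sin z| = sin `|z|.
  have [z0|/ltW z0] := leP 0 z.
    by rewrite (ger0_norm z0) ger0_norm// sin_ge0_pi// z0/= -(ger0_norm z0) (le_trans z1)// (le_trans _ (@pi_ge2 R))// ler1n.
  rewrite (ler0_norm z0) -normrN -sinN ger0_norm// sin_ge0_pi// oppr_ge0 z0/=.
  by rewrite -(ler0_norm z0) (le_trans z1)// (le_trans _ (@pi_ge2 R))// ler1n.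
have [->//|yz] := eqVneq y `|z|.
apply/ltW; rewrite ltr_sin ?in_itv/=; first by rewrite lt_neqAle yz.
  by rewrite (le_trans y1 p1) andbT (le_trans _ (ltW y0))// oppr_le0 (le_trans _ p1).
by rewrite (le_trans z1 p1) andbT (le_trans _ (normr_ge0 z))// oppr_le0 (le_trans _ p1).
Qed.

Lemma trig_lim_bigmin (I : Type) (s : seq I) (M : R) (F : I -> 'rV[R]_N -> R) :
  (forall i, trig_lim (F i)) ->
  trig_lim (fun x => \big[Num.min/M]_(i <- s) F i x).
Proof.
move=> hF; elim: s => [|i s ih].
  by under eq_fun do rewrite big_nil; exact: trig_lim_cst.
by under eq_fun do rewrite big_cons; exact: trig_lim_min.
Qed.

(** On a compact box a bounded continuous function is the infimum, up to [e],
    of finitely many functions [f a + K_a * sin_dist a]: the constant [K_a]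
    makes the one based at [a] exceed [f] away from [a], and near [a] it is
    close to [f].  Clipping keeps the bound of [f] outside the box. *)
Lemma trig_lim_approx f (M B e : R) : continuous f -> (forall x, `|f x| <= M) ->
  0 < B -> 0 < e -> exists2 h, trig_lim h &
    (forall x, `|h x| <= M) /\ forall x, `|x| <= B -> `|h x - f x| <= e.
Proof.
move=> cf fM B0 e0; pose L := 2 * B; have L0 : 0 < L by rewrite mulr_gt0.
have M0 : 0 <= M by apply: le_trans (fM 0).
pose box : set 'rV[R]_N := [set x | `|x| <= B].
have e20 : 0 < e / 2 by rewrite divr_gt0.
have hK a : exists K : R, 0 <= K /\ (`|a| <= B -> forall x, `|x| <= B ->
    f x - e / 2 <= f a + K * sin_dist L a x).
  have [aB|aB] := boolP (`|a| <= B); last by exists 0.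
  have /nbhs_ballP[r /= r0 hr] : nbhs a (f @^-1` ball (f a) (e / 2)).
    by apply: cf; exact: nbhsx_ballx.
  have [k k0 hk] := sin_dist_far B0 r0 (erefl L).
  exists (2 * M / k); split => [|_ x xB]; first by rewrite divr_ge0 ?mulr_ge0// ltW.
  have [xr|xr] := leP r `|x - a|.
    have := hk _ _ aB xB xr; rewrite -(ler_pM2l (x := 2 * M / k + 1)); last first.
      by rewrite ltr_wpDl// divr_ge0 ?mulr_ge0// ltW.
    move=> _; apply: (@le_trans _ _ (f a + 2 * M / k * k)).
      rewrite divfK ?gt_eqF//; have := fM a; have := fM x; rewrite !ler_norml.
      move=> /andP[? ?] /andP[? ?]; lra.
    by rewrite lerD2l ler_wpM2l// ?divr_ge0 ?mulr_ge0// ?(ltW k0)//; exact: hk.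
  have /hr /= : ball a r x by rewrite mx_norm_ball /ball_/= distrC.
  rewrite /ball/= ltr_distlC => /andP[h1 h2].
  apply: (@le_trans _ _ (f a)); first lra.
  by rewrite lerDl mulr_ge0 ?sin_dist_ge0// divr_ge0 ?mulr_ge0// ltW.
have [K /all_and2[K0 hKf]] := choice hK.
pose U a : set 'rV[R]_N := [set x | `|f a - f x| < e / 2 /\ K a * sin_dist L a x < e / 2].
have Ua a : (U a)° a.
  have csd : continuous (sin_dist L a).
    by apply: (@lipschitz_continuous_row _ _ _ (N%:R / L)) => x y; exact: sin_dist_lip.
  have /nbhs_ballP[r1 /= r10 hr1] : nbhs a (f @^-1` ball (f a) (e / 2)).
    by apply: cf; exact: nbhsx_ballx.
  have K1 : 0 < K a + 1 by rewrite ltr_wpDl.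
  have /nbhs_ballP[r2 /= r20 hr2] :
      nbhs a (sin_dist L a @^-1` ball (sin_dist L a a) (e / 2 / (K a + 1))).
    by apply: csd; apply: nbhsx_ballx; rewrite divr_gt0.
  apply/nbhs_ballP; exists (Num.min r1 r2) => [|x].
    by rewrite /= lt_min r10.
  rewrite mx_norm_ball /ball_/= lt_min => /andP[x1 x2].
  split; first by apply: hr1; rewrite mx_norm_ball.
  have : ball a r2 x by rewrite mx_norm_ball.
  move=> /hr2; rewrite /ball /= sin_dist_self sub0r normrN.
  rewrite ger0_norm ?sin_dist_ge0// ltr_pdivlMr// => h.
  by apply: le_lt_trans h; rewrite mulrC ler_wpM2l ?sin_dist_ge0// lerDl.
have cbox : compact box.
  apply: bounded_closed_compact.
    by exists B; split => [|z Bz x /= xB]; rewrite ?num_real// (le_trans xB)// ltW.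
  rewrite /box (_ : mkset _ = (fun x : 'rV[R]_N => `|x|) @^-1` [set t | t <= B])//.
  apply: preimage_closed; last exact: closed_le.
  have cn : continuous (fun x : 'rV[R]_N => `|x|).
    apply: (@lipschitz_continuous_row _ _ _ 1) => x y; rewrite mul1r.
    exact: ler_dist_dist.
  by move=> x _; exact: cn.
move: cbox; rewrite compact_cover.
move=> /(_ 'rV[R]_N box (fun a => (U a)°)) [].
- by move=> a _; exact: open_interior.
- by move=> x xB; exists x.
move=> D Dbox Dcov.
pose h0 x := \big[Num.min/M]_(a <- finmap.enum_fset D) (f a + K a * sin_dist L a x).
have th0 : trig_lim h0.
  apply: trig_lim_bigmin => a; apply: trig_limD; first exact: trig_lim_cst.
  exact/trig_limZ/trig_lim_sin_dist.
exists (fun x => Num.max (- M) (h0 x)).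
  by apply: trig_lim_max => //; exact: trig_lim_cst.
have h0M x : h0 x <= M.
  rewrite /h0; elim: (finmap.enum_fset D) => [|a s ih]; first by rewrite big_nil.
  by rewrite big_cons ge_min ih orbT.
split => [x|x xB].
  by rewrite ler_norml le_max lexx/= ge_max h0M andbT; lra.
have h0f : f x - e / 2 <= h0 x.
  rewrite /h0 big_seq; elim/big_ind : _ => [|y z fy fz|a aD].
  - by have := fM x; rewrite ler_norml => /andP[_]; lra.
  - by rewrite le_min fy.
  - by apply: hKf => //; have := Dbox _ aD; rewrite inE.
have fh0 : h0 x <= f x + e.
  have [a /= aD /interior_subset[h1 h2]] := Dcov _ xB.
  apply: (@le_trans _ _ (f a + K a * sin_dist L a x)).
    have {}aD : a \in finmap.enum_fset D by [].
    rewrite /h0; elim: (finmap.enum_fset D) aD => // b s ih.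
    by rewrite inE big_cons ge_min => /orP[/eqP<-|/ih ->]; rewrite ?lexx ?orbT.
  by move: h1; rewrite ltr_distl => /andP[h3 h4]; lra.
rewrite /= ler_distl maxEle; have := fM x; rewrite ler_norml => /andP[h1 h2].
by case: ifPn => h3; apply/andP; split; lra.
Qed.

Lemma trig_lim_continuous f : trig_lim f -> continuous f.
Proof.
move=> tf x A /nbhs_ballP[e /= e0 eA]; change (nbhs x (f @^-1` A)).
have e30 : 0 < e / 3 by rewrite divr_gt0.
have [g tg fg] := tf _ e30.
have /nbhs_ballP[r /= r0 hr] : nbhs x (g @^-1` ball (g x) (e / 3)).
  by apply: (trig_continuous tg); exact: nbhsx_ballx.
apply/nbhs_ballP; exists r => // y xy; apply: eA => /=.
have := hr _ xy; rewrite /ball /= => gxy; have := fg x; have := fg y.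
rewrite !ler_distl ltr_distl => /andP[h1 h2] /andP[h3 h4].
by move: gxy; rewrite ltr_distl => /andP[h5 h6]; apply/andP; split; lra.
Qed.

End Levy.

Section WeakConvergence.
Context {R : realType} {N : nat}.

Lemma measurable_norm_gt d (T : measurableType d) (V : T -> 'rV[R]_N) (B : R) :
  (forall i, measurable_fun setT (fun w => V w 0 i)) ->
  measurable [set w | B < `|V w|].
Proof.
move=> mV; apply: (@measurable_row_open _ _ _ _ V mV [set x | B < `|x|]).
rewrite (_ : mkset _ = (fun x : 'rV[R]_N => `|x|) @^-1` [set t | B < t])//.
apply: open_comp; last exact: open_gt.
move=> x _; have cn : continuous (fun x : 'rV[R]_N => `|x|).
  apply: (@lipschitz_continuous_row _ _ _ 1) => y z; rewrite mul1r.
  exact: ler_dist_dist.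
exact: cn.
Qed.

Lemma tight_row d (T : measurableType d) (P : probability T R) (V : T -> 'rV[R]_N) (e : R) :
  (forall i, measurable_fun setT (fun w => V w 0 i)) -> 0 < e ->
  exists2 B : R, 0 < B & pr P [set w | B < `|V w|] <= e.
Proof.
move=> mV e0; pose F n := [set w | n%:R < `|V w|].
have mF n : measurable (F n) by exact: measurable_norm_gt.
have F0 : \bigcap_n F n = set0.
  apply/seteqP; split => // w /(_ (Num.truncn `|V w|).+1 I) /=.
  by move/lt_trans => /(_ _ (truncnS_gt _)); rewrite ltxx.
have : (P \o F) n @[n --> \oo] --> P (\bigcap_n F n).
  apply: nonincreasing_cvg_mu => //.
  - by rewrite (le_lt_trans (probability_le1 P (mF _)))// ltry.
  - by rewrite F0.
  - move=> m n mn; apply/subsetPset => w /=; apply: le_lt_trans.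
    by rewrite ler_nat.
rewrite F0 measure0 => /fine_cvgP[_] /cvgrPdist_le/(_ _ e0)[n _ hn].
exists n.+1%:R => //; have := hn n.+1 (leqnSn _).
by rewrite /= sub0r normrN; apply: le_trans; exact: ler_norm.
Qed.

Variables (d : measure_display) (T : measurableType d) (P : probability T R).
Variables (d' : measure_display) (T' : measurableType d') (Q : probability T' R).

Lemma mean_trunc_close d0 (T0 : measurableType d0) (P0 : probability T0 R)
    (V : T0 -> 'rV[R]_N) (f h : 'rV[R]_N -> R) (M B e : R) :
  (forall i, measurable_fun setT (fun w => V w 0 i)) ->
  continuous f -> continuous h -> (forall x, `|f x| <= M) ->
  (forall x, `|h x| <= M) -> (forall x, `|x| <= B -> `|h x - f x| <= e) ->
  0 <= e ->
  `|mean P0 (fun w => f (V w)) - mean P0 (fun w => h (V w))| <=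
    e + 2 * M * pr P0 [set w | B < `|V w|].
Proof.
move=> mV cf ch fM hM hf e0; set S := [set w | _ < _].
have bdd (g : 'rV[R]_N -> R) : (forall x, `|g x| <= M) -> [bounded g x | x in [set: 'rV[R]_N]].
  move=> gM; exists M; split; first exact: num_real.
  by move=> M' MM' x _ /=; rewrite (le_trans (gM x))// ltW.
have bf := bmf_row mV cf (bdd _ fM); have bh := bmf_row mV ch (bdd _ hM).
have mS : measurable S by exact: measurable_norm_gt.
rewrite -meanB// (le_trans (mean_norm _ (bmfB bf bh)))//.
have -> : e + 2 * M * pr P0 S = mean P0 (fun w => e + 2 * M * \1_S w).
  rewrite meanD; [|exact: bmf_cst|exact/bmfZ/bmf_indic].
  by rewrite mean_cst meanZ ?mean_indic//; exact: bmf_indic.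
apply: le_mean => [||w].
- exact/bmf_norm/bmfB.
- apply: bmfD; [exact: bmf_cst|exact/bmfZ/bmf_indic].
rewrite indicE; case: (boolP (w \in S)) => [_|wS]; rewrite ?mulr1 ?mulr0 ?addr0.
  rewrite (le_trans (ler_normB _ _))//.
  by have := fM (V w); have := hM (V w); lra.
rewrite distrC hf// leNgt; apply/negP => h'; move/negP : wS; apply.
exact: mem_set.
Qed.

(** Levy's continuity theorem, with tightness as a hypothesis: expectations of
    [cos] of affine forms determine those of trigonometric polynomials, and
    tightness confines the rest to a box, where these are dense. *)
Theorem cos_cvg_weak_cvg (V : nat -> T -> 'rV[R]_N) (W : T' -> 'rV[R]_N) :
  (forall n i, measurable_fun setT (fun w => V n w 0 i)) ->
  (forall i, measurable_fun setT (fun w => W w 0 i)) ->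
  (forall (c : 'cV[R]_N) b, mean P (fun w => cos ((V n w *m c) 0 0 + b)) @[n --> \oo]
     --> mean Q (fun w => cos ((W w *m c) 0 0 + b))) ->
  (forall e : R, 0 < e -> exists B : R, \forall n \near \oo,
     pr P [set w | B < `|V n w|] <= e) ->
  forall f : 'rV[R]_N -> R, continuous f -> [bounded f x | x in setT] ->
  mean P (fun w => f (V n w)) @[n --> \oo] --> mean Q (fun w => f (W w)).
Proof.
move=> mV mW hcos htight f cf bf.
have bcos d0 (T0 : measurableType d0) (U : T0 -> 'rV[R]_N) (g : 'rV[R]_N -> R) :
    (forall i, measurable_fun setT (fun w => U w 0 i)) -> trig_poly g ->
    bmf (fun w => g (U w)).
  move=> mU tg; apply: bmf_row => //; first exact: trig_continuous.
  have [M gM] := trig_bounded tg; exists M; split; first exact: num_real.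
  by move=> M' MM' x _ /=; rewrite (le_trans (gM x))// ltW.
have htrig g : trig_poly g ->
    mean P (fun w => g (V n w)) @[n --> \oo] --> mean Q (fun w => g (W w)).
  elim=> [k c b|{}g g' tg ihg tg' ihg'].
    have bc0 d0 (T0 : measurableType d0) (U : T0 -> 'rV[R]_N) :
        (forall i, measurable_fun setT (fun w => U w 0 i)) ->
        bmf (fun w => cos ((U w *m c) 0 0 + b)).
      move=> mU; have := bcos _ _ _ _ mU (trig_cos 1 c b).
      by congr bmf; apply/funext => w; rewrite mul1r.
    under eq_fun do rewrite (meanZ _ _ (bc0 _ _ _ (mV _))).
    rewrite (meanZ _ _ (bc0 _ _ _ mW)).
    by apply: cvgM; [exact: cvg_cst|exact: hcos].
  under eq_fun do rewrite (meanD _ (bcos _ _ _ _ (mV _) tg) (bcos _ _ _ _ (mV _) tg')).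
  rewrite (meanD _ (bcos _ _ _ _ mW tg) (bcos _ _ _ _ mW tg')).
  exact: cvgD.
have [M0 [_ hM0]] := bf; pose M : R := `|M0| + 1.
have fM x : `|f x| <= M.
  by apply: hM0 => //; rewrite /M (le_lt_trans (ler_norm _))// ltrDl.
have M_gt0 : 0 < M by rewrite ltr_wpDl.
apply/cvgrPdist_le => e e0; pose e' : R := e / 8.
have e'0 : 0 < e' by rewrite divr_gt0.
have eM0 : 0 < e' / (2 * M) by rewrite divr_gt0// mulr_gt0.
have [B1 [n1 _ hB1]] := htight _ eM0.
have [B2 B20 hB2] := tight_row Q mW eM0.
pose B := Num.max B1 B2.
have B0 : 0 < B by rewrite lt_max B20 orbT.
have [h th [hM hf]] := trig_lim_approx cf fM B0 e'0.
have [g tg hg] := th _ e'0.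
have ch := trig_lim_continuous th.
move/cvgrPdist_le : (htrig _ tg) => /(_ _ e'0)[n2 _ hn2].
exists (maxn n1 n2) => // n /=; rewrite geq_max => /andP[nn1 nn2].
have hgU d0 (T0 : measurableType d0) (P0 : probability T0 R) (U : T0 -> 'rV[R]_N) :
    (forall i, measurable_fun setT (fun w => U w 0 i)) ->
    `|mean P0 (fun w => h (U w)) - mean P0 (fun w => g (U w))| <= e'.
  move=> mU; have bh : bmf (fun w => h (U w)).
    apply: bmf_row => //; exists M; split; first exact: num_real.
    by move=> M' MM' x _ /=; rewrite (le_trans (hM x))// ltW.
  have bg := bcos _ _ _ _ mU tg.
  by rewrite -meanB// mean_norm_le//; exact: bmfB.
have hB d0 (T0 : measurableType d0) (P0 : probability T0 R) (U : T0 -> 'rV[R]_N) (B' : R) :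
    (forall i, measurable_fun setT (fun w => U w 0 i)) -> B' <= B ->
    pr P0 [set w | B' < `|U w|] <= e' / (2 * M) ->
    `|mean P0 (fun w => f (U w)) - mean P0 (fun w => h (U w))| <= e' + e'.
  move=> mU B'B hU; rewrite (le_trans (mean_trunc_close _ mU cf ch fM hM hf (ltW e'0)))//.
  rewrite lerD2l mulrC -ler_pdivlMr ?mulr_gt0//; apply: le_trans hU.
  apply: le_pr; [exact: measurable_norm_gt|exact: measurable_norm_gt|].
  by move=> w /=; exact: le_lt_trans.
have a1 := hB _ _ P _ _ (mV n) (_ : B1 <= B) (hB1 n nn1).
have a2 := hB _ _ Q _ _ mW (_ : B2 <= B) hB2.
have {}a1 := a1 ltac:(by rewrite le_max lexx).
have {}a2 := a2 ltac:(by rewrite le_max lexx orbT).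
have a3 := hn2 n nn2; have a4 := hgU _ _ P _ (mV n); have a5 := hgU _ _ Q _ mW.
have ee : e = 8 * e' by rewrite /e'; field.
move: a1 a2 a3 a4 a5; rewrite ee.
rewrite !ler_distl => /andP[? ?] /andP[? ?] /andP[? ?] /andP[? ?] /andP[? ?].
by apply/andP; split; lra.
Qed.

End WeakConvergence.

Section BoundedConvergence.
Context {d : measure_display} {T : measurableType d} {R : realType}.
Variable P : probability T R.

Lemma bounded_cvg_mean (f_ : nat -> T -> R) (f : T -> R) (M : R) :
  (forall n, measurable_fun setT (f_ n)) -> (forall n x, `|f_ n x| <= M) ->
  measurable_fun setT f -> (forall x, f_ n x @[n --> \oo] --> f x) ->
  mean P (f_ n) @[n --> \oo] --> mean P f.
Proof.
move=> mf_ fM mf cf.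
have [|||||intf _ h] := @dominated_convergence _ _ _ P setT measurableT
  (fun n => EFin \o f_ n) (EFin \o f) (EFin \o cst M).
- by move=> n; exact/measurable_EFinP.
- exact/measurable_EFinP.
- by apply: aeW => x _; apply: cvg_EFin; [exact: nearW|exact: cf].
- exact: finite_measure_integrable_cst.
- by apply: aeW => x n _ /=; rewrite lee_fin.
have fin : (\int[P]_x (f x)%:E \is a fin_num)%E by exact: integrable_fin_num.
by apply: fine_cvg; rewrite -/(mean P f) /mean /Rintegral fineK.
Qed.

End BoundedConvergence.

Section ClosedSets.
Context {R : realType} {N : nat}.

Lemma cone_bmf d (T : measurableType d) (V : T -> 'rV[R]_N) (K : set 'rV[R]_N) n :
  (forall i, measurable_fun setT (fun w => V w 0 i)) ->
  bmf (fun w => cone K n (V w)).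
Proof.
by move=> mV; apply: bmf_row => //; [exact: cone_continuous|exact: cone_bounded].
Qed.

Lemma mean_cone_cvg d (T : measurableType d) (P : probability T R)
    (V : T -> 'rV[R]_N) (K : set 'rV[R]_N) :
  (forall i, measurable_fun setT (fun w => V w 0 i)) -> closed K -> K !=set0 ->
  mean P (fun w => cone K n (V w)) @[n --> \oo] --> pr P (V @^-1` K).
Proof.
move=> mV cK K0; rewrite -mean_indic; last first.
  by apply: measurable_preimage_row => //; exact: closed_borel.
apply: (@bounded_cvg_mean _ _ _ _ _ _ 1).
- by move=> n; exact: (cone_bmf K n mV).1.
- by move=> n x; rewrite ger0_norm ?cone_ge0// cone_le1.
- apply: measurable_indic; apply: measurable_preimage_row => //.
  exact: closed_borel.
- by move=> x; exact: cone_cvg.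
Qed.

Lemma sigma_algebra_closed_open : <<s @open 'rV[R]_N >> = <<s @closed 'rV[R]_N >>.
Proof.
apply/seteqP; split; apply: smallest_sub; try exact: smallest_sigma_algebra.
- move=> U oU; rewrite -[U]setCK; apply: (@measurableC _ (g_sigma_algebraType (@closed 'rV[R]_N))).
  by apply: sub_sigma_algebra; rewrite /= closedC.
- by move=> K; exact: closed_borel.
Qed.

Definition row_mfun d (T : measurableType d) (V : T -> 'rV[R]_N)
  (mV : measurable_fun setT (V : T -> borel_rV R N)) : {mfun T >-> borel_rV R N} :=
  mfun_Sub (mem_set mV).

(** A law on rows is determined by the expectations of the [cos] of all affine
    forms. *)
Theorem cos_unique d (T : measurableType d) (P : probability T R)
    d' (T' : measurableType d') (Q : probability T' R)
    (V : T -> 'rV[R]_N) (W : T' -> 'rV[R]_N) :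
  (forall i, measurable_fun setT (fun w => V w 0 i)) ->
  (forall i, measurable_fun setT (fun w => W w 0 i)) ->
  (forall (c : 'cV[R]_N) b, mean P (fun w => cos ((V w *m c) 0 0 + b))
     = mean Q (fun w => cos ((W w *m c) 0 0 + b))) ->
  forall B, borel_set B -> P (V @^-1` B) = Q (W @^-1` B).
Proof.
move=> mV mW hcos.
have hf (f : 'rV[R]_N -> R) : continuous f -> [bounded f x | x in setT] ->
    mean P (fun w => f (V w)) = mean Q (fun w => f (W w)).
  move=> cf bf.
  have h := @cos_cvg_weak_cvg _ _ _ _ P _ _ Q (fun=> V) W (fun=> mV) mW _ _ f cf bf.
  apply: (@cvg_unique _ _ (mean P (fun w => f (V w)) @[_ --> \oo])) => //.
    exact: cvg_cst.
  apply: h => [c b|e e0]; first by rewrite hcos; exact: cvg_cst.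
  by have [B B0 hB] := tight_row P mV e0; exists B; exact: nearW.
have hK K : closed K -> P (V @^-1` K) = Q (W @^-1` K).
  move=> cK; have [->|/set0P K0] := eqVneq K set0.
    by rewrite !preimage_set0 !measure0.
  have bK := closed_borel cK.
  rewrite !prE; [|exact: measurable_preimage_row..]; congr EFin.
  have h1 := mean_cone_cvg (P := P) mV cK K0.
  have h2 := mean_cone_cvg (P := Q) mW cK K0.
  move: h1; under eq_fun do rewrite (hf _ (@cone_continuous _ _ K _) (@cone_bounded _ _ K _)).
  by move=> h1; exact: (cvg_unique _ h1 h2).
pose V' := row_mfun (measurable_row mV); pose W' := row_mfun (measurable_row mW).
move=> B mB; apply: (@measure_unique _ R (borel_rV R N) closed (fun=> setT) _ _ _ _
  (distribution P V') (distribution Q W')) => //.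
- by rewrite -sigma_algebra_closed_open.
- by move=> A C cA cC; exact: closedI.
- by apply/seteqP; split => // x _; exists 0%N.
- by move=> k; rewrite (le_lt_trans (probability_le1 _ _))// ltry.
Qed.

End ClosedSets.

Section NormalCharacteristic.
Context {R : realType}.
Local Notation mu := (@lebesgue_measure R).
Variable s : R.
Hypothesis s0 : s != 0.
Local Notation phi := (normal_pdf 0 s).

Lemma normal_pdf0E (r x : R) : r != 0 ->
  normal_pdf 0 r x = normal_peak r * expR (- x ^+ 2 / (r ^+ 2 * 2)).
Proof. by move=> r0; rewrite normal_pdfE// /normal_fun subr0 mulr_natr. Qed.

Lemma is_derive_normal_pdf (x : R) : is_derive x 1 phi (- (x / s ^+ 2) * phi x).
Proof.
have -> : phi = (fun x => normal_peak s * expR (- x ^+ 2 / (s ^+ 2 * 2))).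
  by apply/funext => y; exact: normal_pdf0E.
apply: is_derive_eq; rewrite /GRing.scale/=; field; exact: s0.
Qed.

Lemma norm_mul_normal_pdf_le (x : R) :
  `|x| * phi x <= 2 * `|s| * normal_peak s / normal_peak (2 * s) * normal_pdf 0 (2 * s) x.
Proof.
have s20 : 2 * s != 0 by rewrite mulf_neq0.
have p2 := normal_peak_gt0 s20.
rewrite normal_pdf0E// normal_pdf0E// mulrCA [leRHS]mulrA divfK ?gt_eqF//.
rewrite (mulrC (2 * `|s|)) -[leRHS]mulrA; apply: ler_wpM2l; first exact: normal_peak_ge0.
have sgt : 0 < `|s| by rewrite normr_gt0.
set t := `|x| / (2 * `|s|).
have xt : `|x| = 2 * `|s| * t by rewrite /t mulrC divfK// gt_eqF// mulr_gt0.
have x2 : x ^+ 2 = 4 * s ^+ 2 * t ^+ 2.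
  by rewrite -[x ^+ 2]real_normK ?num_real// xt -[s ^+ 2 in RHS]real_normK ?num_real//; ring.
rewrite x2 xt -[leLHS]mulrA; apply: ler_wpM2l; first by rewrite mulr_ge0.
rewrite (_ : - _ / _ = - (2 * t ^+ 2)); last by field.
rewrite (_ : - _ / _ = - (t ^+ 2 / 2)); last by field.
apply: (@le_trans _ _ (expR (t ^+ 2) * expR (- (2 * t ^+ 2)))).
  apply: ler_wpM2r; first exact: expR_ge0.
  apply: le_trans (expR_ge1Dx _); rewrite -subr_ge0.
  rewrite (_ : _ - t = (t - 1/2) ^+ 2 + 3 / 4); last by field.
  by rewrite addr_ge0 ?sqr_ge0.
rewrite -expRD ler_expR; have := sqr_ge0 t; lra.
Qed.

Lemma integrable_norm_mul_normal_pdf :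
  mu.-integrable setT (fun x => (`|x| * phi x)%:E).
Proof.
pose C := 2 * `|s| * normal_peak s / normal_peak (2 * s).
apply: (@le_integrable _ _ _ mu _ measurableT _ (fun x => (C%:E * (normal_pdf 0 (2 * s) x)%:E)%E)) => //.
- apply/measurable_EFinP/measurable_funM; first exact: normr_measurable.
  exact: measurable_normal_pdf.
- move=> x _; rewrite lee_fin ger0_norm ?mulr_ge0 ?normal_pdf_ge0//.
  by rewrite (le_trans (norm_mul_normal_pdf_le x))// ler_norm.
- by apply: integrableZl => //; exact: integrable_normal_pdf.
Qed.

Lemma integrable_mul_normal_pdf (g : R -> R) (c0 c1 : R) :
  measurable_fun setT g -> (forall x, `|g x| <= c0 + c1 * `|x|) -> 0 <= c0 -> 0 <= c1 ->
  mu.-integrable setT (fun x => (g x * phi x)%:E).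
Proof.
move=> mg gc c00 c10.
apply: (@le_integrable _ _ _ mu _ measurableT _
  (fun x => (c0%:E * (phi x)%:E + c1%:E * (`|x| * phi x)%:E)%E)) => //.
- by apply/measurable_EFinP/measurable_funM => //; exact: measurable_normal_pdf.
- move=> x _; rewrite lee_fin normrM (ger0_norm (normal_pdf_ge0 0 s x)).
  apply: (@le_trans _ _ ((c0 + c1 * `|x|) * phi x)).
    by rewrite ler_wpM2r ?normal_pdf_ge0.
  by rewrite mulrDl mulrA ler_norm.
- apply: integrableD => //; apply: integrableZl => //.
    exact: integrable_normal_pdf.
  exact: integrable_norm_mul_normal_pdf.
Qed.


Lemma integral_derive_eq0 (F F' : R -> R) :
  (forall x, is_derive x (1 : R) F (F' x)) -> continuous F' ->
  mu.-integrable setT (EFin \o F') ->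
  F n.+1%:R @[n --> \oo] --> (0 : R) -> F (- n.+1%:R) @[n --> \oo] --> (0 : R) ->
  (\int[mu]_x (F' x)%:E = 0)%E.
Proof.
move=> dF cF' iF' Fp Fm.
pose I n : set R := `[- n.+1%:R, n.+1%:R]%classic.
have cF : continuous F.
  by move=> x; apply: differentiable_continuous; apply/derivable1_diffP; exact: ex_derive.
have mF' : measurable_fun setT (EFin \o F').
  by apply/measurable_EFinP; exact: continuous_measurable_fun.
have h1 n : (\int[mu]_x ((EFin \o F') \_ (I n)) x = (F n.+1%:R - F (- n.+1%:R))%:E)%E.
  rewrite -integral_mkcond EFinB; apply: continuous_FTC2.
  - by rewrite gtrN// ltr0n.
  - exact: continuous_subspaceT.
  - split; first by move=> x _; exact: ex_derive.
      by apply: cvg_at_right_filter; exact: cF.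
    by apply: cvg_at_left_filter; exact: cF.
  - by move=> x _; rewrite derive1E; exact: derive_val.
have [|||||_ _ h] := @dominated_convergence _ _ _ mu setT measurableT
  (fun n => (EFin \o F') \_ (I n)) (EFin \o F') (abse \o (EFin \o F')) => //.
- move=> n; apply/(measurable_restrictT _ _).1; last exact: measurable_funTS.
  exact: measurable_itv.
- apply: aeW => x _; apply: cvg_near_cst.
  exists (Num.truncn `|x|) => // n /= hn; rewrite patchE mem_set//.
  rewrite /I/= in_itv/= -ler_norml (le_trans (ltW (truncnS_gt _)))//.
  by rewrite ler_nat.
- exact: integrable_abse.
- apply: aeW => x n _ /=; rewrite patchE; case: ifPn => // _.
  by rewrite /= ?abse0 ?normr0 lee_fin.
have h2 : (F n.+1%:R - F (- n.+1%:R))%:E @[n --> \oo] --> 0%:E.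
  apply: cvg_EFin; first exact: nearW.
  by rewrite -[X in _ --> X](subr0 (0 : R)); exact: cvgB.
apply: (cvg_unique _ h) => //.
by move: h2; under eq_fun do rewrite -h1.
Qed.

Definition normal_cos_mean (b t : R) : R := \int[mu]_x (cos (t * x + b) * phi x).

Lemma integrable_cos_normal_pdf b t :
  mu.-integrable setT (fun x => (cos (t * x + b) * phi x)%:E).
Proof.
apply: (@integrable_mul_normal_pdf _ 1 0) => //.
  apply: measurableT_comp; first by apply: continuous_measurable_fun; exact: continuous_cos.
  by apply: measurable_funD => //; exact: measurable_funM.
by move=> x; rewrite mul0r addr0 cos_max.
Qed.

Lemma integrable_sin_normal_pdf b t :
  mu.-integrable setT (fun x => (- x * sin (t * x + b) * phi x)%:E).
Proof.
apply: (@integrable_mul_normal_pdf _ 0 1) => //.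
  apply: measurable_funM => //.
  apply: measurableT_comp; first by apply: continuous_measurable_fun; exact: continuous_sin.
  by apply: measurable_funD => //; exact: measurable_funM.
by move=> x; rewrite mul1r add0r normrM normrN ler_piMr// sin_max.
Qed.

(** Integration by parts: [(sin (t x + b) phi x)'] integrates to 0. *)
Lemma normal_sin_mean b t :
  \int[mu]_x (- x * sin (t * x + b) * phi x) = - (s ^+ 2 * t * normal_cos_mean b t).
Proof.
pose F' x : R := t * (cos (t * x + b) * phi x) + s ^- 2 * (- x * sin (t * x + b) * phi x).
have dF (x : R) : is_derive x (1 : R) (fun x => sin (t * x + b) * phi x) (F' x).
  have := is_derive_normal_pdf x => ?.
  apply: is_derive_eq; rewrite /GRing.scale/= /F'; field; exact: s0.
have iF1 := integrable_cos_normal_pdf b t.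
have iF2 := integrable_sin_normal_pdf b t.
have F'E x : (F' x)%:E = (t%:E * (cos (t * x + b) * phi x)%:E +
    (s ^- 2)%:E * (- x * sin (t * x + b) * phi x)%:E)%E by [].
pose C := 2 * `|s| * normal_peak s / normal_peak (2 * s) * normal_peak (2 * s).
have tail (g : nat -> R) : (forall n, `|g n| = n.+1%:R) ->
    sin (t * g n + b) * phi (g n) @[n --> \oo] --> (0 : R).
  move=> gE; apply/norm_cvg0P.
  apply: (@squeeze_cvgr _ _ _ _ (fun=> 0) (fun n => C * n.+1%:R^-1)).
  - apply: nearW => n; rewrite normr_ge0/= normrM (ger0_norm (normal_pdf_ge0 _ _ _)).
    apply: (@le_trans _ _ (phi (g n))).
      by rewrite ler_piMl ?normal_pdf_ge0// sin_max.
    rewrite ler_pdivlMr ?ltr0n// mulrC -gE (le_trans (norm_mul_normal_pdf_le _))//.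
    apply: ler_wpM2l; last by apply: normal_pdf_ub; rewrite mulf_neq0.
    by rewrite divr_ge0 ?normal_peak_ge0// mulr_ge0 ?normal_peak_ge0// mulr_ge0.
  - exact: cvg_cst.
  - rewrite -[X in _ --> X](mulr0 C); apply: cvgM; first exact: cvg_cst.
    exact: cvg_harmonic.
have : (\int[mu]_x (F' x)%:E = 0)%E.
  apply: (integral_derive_eq0 dF).
  - move=> x; apply: differentiable_continuous; apply/derivable1_diffP.
    have := is_derive_normal_pdf x => ?; rewrite /F'; exact: ex_derive.
  - rewrite (_ : _ \o _ = fun x => (t%:E * (cos (t * x + b) * phi x)%:E +
      (s ^- 2)%:E * (- x * sin (t * x + b) * phi x)%:E)%E)//.
    by apply: integrableD => //; apply: integrableZl.
  - by apply: tail => n; rewrite ger0_norm.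
  - by apply: (tail (fun n => - n.+1%:R)) => n; rewrite normrN ger0_norm.
under eq_integral do rewrite F'E.
rewrite integralD//=; [|exact: integrableZl..].
rewrite !integralZl//.
have fin1 := integrable_fin_num measurableT iF1.
have fin2 := integrable_fin_num measurableT iF2.
rewrite -(fineK fin1) -(fineK fin2) -!EFinM -EFinD => -[].
rewrite -/(normal_cos_mean b t) -/(Rintegral mu setT _).
set u := Rintegral _ _ _; set v := Rintegral _ _ _ => h.
have h2 : s ^+ 2 * (t * u + s ^- 2 * v) = 0 by rewrite h mulr0.
have : s ^+ 2 * (t * u + s ^- 2 * v) = s ^+ 2 * t * u + v by field; exact: s0.
rewrite h2 /normal_cos_mean -/u => h3; lra.
Qed.

Lemma is_derive_normal_cos_mean b (t : R) :
  is_derive t (1 : R) (normal_cos_mean b) (- (s ^+ 2 * t * normal_cos_mean b t)).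
Proof.
pose f (t x : R) := cos (t * x + b) * phi x.
have tI : `](t - 1), (t + 1)[%classic t by rewrite /= in_itv/= ltrBlDr ltrDl ltr01.
have iF x : `](t - 1), (t + 1)[%classic x -> mu.-integrable setT (EFin \o f x).
  by move=> _; exact: integrable_cos_normal_pdf.
have df (x y : R) : is_derive x (1 : R) (f ^~ y) (- y * sin (x * y + b) * phi y).
  by apply: is_derive_eq; rewrite /GRing.scale/=; ring.
have d1 x y : `](t - 1), (t + 1)[%classic x -> setT y -> derivable (f ^~ y) x 1.
  by move=> _ _; exact: ex_derive.
have p1 x y : partial1of2 f x y = - y * sin (x * y + b) * phi y.
  by rewrite partial1of2E; exact: derive_val.
have G_ub x y : `](t - 1), (t + 1)[%classic x -> setT y -> `|partial1of2 f x y| <= `|y| * phi y.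
  move=> _ _; rewrite p1 normrM (ger0_norm (normal_pdf_ge0 _ _ _)) ler_wpM2r ?normal_pdf_ge0//.
  by rewrite normrM normrN ler_piMr// sin_max.
have G0 y : 0 <= `|y| * phi y by rewrite mulr_ge0// normal_pdf_ge0.
have D := derivable_under_integral measurableT tI iF d1 G0 integrable_norm_mul_normal_pdf G_ub.
have E := differentiation_under_integral measurableT tI iF d1 G0 integrable_norm_mul_normal_pdf G_ub.
apply: DeriveDef; first exact: D.
rewrite -derive1E -normal_sin_mean /normal_cos_mean E.
by apply: eq_Rintegral => x _; rewrite p1.
Qed.

Lemma normal_cos_meanE b t :
  normal_cos_mean b t = expR (- (t ^+ 2 * s ^+ 2 / 2)) * cos b.
Proof.
pose K (t : R) := normal_cos_mean b t * expR (t ^+ 2 * s ^+ 2 / 2).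
have dK (x : R) : is_derive x (1 : R) K 0.
  have := is_derive_normal_cos_mean b x => ?.
  by apply: is_derive_eq; rewrite /GRing.scale/=; field.
have := @is_derive_0_is_cst _ K t 0 dK.
rewrite /K expr0n !mul0r expR0 mulr1 => h.
have h0 : normal_cos_mean b 0 = cos b.
  rewrite /normal_cos_mean; under eq_Rintegral do rewrite mul0r add0r.
  rewrite RintegralZl//; last exact: integrable_normal_pdf.
  by rewrite /Rintegral integral_normal_pdf mulr1.
by rewrite expRN -h0 -h mulrC mulfK// gt_eqF// expR_gt0.
Qed.

End NormalCharacteristic.

Section GaussianRow.
Context {R : realType}.
Local Notation mu := (@lebesgue_measure R).

Lemma mean_normal_prob (s : R) (g : R -> R) : s != 0 -> bmf g ->
  mean (normal_prob 0 s) g = \int[mu]_x (g x * normal_pdf 0 s x).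
Proof.
move=> s0 bg; have ig := bmf_integrable (normal_prob 0 s) bg.
have dom := normal_prob_dominates 0 s.
rewrite /mean /Rintegral; congr fine.
rewrite -(Radon_Nikodym_change_of_variables dom measurableT ig).
apply: ae_eq_integral => //.
- apply: emeasurable_funM.
    by apply/measurable_EFinP; exact: (proj1 bg).
  by apply: (measurable_int mu); apply: Radon_Nikodym_integrable; exact: dom.
- apply/measurable_EFinP; apply: measurable_funM; first exact: (proj1 bg).
  exact: measurable_normal_pdf.
under [X in ae_eq _ _ _ X]eq_fun do rewrite EFinM.
apply: ae_eqe_mul2l => /=.
apply: integral_ae_eq => //.
- apply: Radon_Nikodym_integrable; exact: dom.
- by apply/measurable_EFinP; exact: measurable_normal_pdf.
- move=> E _ mE; rewrite -Radon_Nikodym_integral//.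
Qed.

Lemma mean_cos_normal_prob (s t b : R) : s != 0 ->
  mean (normal_prob 0 s) (fun x => cos (t * x + b)) =
    expR (- (t ^+ 2 * s ^+ 2 / 2)) * cos b.
Proof.
move=> s0; rewrite mean_normal_prob//; first exact: normal_cos_meanE.
by apply: bmf_cos; apply: measurable_funD => //; exact: measurable_funM.
Qed.

Lemma mean_prod d1 (T1 : measurableType d1) d2 (T2 : measurableType d2)
    (P1 : probability T1 R) (P2 : probability T2 R) (f : T1 * T2 -> R) :
  bmf f -> mean (P1 \x P2)%E f = mean P1 (fun x => mean P2 (fun y => f (x, y))).
Proof.
move=> bf; have if_ := bmf_integrable (P1 \x P2)%E bf.
rewrite /mean /Rintegral -(integral12_prod_meas1 if_); congr fine.
apply: eq_integral => x _; rewrite fineK//.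
apply: integrable_fin_num => //; apply: (@bmf_integrable _ _ _ P2 (fun y => f (x, y))).
case: bf => mf [M fM]; split; last by exists M.
by apply: (measurableT_comp mf); exact: measurable_pair1.
Qed.

(** A centered Gaussian row, described by its characteristic function and
    built one coordinate at a time: with [a = C 0 0] and [g] standard normal and
    independent of [Z'], the row [(sqrt a * g, Z' + (sqrt a / a) * g * r)]
    works, where [r] is the rest of the first row of [C] and the
    covariance of [Z'] is the Schur complement of [a]. *)
Lemma gaussian_row_exists n (C : 'M[R]_n) : C^T = C ->
  (forall c : 'cV[R]_n, 0 <= (c^T *m C *m c) 0 0) ->
  exists d (T : measurableType d) (Q : probability T R) (Z : T -> 'rV[R]_n),
    (forall i, measurable_fun setT (fun w => Z w 0 i)) /\
    forall (c : 'cV[R]_n) b, mean Q (fun w => cos ((Z w *m c) 0 0 + b)) =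
      expR (- ((c^T *m C *m c) 0 0 / 2)) * cos b.
Proof.
elim: n C => [|n IHn] C symC psdC.
  exists _, _, (normal_prob (0 : R) 1 : probability _ R), (fun=> 0); split => [|c b]; first by case.
  have -> : (c^T *m C *m c) 0 0 = 0 by rewrite mxE big_ord0.
  rewrite mul0r oppr0 expR0 mul1r -[RHS](@mean_cst _ _ _ (normal_prob 0 1)).
  by congr mean; apply/funext => w; rewrite mul0mx mxE add0r.
pose C' : 'M[R]_(1 + n) := C.
pose a := C 0 0; pose r : 'rV[R]_n := ursubmx C'; pose D : 'M[R]_n := drsubmx C'.
have CE : C' = block_mx a%:M r r^T D.
  rewrite -[LHS]submxK -/r -/D; congr block_mx.
    by apply/rowP => i; rewrite !ord1 !mxE/= mulr1n; congr (C _ _); apply: val_inj.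
  by rewrite /r trmx_ursub /C' symC.
have quad (x : R) (c : 'cV[R]_n) :
    ((col_mx x%:M c)^T *m C' *m col_mx x%:M c) 0 0 =
    a * x ^+ 2 + 2 * x * (r *m c) 0 0 + (c^T *m D *m c) 0 0.
  rewrite CE tr_col_mx mul_row_block mul_row_col tr_scalar_mx.
  rewrite -trmx_mul !mul_scalar_mx mul_mx_scalar mulmxDl -scalemxAl.
  move: (r *m c) (c^T *m D *m c) => u v.
  by rewrite !mxE/= mulr1n; ring.
have quad0 (x : R) (c : 'cV[R]_n) : 0 <= a * x ^+ 2 + 2 * x * (r *m c) 0 0 + (c^T *m D *m c) 0 0.
  by rewrite -quad; exact: psdC.
have a0 : 0 <= a.
  have := quad0 1 0; rewrite !mulmx0 !mxE mulr0 !addr0 expr1n mulr1; exact.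
have ar0 (c : 'cV[R]_n) : a = 0 -> (r *m c) 0 0 = 0.
  move=> aE; apply/eqP; apply: contraT => rc0.
  have := quad0 (- ((c^T *m D *m c) 0 0 + 1) / (2 * (r *m c) 0 0)) c.
  rewrite aE mul0r add0r; move: ((r *m c) 0 0) ((c^T *m D *m c) 0 0) rc0 => u v u0.
  rewrite (_ : _ + v = -1); last by field.
  by rewrite ler0N1.
pose S : 'M[R]_n := D - a^-1 *: (r^T *m r).
have SE (c : 'cV[R]_n) : (c^T *m S *m c) 0 0 =
    (c^T *m D *m c) 0 0 - a^-1 * (r *m c) 0 0 ^+ 2.
  have h : c^T *m (a^-1 *: (r^T *m r)) *m c = a^-1 *: ((r *m c)^T *m (r *m c)).
    by rewrite -scalemxAr -scalemxAl trmx_mul !mulmxA.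
  rewrite mulmxBr mulmxBl h.
  have -> : (r *m c)^T *m (r *m c) = ((r *m c) 0 0 ^+ 2)%:M.
    rewrite [r *m c]mx11_scalar tr_scalar_mx -scalar_mxM expr2.
    by rewrite !mxE/= mulr1n.
  by rewrite !mxE/= mulr1n.
have symS : S^T = S.
  rewrite /S linearB/= linearZ/= trmx_mul trmxK; congr (_ - _).
  by rewrite /D trmx_drsub /C' symC.
have [|d [T [Q [Z' [mZ' hZ']]]]] := IHn S symS.
  move=> c; rewrite SE.
  have := quad0 (- (r *m c) 0 0 / a) c; have [aE|an0] := eqVneq a 0.
    by rewrite (ar0 _ aE) aE; congr (_ <= _); ring.
  by congr (_ <= _); field.
pose Z (z : T * R) : 'rV[R]_(1 + n) :=
  row_mx (Num.sqrt a * z.2)%:M (Z' z.1 + (Num.sqrt a / a * z.2) *: r).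
exists _, _, (Q \x (normal_prob (0 : R) 1))%E, Z; split => [i|c b].
  have [j ->|j ->] := split_ordP (i : 'I_(1 + n)).
    rewrite (_ : (fun _ => _) = fun z => Num.sqrt a * z.2); last first.
      by apply/funext => z; etransitivity; [exact: row_mxEl|rewrite ord1 mxE mulr1n].
    by apply: measurable_funM => //; exact: measurable_snd.
  rewrite (_ : (fun _ => _) = fun z => Z' z.1 0 j + Num.sqrt a / a * z.2 * r 0 j); last first.
    by apply/funext => z; etransitivity; [exact: row_mxEr|rewrite !mxE].
  apply: measurable_funD; first exact: (measurableT_comp (mZ' j) measurable_fst).
  apply: measurable_funM => //; apply: measurable_funM => //.
have {c}[x [c ->]] : exists x c', c = col_mx (x%:M : 'M[R]_1) (c' : 'cV[R]_n).
  exists (usubmx (c : 'cV_(1 + n)) 0 0), (dsubmx (c : 'cV_(1 + n))).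
  by rewrite -mx11_scalar vsubmxK.
pose tau := Num.sqrt a * x + Num.sqrt a / a * (r *m c) 0 0.
have ZE z : (Z z *m col_mx x%:M c) 0 0 = tau * z.2 + (Z' z.1 *m c) 0 0.
  rewrite /Z mul_row_col mulmxDl -scalemxAl -scalar_mxM /tau.
  by rewrite !mxE/= mulr1n; ring.
rewrite quad.
transitivity (mean (Q \x (normal_prob (0 : R) 1))%E
    (fun z => cos (tau * z.2 + ((Z' z.1 *m c) 0 0 + b)))).
  by congr mean; apply/funext => z; rewrite ZE addrA.
have mA : measurable_fun setT (fun w => (Z' w *m c) 0 0).
  rewrite (_ : (fun _ => _) = fun w => \sum_j Z' w 0 j * c j 0); last first.
    by apply/funext => w; rewrite mxE.
  by apply: measurable_sum => j; apply: measurable_funM => //; exact: mZ'.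
rewrite mean_prod; last first.
  apply: bmf_cos; apply: measurable_funD.
    by apply: measurable_funM => //; exact: measurable_snd.
  apply: measurable_funD => //; exact: (measurableT_comp mA measurable_fst).
transitivity (mean Q (fun w => expR (- (tau ^+ 2 / 2)) * cos ((Z' w *m c) 0 0 + b))).
  congr mean; apply/funext => w /=; rewrite mean_cos_normal_prob ?oner_neq0//.
  by rewrite expr1n mulr1.
rewrite meanZ; last by apply/bmf_cos/measurable_funD.
rewrite hZ' mulrA -expRD; congr (expR _ * _); rewrite SE /tau.
have sa : Num.sqrt a ^+ 2 = a by exact: sqr_sqrtr.
rewrite (_ : (_ + _) ^+ 2 = Num.sqrt a ^+ 2 * (x + a^-1 * (r *m c) 0 0) ^+ 2); last by ring.
rewrite sa; have [aE|an0] := eqVneq a 0; last by field.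
by rewrite (ar0 _ aE) aE; ring.
Qed.

End GaussianRow.

Section GaussianLimit.
Context {R : realType}.

Lemma measurable_linform d (T : measurableType d) n (Z : T -> 'rV[R]_n) (c : 'cV[R]_n) :
  (forall i, measurable_fun setT (fun w => Z w 0 i)) ->
  measurable_fun setT (fun w => (Z w *m c) 0 0).
Proof.
move=> mZ; rewrite (_ : (fun _ => _) = fun w => \sum_j Z w 0 j * c j 0); last first.
  by apply/funext => w; rewrite mxE.
by apply: measurable_sum => j; apply: measurable_funM => //; exact: mZ.
Qed.

Lemma mean_dirac (a : R) (g : R -> R) : measurable_fun setT g ->
  mean (\d_a : probability R R) g = g a.
Proof.
move=> mg; rewrite /mean /Rintegral integral_dirac//; last exact/measurable_EFinP.
by rewrite diracT mul1e.
Qed.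

(** A real random variable with the characteristic function of [N(0, v)] has
    that law. *)
Lemma cos_normal_law d (T : measurableType d) (Q : probability T R) (g : T -> R) (v : R) :
  measurable_fun setT g -> 0 <= v ->
  (forall t b, mean Q (fun w => cos (t * g w + b)) = expR (- (t ^+ 2 * v / 2)) * cos b) ->
  forall B, measurable B -> Q (g @^-1` B) = normal_law 0 v B.
Proof.
move=> mg v0 hcos B mB.
pose V (w : T) : 'rV[R]_1 := \row_i g w; pose W (x : R) : 'rV[R]_1 := \row_i x.
pose B' : set 'rV[R]_1 := [set y | B (y 0 0)].
have bB' : borel_set B'.
  rewrite -[borel_set _]/(@measurable _ (borel_rV R 1) B').
  by rewrite -[B']setTI; exact: (@measurable_coord R 1 0).
have mV i : measurable_fun setT (fun w => V w 0 i).
  by rewrite (_ : (fun _ => _) = g)//; apply/funext => w; rewrite mxE.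
have mW i : measurable_fun setT (fun w => W w 0 i).
  by rewrite (_ : (fun _ => _) = id)//; apply/funext => w; rewrite mxE.
have -> : g @^-1` B = V @^-1` B'.
  by apply/seteqP; split => w /=; rewrite /B' /= mxE.
have WB : B = W @^-1` B'.
  by apply/seteqP; split => w /=; rewrite /B' /= mxE.
have Vc (c : 'cV[R]_1) w : (V w *m c) 0 0 = c 0 0 * g w.
  by rewrite mxE big_ord1 mxE mulrC.
have Wc (c : 'cV[R]_1) w : (W w *m c) 0 0 = c 0 0 * w.
  by rewrite mxE big_ord1 mxE mulrC.
rewrite /normal_law; case: (eqVneq v 0) => [vE|vn0].
  rewrite [in RHS]WB.
  apply: (cos_unique (Q := (\d_(0 : R) : probability R R)) mV mW) => // c b.
  under eq_fun do rewrite Vc; under [in RHS]eq_fun do rewrite Wc.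
  rewrite hcos vE mulr0 mul0r oppr0 expR0 mul1r mean_dirac ?mulr0 ?add0r//.
  by refine (bmf_cos _).1; apply: measurable_funD => //; exact: measurable_funM.
rewrite [in RHS]WB.
have sv0 : Num.sqrt v != 0 by rewrite gt_eqF// sqrtr_gt0 lt_neqAle eq_sym vn0.
apply: (cos_unique (Q := (normal_prob 0 (Num.sqrt v) : probability _ R)) mV mW) => // c b.
under eq_fun do rewrite Vc; under [in RHS]eq_fun do rewrite Wc.
by rewrite hcos mean_cos_normal_prob// sqr_sqrtr.
Qed.

Theorem cos_cvg_to_gaussian d (T : measurableType d) (P : probability T R) N
    (V : nat -> T -> 'rV[R]_N) (C : 'M[R]_N) :
  (forall n i, measurable_fun setT (fun w => V n w 0 i)) ->
  C^T = C -> (forall c : 'cV[R]_N, 0 <= (c^T *m C *m c) 0 0) ->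
  (forall (c : 'cV[R]_N) b, mean P (fun w => cos ((V n w *m c) 0 0 + b)) @[n --> \oo]
     --> expR (- ((c^T *m C *m c) 0 0 / 2)) * cos b) ->
  (forall e : R, 0 < e -> exists B : R, \forall n \near \oo,
     pr P [set w | B < `|V n w|] <= e) ->
  cvg_to_gaussian P V 0 C.
Proof.
move=> mV symC psdC hcos htight.
have [d' [T' [Q [Z [mZ hZ]]]]] := gaussian_row_exists symC psdC.
exists (distribution Q (row_mfun (measurable_row mZ))); split.
  split=> // c v; split; first exact: psdC.
  move=> B mB; rewrite mul0mx mxE.
  apply: (cos_normal_law (g := fun w => (Z w *m c) 0 0)) => //.
  - exact: measurable_linform.
  - exact: psdC.
  - move=> t b.
    transitivity (mean Q (fun w => cos ((Z w *m (t *: c)) 0 0 + b))).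
      by congr mean; apply/funext => w; rewrite -scalemxAr [in RHS]mxE.
    rewrite hZ; congr (expR (- (_ / 2)) * _).
    by rewrite -scalemxAr (_ : (t *: c)^T = t *: c^T) ?linearZ// -!scalemxAl scalerA mxE expr2.
move=> f cf bf.
have -> : \int[distribution Q (row_mfun (measurable_row mZ))]_x f x = mean Q (fun w => f (Z w)).
  rewrite /mean /Rintegral integral_distribution//.
    by apply/measurable_EFinP; exact: continuous_measurable_row.
  exact/bmf_integrable/bmf_row.
apply: cos_cvg_weak_cvg => // c b; rewrite hZ; exact: hcos.
Qed.

End GaussianLimit.

Section MixingCovariance.
Context {d : measure_display} {T : measurableType d} {R : realType}.
Variable P : probability T R.

Definition cov (F G : T -> R) : R := mean P (fun w => F w * G w) - mean P F * mean P G.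

Lemma covBl F F' G : bmf F -> bmf F' -> bmf G ->
  cov (fun w => F w - F' w) G = cov F G - cov F' G.
Proof.
move=> bF bF' bG; rewrite /cov meanB//.
rewrite (_ : (fun w => (F w - F' w) * G w) = (fun w => F w * G w - F' w * G w)); last first.
  by apply/funext => w; rewrite mulrBl.
by rewrite meanB; [ring|exact: bmfM..].
Qed.

Lemma covC F G : cov F G = cov G F.
Proof.
rewrite /cov mulrC; congr (_ - _); congr mean.
by apply/funext => w; rewrite mulrC.
Qed.

Lemma cov_norm_le F G M M' : bmf F -> bmf G -> (forall w, `|F w| <= M) ->
  (forall w, `|G w| <= M') -> `|cov F G| <= 2 * (M * M').
Proof.
move=> bF bG FM GM.
have h1 : `|mean P (fun w => F w * G w)| <= M * M'.
  by apply: mean_norm_le; [exact: bmfM|move=> w; rewrite normrM ler_pM].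
have h2 : `|mean P F * mean P G| <= M * M'.
  by rewrite normrM ler_pM// mean_norm_le.
by rewrite (le_trans (ler_normB _ _))//; lra.
Qed.

Lemma cov_sum (I J : Type) (r : seq I) (r' : seq J) (F : I -> T -> R) (G : J -> T -> R) :
  (forall i, bmf (F i)) -> (forall j, bmf (G j)) ->
  cov (fun w => \sum_(i <- r) F i w) (fun w => \sum_(j <- r') G j w) =
  \sum_(i <- r) \sum_(j <- r') cov (F i) (G j).
Proof.
move=> bF bG; rewrite /cov mean_sum// mean_sum//.
under [RHS]eq_bigr do rewrite sumrB; rewrite sumrB; congr (_ - _); last first.
  by rewrite mulr_suml; apply: eq_bigr => i _; rewrite mulr_sumr.
transitivity (mean P (fun w => \sum_(i <- r) \sum_(j <- r') F i w * G j w)).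
  congr mean; apply/funext => w.
  by rewrite mulr_suml; apply: eq_bigr => i _; rewrite mulr_sumr.
rewrite mean_sum => [|i _]; last by apply: bmf_sum => j _; exact: bmfM.
by apply: eq_bigr => i _; rewrite mean_sum// => j _; exact: bmfM.
Qed.

Lemma cov_affine k l k' l' F G : bmf F -> bmf G ->
  cov (fun w => k + l * F w) (fun w => k' + l' * G w) = l * l' * cov F G.
Proof.
move=> bF bG; rewrite /cov.
have e1 : mean P (fun w => k + l * F w) = k + l * mean P F.
  by rewrite meanD ?mean_cst ?meanZ//; [exact: bmf_cst|exact: bmfZ].
have e2 : mean P (fun w => k' + l' * G w) = k' + l' * mean P G.
  by rewrite meanD ?mean_cst ?meanZ//; [exact: bmf_cst|exact: bmfZ].
have -> : (fun w => (k + l * F w) * (k' + l' * G w)) =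
  (fun w => (k * k' + (k * l') * G w) + ((l * k') * F w + (l * l') * (F w * G w))).
  by apply/funext => w; ring.
have bFG := bmfM bF bG.
rewrite meanD; [|apply: bmfD; [exact: bmf_cst|exact: bmfZ]|by apply: bmfD; exact: bmfZ].
rewrite meanD; [|exact: bmf_cst|exact: bmfZ].
rewrite meanD; [|exact: bmfZ..].
by rewrite e1 e2 mean_cst !meanZ//; ring.
Qed.

(** Number of positive integers [<= y], cut at [n]. *)
Definition level_count (n : nat) (y : R) : R := \sum_(i < n) ((i.+1%:R <= y)%R : nat)%:R.

Lemma level_countP n y : 0 <= y <= n%:R ->
  0 <= y - level_count n y <= 1.
Proof.
move=> /andP[y0 yn].
have full k : k%:R <= y -> level_count k y = k%:R.
  move=> ky; rewrite /level_count (eq_bigr (fun=> 1)) => [|i _].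
    by rewrite sumr_const card_ord.
  by rewrite (le_trans _ ky)// ler_nat.
elim: n yn => [|n ih] yn; first by rewrite /level_count big_ord0 subr0 y0 (le_trans yn).
have [yS|yS] := leP n.+1%:R y.
  by rewrite full// subr_ge0 yS/= lerBlDr (le_trans yn)// lerDr.
rewrite /level_count big_ord_recr/= (lt_geF yS) addr0 -/(level_count n y).
have [yn'|/ltW yn'] := leP y n%:R; first exact: ih.
rewrite full// subr_ge0 yn'/= lerBlDr; rewrite -natr1 in yn; lra.
Qed.

Definition level_approx (M : R) (K : nat) (F : T -> R) (w : T) : R :=
  - M + M / K%:R * \sum_(i < 2 * K) \1_[set w | i.+1%:R * (M / K%:R) - M <= F w] w.

Lemma level_approxP M K F w : 0 < M -> (0 < K)%N -> `|F w| <= M ->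
  `|F w - level_approx M K F w| <= M / K%:R.
Proof.
move=> M0 K0 FM; have K0' : 0 < K%:R :> R by rewrite ltr0n.
pose q := M / K%:R; have q0 : 0 < q by rewrite divr_gt0.
pose y := (F w + M) / q.
have yE : F w = - M + q * y by rewrite /y mulrC divfK ?gt_eqF//; ring.
have -> : level_approx M K F w = - M + q * level_count (2 * K) y.
  rewrite /level_approx; congr (_ + _ * _); apply: eq_bigr => i _.
  rewrite indicE; congr (_%:R); congr nat_of_bool.
  apply/idP/idP => [/set_mem/=|h]; first by rewrite ler_pdivlMr// lerBlDr.
  by apply/mem_set => /=; rewrite lerBlDr -ler_pdivlMr.
have : 0 <= y <= (2 * K)%:R.
  move: FM; rewrite ler_norml => /andP[F1 F2]; apply/andP; split.
    by rewrite divr_ge0// ?(ltW q0)//; lra.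
  rewrite ler_pdivrMr// natrM /q -mulrA [K%:R * _]mulrC divfK ?gt_eqF//; lra.
move=> /level_countP /andP[h1 h2].
rewrite {1}yE (_ : _ - _ = q * (y - level_count (2 * K) y)); last by ring.
rewrite -[leRHS]/q ger0_norm; last by rewrite mulr_ge0// ltW.
by rewrite ler_piMr// ltW.
Qed.

Lemma measurable_level (F : T -> R) (x : R) : measurable_fun setT F ->
  measurable [set w | x <= F w].
Proof.
move=> mF; rewrite -[X in measurable X]setTI.
rewrite (_ : [set w | _] = F @^-1` `[x, +oo[%classic).
  exact: mF.
by apply/seteqP; split => w /=; rewrite in_itv/= andbT.
Qed.

Lemma cov_indic (A B : set T) : measurable A -> measurable B ->
  cov \1_A \1_B = pr P (A `&` B) - pr P A * pr P B.
Proof.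
move=> mA mB; rewrite /cov !mean_indic//; congr (_ - _).
rewrite -mean_indic; last exact: measurableI.
by congr mean; apply/funext => w; rewrite indicI.
Qed.

(** Covariance inequality for strong mixing: slicing [F] and [G] along their
    level sets writes the covariance as an average of at most
    [(2 K)^2] covariances of indicators, with weights [M M' / K^2]. *)
Theorem cov_le_mixing (F G : T -> R) (M M' a : R) : 0 < M -> 0 < M' ->
  measurable_fun setT F -> measurable_fun setT G ->
  (forall w, `|F w| <= M) -> (forall w, `|G w| <= M') ->
  (forall x y, `|pr P ([set w | (x <= F w)%R] `&` [set w | (y <= G w)%R]) -
     pr P [set w | (x <= F w)%R] * pr P [set w | (y <= G w)%R]| <= a) ->
  `|cov F G| <= 4 * (M * M') * a.
Proof.
move=> M0 M'0 mF mG FM GM h.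
have bF : bmf F by split => //; exists M.
have bG : bmf G by split => //; exists M'.
have bi (H : T -> R) x : measurable_fun setT H -> bmf (\1_[set w | x <= H w] : T -> R).
  by move=> mH; apply: bmf_indic; exact: measurable_level.
have bL (H : T -> R) Q K : measurable_fun setT H -> bmf (level_approx Q K H).
  move=> mH; apply: bmfD; first exact: bmf_cst.
  by apply: bmfZ; apply: bmf_sum => i _; exact: bi.
have key K : (0 < K)%N -> `|cov F G| <= 4 * (M * M') * a + 6 * (M * M') / K%:R.
  move=> K0; have K0' : 0 < K%:R :> R by rewrite ltr0n.
  pose FK := level_approx M K F; pose GK := level_approx M' K G.
  have dF w : `|F w - FK w| <= M / K%:R by exact: level_approxP.
  have dG w : `|G w - GK w| <= M' / K%:R by exact: level_approxP.
  have bFK : bmf FK by exact: bL. have bGK : bmf GK by exact: bL.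
  have FKM w : `|FK w| <= 2 * M.
    rewrite (_ : FK w = F w - (F w - FK w)); last by ring.
    rewrite (le_trans (ler_normB _ _))// (_ : 2 * M = M + M); last by ring.
    rewrite lerD// (le_trans (dF w))// ler_pdivrMr// ler_peMr ?(ltW M0)//.
    by rewrite ler1n.
  have e1 : `|cov (fun w => F w - FK w) G| <= 2 * (M / K%:R * M').
    by apply: cov_norm_le => //; exact: bmfB.
  have e2 : `|cov FK (fun w => G w - GK w)| <= 2 * (2 * M * (M' / K%:R)).
    by apply: cov_norm_le => //; exact: bmfB.
  have e3 : `|cov FK GK| <= 4 * (M * M') * a.
    rewrite /FK /GK /level_approx cov_affine; last 2 first.
    - by apply: bmf_sum => i _; exact: bi.
    - by apply: bmf_sum => i _; exact: bi.
    rewrite cov_sum; [|by move=> i; exact: bi|by move=> i; exact: bi].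
    rewrite normrM ger0_norm; last by rewrite mulr_ge0// divr_ge0// ltW.
    apply: (@le_trans _ _ (M / K%:R * (M' / K%:R) * \sum_(i < 2 * K) \sum_(j < 2 * K) a)).
      apply: ler_wpM2l; first by rewrite mulr_ge0// divr_ge0// ltW.
      rewrite (le_trans (ler_norm_sum _ _ _))//; apply: ler_sum => i _.
      rewrite (le_trans (ler_norm_sum _ _ _))//; apply: ler_sum => j _.
      by rewrite cov_indic; [exact: h|exact: measurable_level..].
    rewrite !sumr_const !card_ord -mulr_natl -[in leLHS](mulr_natl a) !natrM.
    by rewrite le_eqVlt; apply/orP; left; apply/eqP; field; rewrite gt_eqF.
  have -> : cov F G = cov (fun w => F w - FK w) G + cov FK (fun w => G w - GK w) + cov FK GK.
    by rewrite covBl// (covC FK (fun w => G w - GK w)) covBl// (covC G FK) (covC GK FK); ring.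
  rewrite (le_trans (ler_normD _ _))// [leRHS]addrC lerD//.
  rewrite (le_trans (ler_normD _ _))//.
  rewrite (_ : 6 * (M * M') / K%:R = 2 * (M / K%:R * M') + 2 * (2 * M * (M' / K%:R))).
    by rewrite lerD.
  by ring.
apply/ler_addgt0Pr => e e0.
pose K := (Num.truncn (6 * (M * M') / e)).+1.
rewrite (le_trans (key K isT))// lerD2l ler_pdivrMr ?ltr0n// [leRHS]mulrC -ler_pdivrMr//.
by apply/ltW; exact: truncnS_gt.
Qed.

(** Lindeberg's telescoping for [cos]: adding the block [S j] to the sum [V] of
    the previous ones multiplies the mean of [cos (V + b)] by [1 - v / 2], up to
    the covariances of [S j] and [S j ^ 2] with functions of [V] and the third
    order Taylor remainder. *)
Lemma block_cos_mean (m : nat) (S : nat -> T -> R) (beta v e1 e2 : R) :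
  0 <= beta -> (forall j, measurable_fun setT (S j)) ->
  (forall j w, `|S j w| <= beta) ->
  (forall j, mean P (S j) = 0) -> (forall j, mean P (fun w => S j w ^+ 2) = v) ->
  0 <= v <= 2 -> 
  (forall j b, (j < m)%N ->
    `|cov (fun w => cos (\sum_(i < j) S i w + b)) (S j)| <= e1) ->
  (forall j b, (j < m)%N ->
    `|cov (fun w => cos (\sum_(i < j) S i w + b)) (fun w => S j w ^+ 2)| <= e2) ->
  forall b, `|mean P (fun w => cos (\sum_(i < m) S i w + b)) - (1 - v / 2) ^+ m * cos b|
    <= m%:R * (e1 + e2 + beta * v).
Proof.
move=> beta0 mS Sb S0 S2 /andP[v0 v2] c1 c2 b.
have bS j : bmf (S j) by split => //; exists beta.
have bS2 j : bmf (fun w => S j w ^+ 2).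
  by under eq_fun do rewrite expr2; exact: bmfM.
have mV j : measurable_fun setT (fun w => \sum_(i < j) S i w).
  by apply: measurable_sum.
have mVx k x : measurable_fun setT (fun w => \sum_(i < k) S i w + x).
  exact: (measurable_funD (mV k) (measurable_cst x)).
elim: m c1 c2 => [|m ih] c1 c2.
  rewrite expr0 mul1r mul0r (_ : (fun w => _) = (fun=> cos b)).
    by rewrite mean_cst subrr normr0.
  by apply/funext => w; rewrite big_ord0 add0r.
have {}ih := ih (fun j x jm => c1 j x (ltnW jm)) (fun j x jm => c2 j x (ltnW jm)).
pose V w := \sum_(i < m) S i w.
have bc x : bmf (fun w => cos (V w + x)) by exact/bmf_cos/mVx.
have bs : bmf (fun w => sin (V w + b)) by exact/bmf_sin/mVx.
pose A w := cos (V w + b) - S m w * sin (V w + b) - S m w ^+ 2 / 2 * cos (V w + b).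
have bA : bmf A.
  apply: bmfB; first by apply: bmfB => //; exact: bmfM.
  by apply: bmfM => //; apply: bmfM => //; exact: bmf_cst.
have h1 : `|mean P (fun w => cos (\sum_(i < m.+1) S i w + b)) - mean P A| <= beta * v.
  have bS1 : bmf (fun w => cos (\sum_(i < m.+1) S i w + b)).
    by exact/bmf_cos/mVx.
  rewrite -meanB// (le_trans (mean_norm _ (bmfB bS1 bA)))//.
  rewrite -(S2 m) -meanZ//; apply: le_mean => [||w].
  - exact/bmf_norm/bmfB.
  - exact: bmfZ.
  rewrite big_ord_recr/= -/(V w) addrAC (le_trans (cos_taylor2 _ _))//.
  by rewrite exprS -[S m w ^+ 2]real_normK ?num_real// ler_wpM2r// exprn_ge0.
have h2 : mean P A = (1 - v / 2) * mean P (fun w => cos (V w + b)) -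
    cov (fun w => cos (V w + (b - pi / 2))) (S m) -
    1 / 2 * cov (fun w => cos (V w + b)) (fun w => S m w ^+ 2).
  rewrite /cov S0 S2 mulr0 subr0.
  have -> : mean P A = mean P (fun w => cos (V w + b)) -
      mean P (fun w => cos (V w + (b - pi / 2)) * S m w) -
      1 / 2 * mean P (fun w => cos (V w + b) * S m w ^+ 2).
    rewrite -meanB//; last exact: bmfM.
    rewrite -meanZ; last exact: bmfM.
    rewrite -meanB; last 2 first.
    - by apply: bmfB => //; exact: bmfM.
    - by apply: bmfZ; exact: bmfM.
    congr mean; apply/funext => w; rewrite addrA cosBpihalf /A; ring.
  by field.
have c1' := c1 m (b - pi / 2) (ltnSn m); have c2' := c2 m b (ltnSn m).
rewrite exprS -natr1 mulrDl mul1r.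
set X := mean P (fun w => cos (V w + b)) in ih h2.
have hX : `|(1 - v / 2) * (X - (1 - v / 2) ^+ m * cos b)| <= m%:R * (e1 + e2 + beta * v).
  rewrite normrM; apply: (le_trans _ ih).
  by rewrite -[leRHS]mul1r ler_wpM2r// ler_norml; apply/andP; split; lra.
move: h1; rewrite h2.
set Z := mean P _; set C1 := cov _ _ in c1' *; set C2 := cov _ _ in c2' *.
move=> h1.
rewrite (_ : Z - _ = (Z - ((1 - v / 2) * X - C1 - 1 / 2 * C2)) - C1 - 1 / 2 * C2 +
    (1 - v / 2) * (X - (1 - v / 2) ^+ m * cos b)); last by ring.
move: h1 c1' c2' hX; set q1 := Z - _; set q2 := _ * (X - _).
rewrite !ler_norml => /andP[? ?] /andP[? ?] /andP[? ?] /andP[? ?].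
by apply/andP; split; lra.
Qed.

End MixingCovariance.

Section StationarySums.
Context {d : measure_display} {T : measurableType d} {R : realType}.
Variables (P : probability T R) (xi : nat -> T -> R) (C : R) (gam : nat -> R).
Hypothesis mxi : forall i, measurable_fun setT (xi i).
Hypothesis xiC : forall i w, `|xi i w| <= C.
Hypothesis xi_mean : forall i, mean P (xi i) = 0.
Hypothesis xi_cov : forall i j, mean P (fun w => xi i w * xi j w) = gam ((i - j) + (j - i))%N.

Lemma bmf_xi i : bmf (xi i).
Proof. by split; [|exists C]. Qed.

Lemma sum_gam_le (G : R) (M i : nat) : (forall L, \sum_(h < L) `|gam h| <= G) -> (i < M)%N ->
  \sum_(k < M) `|gam ((i - k) + (k - i))%N| <= 2 * G.
Proof.
move=> hG iM; rewrite (_ : 2 * G = G + G); last by ring.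
rewrite -(big_mkord xpredT (fun k => `|gam ((i - k) + (k - i))%N|)).
rewrite (big_cat_nat (n := i.+1))//=; apply: lerD.
  apply: le_trans (hG i.+1); rewrite big_nat_rev/= big_mkord.
  rewrite le_eqVlt; apply/orP; left; apply/eqP; apply: eq_bigr => k _.
  by rewrite add0n subSS subKn -1?ltnS// -subnDA; congr (`|gam _|); have := ltn_ord k; lia.
apply: le_trans (hG (M - i)%N).
rewrite -{1}[i.+1]add0n big_addn big_mkord.
case: M iM => // M iM; rewrite subSS subSn// big_ord_recl/= -[leLHS]add0r lerD//.
rewrite le_eqVlt; apply/orP; left; apply/eqP; apply: eq_bigr => k _.
by congr (`|gam _|); rewrite /bump/=; lia.
Qed.

Lemma mean_sqr_sum_le (G : R) (q : pred nat) (M : nat) :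
  (forall L, \sum_(h < L) `|gam h| <= G) ->
  mean P (fun w => (\sum_(i < M | q i) xi i w) ^+ 2) <= 2 * G * (\sum_(i < M) q i)%:R.
Proof.
move=> hG.
have bx := bmf_xi.
have -> : mean P (fun w => (\sum_(i < M | q i) xi i w) ^+ 2) =
    \sum_(i < M | q i) \sum_(k < M | q k) gam ((i - k) + (k - i))%N.
  transitivity (mean P (fun w => \sum_(i < M | q i) \sum_(k < M | q k) xi i w * xi k w)).
    congr mean; apply/funext => w; rewrite expr2 mulr_suml; apply: eq_bigr => i _.
    by rewrite mulr_sumr.
  rewrite mean_sum => [|i _]; last by apply: bmf_sum => k _; exact: bmfM.
  apply: eq_bigr => i _; rewrite mean_sum => [|k _]; last exact: bmfM.
  by apply: eq_bigr => k _; exact: xi_cov.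
rewrite natr_sum mulr_sumr big_mkcond/=; apply: ler_sum => i _.
case: (q i); last by rewrite mulr0.
rewrite mulr1 (le_trans _ (sum_gam_le hG (ltn_ord i)))// big_mkcond/=.
by apply: ler_sum => k _; case: ifP => _; rewrite ?ler_norm.
Qed.

(** The variance of a block of [b] terms, in Cesaro form. *)
Definition partial_cov j : R := gam 0 + 2 * \sum_(h < j) gam h.+1.

Lemma mean_sqr_block (l b : nat) :
  mean P (fun w => (\sum_(l <= i < l + b) xi i w) ^+ 2) = \sum_(j < b) partial_cov j.
Proof.
elim: b => [|b ih].
  rewrite big_ord0 -[RHS](mean_cst P 0); congr mean; apply/funext => w.
  by rewrite addn0 big_geq// expr0n.
rewrite big_ord_recr/= -ih.
pose A w := \sum_(l <= i < l + b) xi i w.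
have bA : bmf A by apply: bmf_sum => i _; exact: bmf_xi.
have bx := bmf_xi (l + b).
transitivity (mean P (fun w => (A w ^+ 2 + 2 * (A w * xi (l + b)%N w)) + xi (l + b)%N w * xi (l + b)%N w)).
  congr mean; apply/funext => w; rewrite addnS big_nat_recr/=; last by rewrite leq_addr.
  by rewrite -/(A w); ring.
have bA2 : bmf (fun w => A w ^+ 2) by under eq_fun do rewrite expr2; exact: bmfM.
have bAx : bmf (fun w => 2 * (A w * xi (l + b)%N w)) by apply: bmfZ; exact: bmfM.
rewrite meanD; [|exact: bmfD|exact: bmfM].
rewrite meanD// meanZ; last exact: bmfM.
rewrite xi_cov subnn addn0 -addrA; congr (_ + _); rewrite /partial_cov addrC; congr (_ + _ * _).
transitivity (mean P (fun w => \sum_(l <= i < l + b) xi i w * xi (l + b)%N w)).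
  by congr mean; apply/funext => w; rewrite mulr_suml.
rewrite mean_sum => [|i _]; last by apply: bmfM; exact: bmf_xi.
rewrite -{1}[l]add0n big_addn addKn big_nat_rev/= big_mkord; apply: eq_bigr => i _.
by rewrite xi_cov; congr gam; have := ltn_ord i; lia.
Qed.

Lemma sum_blocks (V : nmodType) (f : nat -> V) (s b m : nat) : (0 < b)%N ->
  \sum_(j < m) \sum_(j * (s + b) + s <= i < j * (s + b) + s + b) f i =
  \sum_(i < m * (s + b) | (s <= i %% (s + b))%N) f i.
Proof.
move=> b0; have L0 : (0 < s + b)%N by rewrite addn_gt0 b0 orbT.
elim: m => [|m ih]; first by rewrite mul0n !big_ord0.
rewrite big_ord_recr/= ih -!(big_mkord (fun i => (s <= i %% (s + b))%N) f).
rewrite mulSnr [RHS](big_cat_nat (n := (m * (s + b))%N))//=; last exact: leq_addr.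
congr (_ + _); set l := (m * (s + b))%N.
rewrite [RHS](big_cat_nat (n := (l + s)%N))//=; [|exact: leq_addr|by rewrite addnA leq_addr].
rewrite [X in _ = X + _]big_nat_cond [X in _ = X + _]big_pred0 ?add0r; last first.
  move=> i; apply/negbTE; apply/negP => /andP[/andP[li il]].
  rewrite -(subnKC li) modnMDl modn_small; last by lia.
  by lia.
rewrite addnA [RHS]big_nat_cond [LHS]big_nat_cond; apply: eq_bigl => i.
apply/idP/idP => /andP[/andP[li il]]; rewrite li il//=.
rewrite -(@subnKC l i); last by rewrite (leq_trans _ li)// leq_addr.
by rewrite modnMDl modn_small; lia.
Qed.

Hypothesis C0 : 0 < C.

(** The quantitative heart of the central limit theorem: [m] blocks of length
    [b] separated by gaps of length [s] out of [M] terms, with a mixing rate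
    [a] across a gap. *)
Lemma cos_sum_bound (rho G a : R) (s b m M : nat) (x : R) :
  0 < rho -> (0 < b)%N -> (m * (s + b) <= M)%N -> (M < m * (s + b) + (s + b))%N ->
  (forall L, \sum_(h < L) `|gam h| <= G) ->
  0 <= \sum_(j < b) partial_cov j / rho ^+ 2 <= 2 ->
  (forall (K : pred nat) (k0 : nat) (c y M' : R) (g : R -> R), continuous g -> 0 < M' ->
    (forall w, `|g (\sum_(k0 + s <= i < k0 + s + b) xi i w)| <= M') ->
    `|cov P (fun w => cos (c * \sum_(i < k0 | K i) xi i w + y))
            (fun w => g (\sum_(k0 + s <= i < k0 + s + b) xi i w))| <= 4 * M' * a) ->
  forall beta v : R, beta = C * b%:R / rho ->
  v = \sum_(j < b) partial_cov j / rho ^+ 2 ->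
  `|mean P (fun w => cos (rho^-1 * \sum_(i < M) xi i w + x)) - (1 - v / 2) ^+ m * cos x| <=
    Num.sqrt (2 * G * (m * s + (s + b))%:R / rho ^+ 2) +
    m%:R * (4 * beta * a + 4 * beta ^+ 2 * a + beta * v).
Proof.
move=> rho0 b0 mM Mm hG v02 hmix beta v betaE vE.
rewrite -vE in v02.
pose B j w := \sum_(j * (s + b) + s <= i < j * (s + b) + s + b) xi i w.
pose S j w := rho^-1 * B j w.
have bx := bmf_xi.
have bB j : bmf (B j) by apply: bmf_sum => i _.
have rV0 : 0 < rho^-1 by rewrite invr_gt0.
have BC j w : `|B j w| <= C * b%:R.
  rewrite (le_trans (ler_norm_sum _ _ _))//.
  apply: (@le_trans _ _ (\sum_(j * (s + b) + s <= i < j * (s + b) + s + b) C)).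
    by apply: ler_sum => i _; exact: xiC.
  by rewrite sumr_const_nat addKn mulr_natr.
have beta0 : 0 < beta by rewrite betaE divr_gt0// mulr_gt0// ltr0n.
have Sb j w : `|S j w| <= beta.
  by rewrite normrM gtr0_norm// mulrC betaE ler_wpM2r// ltW.
have S0 j : mean P (S j) = 0.
  rewrite meanZ// /B mean_sum => [|i _]; last exact: bx.
  by rewrite big1 ?mulr0// => i _; exact: xi_mean.
have S2 j : mean P (fun w => S j w ^+ 2) = v.
  transitivity (mean P (fun w => rho ^- 2 * (B j w ^+ 2))).
    by congr mean; apply/funext => w; rewrite exprMn exprVn.
  rewrite meanZ; last by under eq_fun do rewrite expr2; exact: bmfM.
  by rewrite mean_sqr_block vE mulr_sumr; apply: eq_bigr => i _; rewrite mulrC.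
have VE j w : \sum_(i < j) S i w = rho^-1 * \sum_(i < j * (s + b) | (s <= i %% (s + b))%N) xi i w.
  by rewrite -mulr_sumr (sum_blocks (fun i => xi i w)).
have c1 j y : (j < m)%N -> `|cov P (fun w => cos (\sum_(i < j) S i w + y)) (S j)| <= 4 * beta * a.
  move=> _; under [X in cov P X _]eq_fun do rewrite VE.
  apply: (hmix (fun i => (s <= i %% (s + b))%N) (j * (s + b))%N rho^-1 y beta (fun z => rho^-1 * z)) => //.
  - by move=> z; apply: cvgM; [exact: cvg_cst|exact: cvg_id].
  - by move=> w; exact: Sb.
have c2 j y : (j < m)%N ->
    `|cov P (fun w => cos (\sum_(i < j) S i w + y)) (fun w => S j w ^+ 2)| <= 4 * beta ^+ 2 * a.
  move=> _; under [X in cov P X _]eq_fun do rewrite VE.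
  apply: (hmix (fun i => (s <= i %% (s + b))%N) (j * (s + b))%N rho^-1 y (beta ^+ 2)
    (fun z => (rho^-1 * z) ^+ 2)) => //.
  - move=> z; apply: (@continuous_comp _ _ _ (fun z => rho^-1 * z) (fun z => z ^+ 2)).
      by apply: cvgM; [exact: cvg_cst|exact: cvg_id].
    exact: sqr_continuous.
  - by rewrite exprn_gt0.
  - by move=> w; rewrite normrX ler_pXn2r ?nnegrE ?(ltW beta0)//; exact: Sb.
have mS j : measurable_fun setT (S j) by apply: (bmfZ _ (bB j)).1.
have main := block_cos_mean (ltW beta0) mS Sb S0 S2 v02 c1 c2 x.
pose q i := ~~ ((i < m * (s + b)) && (s <= i %% (s + b)))%N.
pose D w := rho^-1 * \sum_(i < M | q i) xi i w.
have split w : rho^-1 * \sum_(i < M) xi i w = \sum_(i < m) S i w + D w.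
  rewrite VE -mulrDr (bigID (fun i : 'I_M => ~~ q i))/=; congr (_ * (_ + _)); last first.
    by apply: eq_bigl => i; rewrite negbK.
  rewrite (big_ord_widen_cond M (fun i => (s <= i %% (s + b))%N) (fun i => xi i w))//.
  by apply: eq_bigl => i; rewrite negbK andbC.
have count : (\sum_(i < M) q i <= m * s + (s + b))%N.
  have h : (\sum_(i < M) ~~ q i = m * b)%N.
    have := @sum_blocks _ (fun=> 1%N) s b m b0.
    under eq_bigr do rewrite sum_nat_const_nat muln1 addKn.
    rewrite sum_nat_const card_ord => ->.
    rewrite (big_ord_widen_cond M (fun i => (s <= i %% (s + b))%N) (fun i => 1%N))//.
    rewrite [RHS]big_mkcond/=; apply: eq_bigr => i _; rewrite negbK andbC.
    by case: (_ && _).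
  have : ((\sum_(i < M) q i) + (\sum_(i < M) ~~ q i) = M)%N.
    rewrite -big_split/= -[RHS]card_ord -sum1_card; apply: eq_bigr => i _.
    by case: (q i).
  rewrite h; move: (\sum_(i < M) q i)%N => z; lia.
have bD : bmf D by apply: bmfZ; apply: bmf_sum => i _.
have bV : bmf (fun w => \sum_(i < m) S i w) by apply: bmf_sum => i _; exact: bmfZ.
have mV y : measurable_fun setT (fun w => \sum_(i < m) S i w + y).
  exact: (measurable_funD bV.1 (measurable_cst y)).
have e1 : `|mean P (fun w => cos (rho^-1 * \sum_(i < M) xi i w + x)) -
    mean P (fun w => cos (\sum_(i < m) S i w + x))| <=
    Num.sqrt (2 * G * (m * s + (s + b))%:R / rho ^+ 2).
  have b1 : bmf (fun w => cos (rho^-1 * \sum_(i < M) xi i w + x)).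
    apply: bmf_cos; apply: measurable_funD; last exact: measurable_cst.
    apply: (bmfZ _ _).1; exact: bmf_sum.
  have b2 := bmf_cos (mV x).
  rewrite -meanB// (le_trans (mean_norm _ (bmfB b1 b2)))//.
  apply: (@le_trans _ _ (mean P (fun w => `|D w|))).
    apply: le_mean => [||w]; [exact/bmf_norm/bmfB|exact: bmf_norm|].
    rewrite (le_trans (cos_lip _ _))// split.
    by rewrite (_ : _ - _ = D w)//; ring.
  rewrite (le_trans (mean_norm_sqr _ bD))// ler_wsqrtr//.
  have -> : mean P (fun w => D w ^+ 2) =
      rho ^- 2 * mean P (fun w => (\sum_(i < M | q i) xi i w) ^+ 2).
    rewrite -meanZ; last first.
      under eq_fun do rewrite expr2; apply: bmfM; apply: bmf_sum => i _; exact: bx.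
    by congr mean; apply/funext => w; rewrite exprMn exprVn.
  rewrite mulrC ler_wpM2r ?invr_ge0 ?exprn_ge0 ?(ltW rho0)//.
  rewrite (le_trans (mean_sqr_sum_le _ _ hG))// ler_wpM2l ?ler_nat//.
  by rewrite mulr_ge0// (le_trans _ (hG 0%N))// big_ord0.
rewrite -(subrKA (mean P (fun w => cos (\sum_(i < m) S i w + x)))).
by rewrite (le_trans (ler_normD _ _))// lerD.
Qed.

End StationarySums.

Section ArrayCLT.
Context {R : realType}.

Lemma expR_lip (x y : R) : x <= 0 -> y <= 0 -> `|expR x - expR y| <= `|x - y|.
Proof.
wlog yx : x y / y <= x => [h|x0 y0].
  by have [/h//|/ltW/h h' x0 y0] := leP y x; rewrite distrC [leRHS]distrC h'.
rewrite !ger0_norm ?subr_ge0 ?ler_expR// (_ : expR y = expR x * expR (y - x)).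
  rewrite -[X in X - _]mulr1 -mulrBr.
  have h1 : 1 - expR (y - x) <= x - y by have := expR_ge1Dx (y - x); lra.
  apply: le_trans h1; rewrite ler_piMl//; last by rewrite -expR0 ler_expR.
  by rewrite subr_ge0 -expR0 ler_expR subr_le0.
by rewrite -expRD; congr expR; ring.
Qed.

Lemma dist_exprn_le (A B : R) (m : nat) : 0 <= A <= 1 -> 0 <= B <= 1 ->
  `|A ^+ m - B ^+ m| <= m%:R * `|A - B|.
Proof.
move=> /andP[A0 A1] /andP[B0 B1]; elim: m => [|m ih].
  by rewrite !expr0 subrr normr0 mul0r.
rewrite !exprS (_ : _ - _ = A * (A ^+ m - B ^+ m) + (A - B) * B ^+ m); last by ring.
rewrite (le_trans (ler_normD _ _))// -natr1 [leRHS]mulrDl mul1r lerD//.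
  by rewrite normrM (ger0_norm A0) (le_trans _ ih)// ler_piMl.
by rewrite normrM ler_piMr// ger0_norm ?exprn_ge0// exprn_ile1.
Qed.

Lemma exprn_expR_le (y : R) (m : nat) : 0 <= y <= 1 ->
  `|(1 - y) ^+ m - expR (- (m%:R * y))| <= m%:R * y ^+ 2.
Proof.
move=> /andP[y0 y1].
have e1 : 1 - y <= expR (- y) by have := expR_ge1Dx (- y); lra.
have e2 : expR (- y) <= 1 - y + y ^+ 2.
  rewrite expRN; have h := expR_ge1Dx y.
  apply: (@le_trans _ _ (1 + y)^-1); first by rewrite lef_pV2// ?posrE ?expR_gt0//; lra.
  rewrite -[leLHS]mul1r ler_pdivrMr; last by lra.
  rewrite (_ : _ * _ = 1 + y ^+ 3); last by ring.
  by rewrite lerDl exprn_ge0.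
have -> : expR (- (m%:R * y)) = expR (- y) ^+ m by rewrite -expRM_natl mulrN.
apply: le_trans (dist_exprn_le m _ _) _.
- by apply/andP; split; lra.
- by rewrite expR_ge0 -expR0 ler_expR oppr_le0.
by rewrite ler_wpM2l// ler_norml; apply/andP; split; have := sqr_ge0 y; lra.
Qed.

Lemma half_le_trunc (y z : R) : 2 <= y -> y < z + 1 -> y / 2 <= z.
Proof. by move=> h1 h2; lra. Qed.

Lemma half_le1 : 1 / 2 <= 1 :> R.
Proof. by lra. Qed.

Lemma block_fraction_aux (n ms mb s b z w u : R) :
  n <= ms + mb + (s + b) + u -> ms <= z -> s + b <= z -> u <= w ->
  n - mb <= z + z + w.
Proof. by move=> h1 h2 h3 h4; lra. Qed.

Lemma sum_errors_aux (S A B D eta th : R) : eta <= th -> 0 <= A -> 0 <= B -> 0 <= D ->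
  S * th + (eta + A * eta) + (B * eta + D * eta) <= th * (S + A + 1 + B + D).
Proof.
move=> et A0 B0 D0; rewrite -subr_ge0.
rewrite (_ : _ - _ = (th - eta) * (1 + A + B + D)); last by ring.
by rewrite mulr_ge0 ?subr_ge0// !addr_ge0.
Qed.

Lemma leq_of_subn_lt (n t l s : nat) : (n - t < l + s -> n <= l + s + t)%N.
Proof. by lia. Qed.

Lemma sum_ltn_le (b k : nat) : (\sum_(j < b) (j < k) <= k)%N.
Proof.
suff : (\sum_(j < b) (j < k) <= minn b k)%N by move=> /leq_trans; apply; exact: geq_minr.
elim: b => [|c ih]; first by rewrite big_ord0.
by rewrite big_ord_recr/=; move: ih; case: (ltnP c k) => /=; lia.
Qed.

Context {d : measure_display} {T : measurableType d}.
Variables (P : probability T R) (xi : nat -> nat -> T -> R) (C G sig : R).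
Variables (gam : nat -> nat -> R) (p a : nat -> R) (t : nat).
Hypothesis C0 : 0 < C.
Hypothesis mxi : forall n i, measurable_fun setT (xi n i).
Hypothesis xiC : forall n i w, `|xi n i w| <= C.
Hypothesis xi_mean : forall n i, mean P (xi n i) = 0.
Hypothesis xi_cov : forall n i j,
  mean P (fun w => xi n i w * xi n j w) = gam n ((i - j) + (j - i))%N.
Hypothesis p_gt0 : \forall n \near \oo, 0 < p n.
Hypothesis p_le1 : forall n, p n <= 1.
Hypothesis np_infty : n%:R * p n @[n --> \oo] --> +oo.
Hypothesis G0 : 0 < G.
Hypothesis gamG : \forall n \near \oo, forall L, \sum_(h < L) `|gam n h| <= G * p n.
Hypothesis gam_cvg : forall e, 0 < e -> exists k, \forall n \near \oo,
  forall j, (k <= j)%N -> `|partial_cov (gam n) j / p n - sig| <= e.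
Local Notation rho n := (Num.sqrt (n%:R * p n)).
Hypothesis a_ge0 : forall s, 0 <= a s.
Hypothesis a_small : forall c : R, 0 < c ->
  rho n / p n * a (Num.truncn (c * rho n)) @[n --> \oo] --> 0.
Hypothesis mixing : forall n s b (K : pred nat) (k0 : nat) (c y M' : R) (g : R -> R),
  continuous g -> 0 < M' ->
  (forall w, `|g (\sum_(k0 + s <= i < k0 + s + b) xi n i w)| <= M') ->
  `|cov P (fun w => cos (c * \sum_(i < k0 | K i) xi n i w + y))
     (fun w => g (\sum_(k0 + s <= i < k0 + s + b) xi n i w))| <= 4 * M' * a s.

Lemma rho_infty (K : R) : \forall n \near \oo, K <= rho n.
Proof.
near=> n.
have h : K ^+ 2 <= n%:R * p n by near: n; exact: (cvgryPge _).1.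
by rewrite (le_trans (ler_norm K))// -sqrtr_sqr ler_wsqrtr.
Unshelve. all: by end_near. Qed.

Lemma array_clt_bound (th x : R) : 0 < th -> th <= 1 / 4 -> 0 <= sig ->
  \forall n \near \oo,
  `|mean P (fun w => cos ((rho n)^-1 * \sum_(i < n - t) xi n i w + x)) -
    expR (- (sig / 2)) * cos x| <=
  th * (Num.sqrt (8 * G) + 2 * G * C + 1 + G ^+ 2 + (2 + 5 * sig)).
Proof.
move=> th0 th1 sig0; pose eta := th ^+ 2; have eta0 : 0 < eta by rewrite exprn_gt0.
have etath : eta <= th by rewrite /eta expr2 ler_piMr ?(ltW th0)//; lra.
have eta1 : eta <= 1 / 4 by lra.
have eta_le1 : eta <= 1 by lra.
have [k hk] := gam_cvg eta0.
have split3 (Y X r' : R) : Y + 1 + G + X <= r' -> 0 <= X -> 0 < Y ->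
    [/\ 1 <= r', Y <= r', X <= r' & G <= r'].
  by move=> h1 h2 h3; move: G0 => G0'; split; lra.
pose CC := 4 * C * (1 + C); have CC0 : 0 < CC by rewrite !mulr_gt0// addr_gt0.
have eta20 : 0 < eta ^+ 2 by rewrite exprn_gt0.
near=> n.
have p0 : 0 < p n by near: n.
have p1 := p_le1 n.
have Gn : forall L, \sum_(h < L) `|gam n h| <= G * p n by near: n.
have hkn : forall j, (k <= j)%N -> `|partial_cov (gam n) j / p n - sig| <= eta by near: n.
have rbig : 2 / eta + 1 + G + 2 * (k%:R * (2 * G + sig)) / eta ^+ 2 <= rho n.
  by near: n; exact: rho_infty.
have an : rho n / p n * a (Num.truncn (eta ^+ 2 * rho n)) <= eta / CC.
  near: n; have /cvgrPdist_le/(_ (eta / CC) (divr_gt0 eta0 CC0)) := a_small eta20.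
  apply: filterS => n; rewrite sub0r normrN; apply: le_trans; exact: ler_norm.
have tn : t%:R <= eta * n%:R.
  near: n; exists (Num.truncn (t%:R / eta)).+1 => // n /= hn.
  rewrite mulrC -ler_pdivrMr// (le_trans (ltW (truncnS_gt _)))// ler_nat//.
set r := rho n in rbig an *.
have k0' : 0 <= 2 * (k%:R * (2 * G + sig)) / eta ^+ 2.
  by rewrite divr_ge0 ?(ltW eta20)// !mulr_ge0// addr_ge0 ?mulr_ge0// ltW.
have e20 : 0 < 2 / eta by rewrite divr_gt0.
have [r1 r2eta rX rG] := split3 _ _ _ rbig k0' e20.
have r0 : 0 < r by exact: lt_le_trans r1.
have r2 : r ^+ 2 = n%:R * p n.
  by rewrite /r sqr_sqrtr// mulr_ge0// ltW.
have n0 : 0 < n%:R :> R.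
  by rewrite lt_neqAle ler0n andbT eq_sym; apply/eqP => h; move: r2 (exprn_gt0 2 r0); rewrite h mul0r => ->; rewrite ltxx.
have rn : r <= n%:R.
  rewrite -(ler_pXn2r (n := 2)) ?nnegrE ?ler0n ?(ltW r0)// r2 expr2 ler_wpM2l//.
  have n1 : (0 < n)%N by rewrite -(ltr0n R).
  by rewrite (le_trans p1)// ler1n.
have rpn : r / p n = n%:R / r.
  have -> : n%:R = r ^+ 2 / p n by rewrite r2 mulfK ?gt_eqF.
  by field; rewrite !gt_eqF.
pose b := Num.truncn (eta * r); pose s := Num.truncn (eta ^+ 2 * r).
have er0 : 0 <= eta * r by rewrite mulr_ge0 ?ltW.
have br : b%:R <= eta * r by rewrite truncn_le.
have sr : s%:R <= eta ^+ 2 * r by rewrite truncn_le// mulr_ge0 ?ltW.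
have er2 : 2 <= eta * r.
  by rewrite mulrC -ler_pdivrMr.
have rb : eta * r / 2 <= b%:R.
  by apply: half_le_trunc er2 _; rewrite natr1; exact: truncnS_gt.
have b0' : 0 < b%:R :> R.
  by apply: lt_le_trans rb; rewrite divr_gt0// (lt_le_trans _ er2).
have b0 : (0 < b)%N by rewrite -(ltr0n R).
pose M := (n - t)%N; pose m := (M %/ (s + b))%N.
have L0 : (0 < s + b)%N by rewrite addn_gt0 b0 orbT.
have mM : (m * (s + b) <= M)%N by exact: leq_divM.
have Mm : (M < m * (s + b) + (s + b))%N by rewrite -mulSnr ltn_ceil.
have mLn : m%:R * (s%:R + b%:R) <= n%:R :> R.
  by rewrite -natrD -natrM ler_nat (leq_trans mM)// leq_subr.
have nmL : n%:R <= m%:R * (s%:R + b%:R) + (s%:R + b%:R) + t%:R :> R.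
  by rewrite -!natrD -natrM -!natrD ler_nat; exact: leq_of_subn_lt.
have m0 : 0 <= m%:R :> R by []. have s0 : 0 <= s%:R :> R by [].
have mbn : m%:R * b%:R <= n%:R :> R.
  by apply: le_trans mLn; rewrite ler_wpM2l// lerDr.
have msn : m%:R * s%:R <= 2 * eta * n%:R :> R.
  have h : s%:R <= 2 * eta * b%:R :> R.
    apply: (le_trans sr); rewrite (_ : _ * r = 2 * eta * (eta * r / 2)); last by field.
    by rewrite ler_wpM2l// mulr_ge0// ltW.
  apply: (@le_trans _ _ (m%:R * (2 * eta * b%:R))); first by rewrite ler_wpM2l.
  by rewrite mulrCA ler_wpM2l// mulr_ge0// ltW.
have ern : eta * r <= eta * n%:R by rewrite ler_wpM2l// ltW.
have Ln : s%:R + b%:R <= 2 * eta * n%:R :> R.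
  have : s%:R <= eta * r.
    by rewrite (le_trans sr)// ler_wpM2r ?(ltW r0)// expr2 ler_piMl ?(ltW eta0).
  move: br ern; move: (s%:R) (b%:R : R) => z1 z2 h1 h2 h3.
  rewrite (_ : 2 * eta * n%:R = eta * n%:R + eta * n%:R); last by ring.
  by rewrite lerD// ?(le_trans h3)// (le_trans h1).
pose w := (\sum_(j < b) partial_cov (gam n) j / p n) / b%:R.
pose v := \sum_(j < b) partial_cov (gam n) j / r ^+ 2.
have wE : \sum_(j < b) partial_cov (gam n) j / p n = w * b%:R.
  by rewrite /w divfK// gt_eqF.
have vw : v = b%:R / n%:R * w.
  transitivity (n%:R^-1 * \sum_(j < b) partial_cov (gam n) j / p n).
    rewrite /v mulr_sumr; apply: eq_bigr => j _; rewrite r2.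
    by field; rewrite !gt_eqF.
  by rewrite wE; ring.
have pcG j : `|partial_cov (gam n) j / p n| <= 2 * G.
  rewrite normrM (gtr0_norm (x := (p n)^-1)) ?invr_gt0// ler_pdivrMr// -mulrA.
  apply: (@le_trans _ _ (2 * \sum_(h < j.+1) `|gam n h|)); last by rewrite ler_pM2l.
  rewrite /partial_cov big_ord_recl/= (le_trans (ler_normD _ _))//.
  rewrite normrM (ger0_norm (x := 2))// mulrDr lerD//.
    by rewrite ler_peMl// ler1n.
  by rewrite ler_wpM2l// (le_trans (ler_norm_sum _ _ _)).
have v0 : 0 <= v.
  have -> : v = r ^- 2 * \sum_(j < b) partial_cov (gam n) j.
    by rewrite /v mulr_sumr; apply: eq_bigr => j _; rewrite mulrC.
  rewrite -(mean_sqr_block (mxi n) (xiC n) (xi_cov n) 0 b) mulr_ge0//.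
    by rewrite invr_ge0 exprn_ge0// ltW.
  by apply: mean_ge0 => y; exact: sqr_ge0.
have w0 : 0 <= w.
  by move: v0; rewrite vw pmulr_rge0// divr_gt0.
have w2G : w <= 2 * G.
  rewrite /w ler_pdivrMr// (le_trans (ler_norm _))// (le_trans (ler_norm_sum _ _ _))//.
  apply: (@le_trans _ _ (\sum_(j < b) (2 * G))); first by apply: ler_sum => j _.
  by rewrite sumr_const card_ord mulr_natr.
have wsig : `|w - sig| <= 2 * eta.
  have -> : w - sig = (\sum_(j < b) (partial_cov (gam n) j / p n - sig)) / b%:R.
    by rewrite sumrB wE sumr_const card_ord -mulr_natr; field; rewrite gt_eqF.
  rewrite normrM (gtr0_norm (x := b%:R^-1)) ?invr_gt0// ler_pdivrMr//.
  rewrite (le_trans (ler_norm_sum _ _ _))//.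
  apply: (@le_trans _ _ (\sum_(j < b) (eta + ((j < k)%N : nat)%:R * (2 * G + sig)))).
    apply: ler_sum => j _; have [jk|kj] := ltnP j k; last first.
      by rewrite mul0r addr0; exact: hkn.
    rewrite mul1r (le_trans (ler_normB _ _))// (ger0_norm sig0).
    by rewrite (le_trans (lerD (pcG j) (lexx sig)))// lerDr ltW.
  rewrite big_split/= sumr_const card_ord -mulr_suml -natr_sum.
  have ck : (\sum_(j < b) (j < k) <= k)%N.
    exact: sum_ltn_le.
  rewrite -[eta *+ b]mulr_natr (_ : 2 * eta * b%:R = eta * b%:R + eta * b%:R); last by ring.
  rewrite lerD2l; apply: (@le_trans _ _ (k%:R * (2 * G + sig))).
    by rewrite ler_wpM2r ?ler_nat// addr_ge0// mulr_ge0// ltW.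
  move: rX; rewrite ler_pdivrMr// => rX.
  apply: (@le_trans _ _ (eta * (eta * r / 2))); last by rewrite ler_wpM2l// ltW.
  rewrite (_ : _ * (_ / 2) = (r * eta ^+ 2) / 2); last by field.
  by rewrite ler_pdivlMr// mulrC.
have r2n : r ^+ 2 <= n%:R by rewrite r2 ler_piMr// ltW.
have brn : b%:R <= eta * n%:R by apply: le_trans ern.
have vG : v <= 2 * G * eta.
  rewrite vw mulrC ler_pM// ?divr_ge0 ?(ltW b0') ?(ltW n0)//.
  by rewrite ler_pdivrMr.
have v2 : v <= 2.
  rewrite vw mulrC; apply: (@le_trans _ _ (2 * G * (b%:R / n%:R))).
    by rewrite ler_wpM2r// divr_ge0 ltW.
  rewrite -mulrA -[leRHS]mulr1 ler_pM2l// mulrA ler_pdivrMr// mul1r.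
  apply: (le_trans _ r2n); rewrite expr2 ler_pM ?(ltW G0) ?(ltW b0')//.
  by rewrite (le_trans br)// ler_piMl ?(ltW r0).
pose q : R := m%:R * b%:R / n%:R.
have q1 : q <= 1 by rewrite ler_pdivrMr// mul1r.
have q0 : 0 <= q by rewrite divr_ge0 ?(ltW n0)// mulr_ge0// ltW.
have q5 : 1 - q <= 5 * eta.
  rewrite -(ler_pM2r n0) mulrBl mul1r /q divfK ?gt_eqF//.
  move: nmL msn Ln tn; rewrite mulrDr => h1 h2 h3 h4.
  rewrite (_ : 5 * eta * n%:R = 2 * eta * n%:R + 2 * eta * n%:R + eta * n%:R); last by ring.
  exact: block_fraction_aux h1 h2 h3 h4.
have mvq : m%:R * v = q * w by rewrite vw /q; ring.
have mv2G : m%:R * v <= 2 * G.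
  by rewrite mvq (le_trans _ w2G)// ler_piMl.
have beta_eta : C * b%:R / r <= C * eta.
  by rewrite -mulrA ler_pM2l// ler_pdivrMr.
have beta0 : 0 <= C * b%:R / r by rewrite !mulr_ge0 ?invr_ge0 ?(ltW r0) ?(ltW C0).
have hmix (K : pred nat) (k0 : nat) (c y M' : R) (g : R -> R) : continuous g -> 0 < M' ->
    (forall z, `|g (\sum_(k0 + s <= i < k0 + s + b) xi n i z)| <= M') ->
    `|cov P (fun z => cos (c * \sum_(i < k0 | K i) xi n i z + y))
       (fun z => g (\sum_(k0 + s <= i < k0 + s + b) xi n i z))| <= 4 * M' * a s.
  exact: mixing.
have v02 : 0 <= \sum_(j < b) partial_cov (gam n) j / r ^+ 2 <= 2 by rewrite v0.
have := cos_sum_bound (mxi n) (xiC n) (xi_mean n) (xi_cov n) C0 x r0 b0 mM Mm Gn v02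
  hmix erefl erefl.
rewrite -/v; set beta := C * b%:R / r in beta_eta beta0 *; set X := mean P _.
set Q := (1 - v / 2) ^+ m; move=> main.
have T2 : `|Q - expR (- (m%:R * (v / 2)))| <= G ^+ 2 * eta.
  have v2' : 0 <= v / 2 <= 1 by rewrite divr_ge0//= ler_pdivrMr// mul1r.
  apply: (le_trans (exprn_expR_le m v2')).
  rewrite (_ : _ * _ ^+ 2 = (m%:R * v) * v / 4); last by field.
  rewrite (_ : G ^+ 2 * eta = 2 * G * (2 * G * eta) / 4); last by field.
  by rewrite ler_pM2r// ler_pM// mulr_ge0.
have T3 : `|expR (- (m%:R * (v / 2))) - expR (- (sig / 2))| <= (2 + 5 * sig) * eta.
  apply: (le_trans (expR_lip _ _)).
  - by rewrite oppr_le0 mulr_ge0// divr_ge0.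
  - by rewrite oppr_le0 divr_ge0.
  rewrite (_ : _ - _ = - (1 / 2 * (m%:R * v - sig))); last by field.
  rewrite normrN normrM mvq (_ : q * w - sig = q * (w - sig) - (1 - q) * sig); last by ring.
  have h1 : `|q * (w - sig)| <= 2 * eta.
    by rewrite normrM (ger0_norm q0) (le_trans _ wsig)// ler_piMl.
  have h2 : `|(1 - q) * sig| <= 5 * eta * sig.
    by rewrite normrM (ger0_norm sig0) ger0_norm ?subr_ge0// ler_wpM2r.
  have h3 := le_trans (ler_normB (q * (w - sig)) ((1 - q) * sig)) (lerD h1 h2).
  have h4 : 0 <= 2 * eta + 5 * eta * sig.
    have eta_ge0 := ltW eta0.
    by apply: addr_ge0; apply: mulr_ge0 => //; apply: mulr_ge0.
  rewrite (_ : (2 + 5 * sig) * eta = 2 * eta + 5 * eta * sig); last by ring.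
  rewrite (ger0_norm (x := 1 / 2))//; apply: (le_trans (ler_wpM2l _ h3)) => //.
  by rewrite ler_piMl//; exact: half_le1.
have T1 : m%:R * (4 * beta * a s + 4 * beta ^+ 2 * a s + beta * v) <=
    eta + 2 * G * C * eta.
  rewrite mulrDr lerD//; last first.
    rewrite mulrCA (_ : 2 * G * C * eta = (C * eta) * (2 * G)); last by ring.
    by rewrite ler_pM// mulr_ge0.
  have beta_C : beta <= C.
    by apply: (le_trans beta_eta); rewrite ler_piMr ?(ltW C0).
  apply: (@le_trans _ _ (CC * (r / p n * a s))); last first.
    by rewrite mulrC -ler_pdivlMr.
  rewrite (_ : m%:R * _ = 4 * (m%:R * beta) * (1 + beta) * a s); last by ring.
  rewrite [leRHS]mulrA ler_wpM2r//.
  rewrite (_ : CC * (r / p n) = 4 * (C * (r / p n)) * (1 + C)); last by rewrite /CC; ring.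
  apply: ler_pM => //.
  - by apply: mulr_ge0 => //; exact: mulr_ge0.
  - exact: addr_ge0.
  - rewrite ler_pM2l// rpn /beta (_ : m%:R * _ = C * (m%:R * b%:R / r)); last by ring.
    by rewrite ler_pM2l// ler_pM2r// invr_gt0.
  - by rewrite lerD2l.
have T0 : Num.sqrt (2 * (G * p n) * (m * s + (s + b))%:R / r ^+ 2) <= Num.sqrt (8 * G) * th.
  rewrite -[th in leRHS](ger0_norm (ltW th0)) -sqrtr_sqr -sqrtrM ?mulr_ge0 ?(ltW G0)//.
  rewrite ler_wsqrtr// -/eta r2 (_ : _ / _ = 2 * G * ((m * s + (s + b))%:R / n%:R)); last first.
    by field; rewrite !gt_eqF.
  rewrite (_ : 8 * G * eta = 2 * G * (4 * eta)); last by ring.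
  rewrite ler_wpM2l ?mulr_ge0 ?(ltW G0)// ler_pdivrMr// !natrD natrM.
  rewrite (_ : 4 * eta * n%:R = 2 * eta * n%:R + 2 * eta * n%:R); last by ring.
  by rewrite lerD.
have cx := cos_max x.
have -> : X - expR (- (sig / 2)) * cos x = (X - Q * cos x) +
   ((Q - expR (- (m%:R * (v / 2)))) + (expR (- (m%:R * (v / 2))) - expR (- (sig / 2)))) * cos x.
  by ring.
rewrite (le_trans (ler_normD _ _))//.
have T4 : `|((Q - expR (- (m%:R * (v / 2)))) +
    (expR (- (m%:R * (v / 2))) - expR (- (sig / 2)))) * cos x| <=
    G ^+ 2 * eta + (2 + 5 * sig) * eta.
  rewrite normrM -[leRHS]mulr1 ler_pM//.
  by rewrite (le_trans (ler_normD _ _))// lerD.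
apply: (le_trans (lerD main T4)); apply: (le_trans (lerD (lerD T0 T1) (lexx _))).
apply: sum_errors_aux etath _ _ _; first by rewrite !mulr_ge0 ?(ltW G0) ?(ltW C0).
  by rewrite exprn_ge0 ?(ltW G0).
by rewrite addr_ge0// mulr_ge0.
Unshelve. all: by end_near. Qed.

Theorem array_clt (x : R) : 0 <= sig ->
  mean P (fun w => cos ((rho n)^-1 * \sum_(i < n - t) xi n i w + x)) @[n --> \oo] -->
    expR (- (sig / 2)) * cos x.
Proof.
move=> sig0; apply/cvgrPdist_le => e e0.
pose K := Num.sqrt (8 * G) + 2 * G * C + 1 + G ^+ 2 + (2 + 5 * sig).
have K0 : 0 < K.
  have := sqrtr_ge0 (8 * G); have := mulr_gt0 (mulr_gt0 (ltr0Sn R 1) G0) C0.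
  have := sqr_ge0 G; rewrite /K => *; lra.
pose th := Num.min (1 / 4) (e / K).
have th0 : 0 < th by rewrite lt_min divr_gt0//= divr_gt0.
have th1 : th <= 1 / 4 by rewrite ge_min lexx.
have := array_clt_bound x th0 th1 sig0; apply: filterS => n h.
by rewrite distrC (le_trans h)// -/K -ler_pdivlMr// ge_min lexx orbT.
Qed.

End ArrayCLT.

Section Margins.
Context {d : measure_display} {T : measurableType d} {R : realType}.
Context {P : probability T R}.
Variable X : int -> {RV P >-> R}.

Lemma margin_coord m (s : 'I_m -> int) w i : margin X s w 0 i = X (s i) w.
Proof. by rewrite mxE. Qed.

Lemma measurable_margin m (s : 'I_m -> int) (i : 'I_m) :
  measurable_fun setT (fun w => margin X s w 0 i).
Proof.
rewrite (_ : (fun _ => _) = X (s i)) //; apply/funext => w; exact: margin_coord.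
Qed.

Lemma measurable_margin_preimage m (s : 'I_m -> int) (B : set 'rV[R]_m) :
  borel_set B -> measurable (margin X s @^-1` B).
Proof. by apply: measurable_preimage_row; exact: measurable_margin. Qed.

Lemma bmf_margin m (s : 'I_m -> int) (f : 'rV[R]_m -> R) (M : R) :
  measurable_fun setT (f : borel_rV R m -> R) -> (forall x, `|f x| <= M) ->
  bmf (fun w => f (margin X s w)).
Proof.
move=> mf fM; split; last by exists M.
apply: (@measurableT_comp _ _ _ _ (borel_rV R m) _ f _ (margin X s)) => //.
exact/measurable_row/measurable_margin.
Qed.

Lemma mean_eq_law m (V W : T -> 'rV[R]_m) (f : 'rV[R]_m -> R) (M : R) :
  (forall i, measurable_fun setT (fun w => V w 0 i)) ->
  (forall i, measurable_fun setT (fun w => W w 0 i)) ->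
  measurable_fun setT (f : borel_rV R m -> R) -> (forall x, `|f x| <= M) ->
  (forall B, borel_set B -> P (V @^-1` B) = P (W @^-1` B)) ->
  mean P (fun w => f (V w)) = mean P (fun w => f (W w)).
Proof.
move=> mV mW mf fM VW.
have key (U : T -> 'rV[R]_m) (mU : forall i, measurable_fun setT (fun w => U w 0 i)) :
    mean P (fun w => f (U w)) =
    fine (\int[distribution P (row_mfun (measurable_row mU))]_x (f x)%:E).
  rewrite /mean /Rintegral integral_distribution//; first exact/measurable_EFinP.
  apply: bmf_integrable; split; last by exists M.
  apply: (@measurableT_comp _ _ _ _ (borel_rV R m) _ f _ U) => //.
  exact: measurable_row.
rewrite (key _ mV) (key _ mW); congr fine; apply: eq_measure_integral => B mB _.
exact: VW.
Qed.

Definition cat_index m m' (s : 'I_m -> int) (s' : 'I_m' -> int) (i : 'I_(m + m')) : int :=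
  match fintype.split i with inl j => s j | inr j => s' j end.

Lemma margin_cat m m' (s : 'I_m -> int) (s' : 'I_m' -> int) w :
  margin X (cat_index s s') w = row_mx (margin X s w) (margin X s' w).
Proof.
apply/rowP => i; rewrite margin_coord /cat_index mxE.
by case: fintype.splitP => j _; rewrite margin_coord.
Qed.

Lemma measurable_lsubmx m m' :
  measurable_fun setT (lsubmx : borel_rV R (m + m') -> borel_rV R m).
Proof.
apply: (@measurable_row _ _ _ (borel_rV R (m + m')) (fun x : 'rV[R]_(m + m') => lsubmx x)) => i.
under eq_fun do rewrite mxE; exact: measurable_coord.
Qed.

Lemma measurable_rsubmx m m' :
  measurable_fun setT (rsubmx : borel_rV R (m + m') -> borel_rV R m').
Proof.
apply: (@measurable_row _ _ _ (borel_rV R (m + m')) (fun x : 'rV[R]_(m + m') => rsubmx x)) => i.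
under eq_fun do rewrite mxE; exact: measurable_coord.
Qed.

Hypothesis stat : strictly_stationary X.

Lemma mean_margin_shift m (s : 'I_m -> int) (h : int) (f : 'rV[R]_m -> R) (M : R) :
  measurable_fun setT (f : borel_rV R m -> R) -> (forall x, `|f x| <= M) ->
  mean P (fun w => f (margin X (fun i => s i + h) w)) = mean P (fun w => f (margin X s w)).
Proof.
move=> mf fM; apply: mean_eq_law mf fM _; try exact: measurable_margin.
by move=> B bB; exact: stat.
Qed.

Lemma mean_margin_shift2 m m' (s : 'I_m -> int) (s' : 'I_m' -> int) (h : int)
    (f : 'rV[R]_m -> R) (g : 'rV[R]_m' -> R) (M M' : R) :
  measurable_fun setT (f : borel_rV R m -> R) -> (forall x, `|f x| <= M) ->
  measurable_fun setT (g : borel_rV R m' -> R) -> (forall x, `|g x| <= M') ->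
  mean P (fun w => f (margin X (fun i => s i + h) w) * g (margin X (fun i => s' i + h) w)) =
  mean P (fun w => f (margin X s w) * g (margin X s' w)).
Proof.
move=> mf fM mg gM.
pose F (x : 'rV[R]_(m + m')) := f (lsubmx x) * g (rsubmx x).
have mF : measurable_fun setT (F : borel_rV R (m + m') -> R).
  apply: measurable_funM; first exact: (measurableT_comp mf (@measurable_lsubmx m m')).
  exact: (measurableT_comp mg (@measurable_rsubmx m m')).
have FM x : `|F x| <= M * M' by rewrite normrM ler_pM.
have := mean_margin_shift (cat_index s s') h mF FM.
have E (r : 'I_m -> int) (r' : 'I_m' -> int) :
    (fun w => f (margin X r w) * g (margin X r' w)) = fun w => F (margin X (cat_index r r') w).
  by apply/funext => w; rewrite margin_cat /F row_mxKl row_mxKr.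
rewrite !E => <-; congr mean; apply/funext => w; congr (F (margin X _ w)).
by apply/funext => i; rewrite /cat_index; case: (fintype.split i).
Qed.

(** Events of the form [margin s \in B] with all indices at most [0], resp. at
    least [h], are past, resp. future, events. *)
Lemma past_event m (s : 'I_m -> int) (B : set 'rV[R]_m) : borel_set B ->
  (forall i, s i <= 0) ->
  exists2 A, borel_seq A & margin X s @^-1` B = past X @^-1` A.
Proof.
move=> bB s0.
pose G : set_system (nat -> R) := [set C | exists (n : nat) (B : set R),
         measurable B /\ C = (fun x : nat -> R => x n) @^-1` B].
pose f (x : g_sigma_algebraType G) : 'rV[R]_m := \row_i x `|s i|%N.
exists (f @^-1` B).
  apply: (@measurable_preimage_row _ _ _ (g_sigma_algebraType G) f) => // i.
  move=> _ C mC; rewrite setTI; apply: sub_sigma_algebra; exists `|s i|%N, C; split => //.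
  by apply/seteqP; split => x /=; rewrite mxE.
suff -> : margin X s = (fun w => f (past X w)) by [].
apply/funext => w; apply/rowP => i; rewrite !mxE /past; congr (X _ w).
by have := s0 i; case: (s i) => [[|n]|n] //=; rewrite ?oppr0// NegzE.
Qed.

Lemma future_event m (s : 'I_m -> int) (h : nat) (B : set 'rV[R]_m) : borel_set B ->
  (forall i, h%:Z <= s i) ->
  exists2 A, borel_seq A & margin X s @^-1` B = future X h @^-1` A.
Proof.
move=> bB s0.
pose G : set_system (nat -> R) := [set C | exists (n : nat) (B : set R),
         measurable B /\ C = (fun x : nat -> R => x n) @^-1` B].
pose f (x : g_sigma_algebraType G) : 'rV[R]_m := \row_i x `|s i - h%:Z|%N.
exists (f @^-1` B).
  apply: (@measurable_preimage_row _ _ _ (g_sigma_algebraType G) f) => // i.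
  move=> _ C mC; rewrite setTI; apply: sub_sigma_algebra; exists `|s i - h%:Z|%N, C; split => //.
  by apply/seteqP; split => x /=; rewrite mxE.
suff -> : margin X s = (fun w => f (future X h w)) by [].
apply/funext => w; apply/rowP => i; rewrite !mxE /future; congr (X _ w).
by have := s0 i; lia.
Qed.

Lemma measurable_seq_preimage (f : T -> nat -> R) (A : set (nat -> R)) :
  (forall n, measurable_fun setT (fun w => f w n)) -> borel_seq A -> measurable (f @^-1` A).
Proof.
move=> mf bA.
pose G : set_system (nat -> R) := [set C | exists (n : nat) (B : set R),
         measurable B /\ C = (fun x : nat -> R => x n) @^-1` B].
have mf' : measurable_fun setT (f : T -> g_sigma_algebraType G).
  apply: (@measurability _ _ T (g_sigma_algebraType G) setT f G erefl).
  move=> _ [_ [n [B [mB ->]]] <-]; exact: mf.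
by rewrite -[X in measurable X]setTI; exact: mf'.
Qed.

Lemma alpha_mixing_ub (h : nat) (A B : set (nat -> R)) : borel_seq A -> borel_seq B ->
  `|pr P (past X @^-1` A `&` future X h @^-1` B)
     - pr P (past X @^-1` A) * pr P (future X h @^-1` B)| <= alpha_mixing X h.
Proof.
move=> bA bB; apply: ub_le_sup; last by exists A, B.
exists 2 => _ [A' [B' [bA' bB' ->]]].
have mp : measurable (past X @^-1` A') by apply: measurable_seq_preimage.
have mq : measurable (future X h @^-1` B') by apply: measurable_seq_preimage.
have h1 := pr_le1 P (measurableI _ _ mp mq).
have h2 := pr_ge0 P (past X @^-1` A' `&` future X h @^-1` B').
have h3 : 0 <= pr P (past X @^-1` A') * pr P (future X h @^-1` B') <= 1.
  by rewrite mulr_ge0 ?pr_ge0//= mulr_ile1 ?pr_ge0 ?pr_le1.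
move: h3 => /andP[h3 h4]; rewrite ler_norml; apply/andP; split; lra.
Qed.

Lemma alpha_mixing_ge0 h : 0 <= alpha_mixing X h.
Proof.
have b0 : borel_seq (set0 : set (nat -> R)) by exact: (@measurable0 _ (g_sigma_algebraType _)).
by apply: le_trans (alpha_mixing_ub h b0 b0).
Qed.

Theorem cov_margin_le m m' (s : 'I_m -> int) (s' : 'I_m' -> int) (k0 : int) (h : nat)
    (f : 'rV[R]_m -> R) (g : 'rV[R]_m' -> R) (M M' : R) :
  (forall i, s i <= k0) -> (forall i, k0 + h%:Z <= s' i) -> 0 < M -> 0 < M' ->
  measurable_fun setT (f : borel_rV R m -> R) -> (forall x, `|f x| <= M) ->
  measurable_fun setT (g : borel_rV R m' -> R) -> (forall x, `|g x| <= M') ->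
  `|cov P (fun w => f (margin X s w)) (fun w => g (margin X s' w))| <=
    4 * (M * M') * alpha_mixing X h.
Proof.
move=> sk sk' M0 M'0 mf fM mg gM.
apply: cov_le_mixing => //; [exact: (bmf_margin _ mf fM).1|exact: (bmf_margin _ mg gM).1|].
move=> x y.
pose B : set 'rV[R]_m := [set z | x <= f z]; pose B' : set 'rV[R]_m' := [set z | y <= g z].
have bB : borel_set B by exact: (@measurable_level _ (borel_rV R m)).
have bB' : borel_set B' by exact: (@measurable_level _ (borel_rV R m')).
pose r i := s i - k0; pose r' i := s' i - k0.
have sr : s = fun i => r i + k0 by apply/funext => i; rewrite /r subrK.
have sr' : s' = fun i => r' i + k0 by apply/funext => i; rewrite /r' subrK.
have [C bC CE] : exists2 C, borel_seq C & margin X r @^-1` B = past X @^-1` C.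
  by apply: past_event => // i; rewrite subr_le0.
have [C' bC' CE'] : exists2 C, borel_seq C & margin X r' @^-1` B' = future X h @^-1` C.
  by apply: future_event => // i; rewrite lerBrDl.
have := alpha_mixing_ub h bC bC'; rewrite -CE -CE'.
have e1 : pr P (margin X r @^-1` B) = pr P (margin X s @^-1` B).
  by rewrite sr /pr stat.
have e2 : pr P (margin X r' @^-1` B') = pr P (margin X s' @^-1` B').
  by rewrite sr' /pr stat.
have e3 : pr P (margin X r @^-1` B `&` margin X r' @^-1` B') =
    pr P (margin X s @^-1` B `&` margin X s' @^-1` B').
  have mi (q : 'I_m -> int) (q' : 'I_m' -> int) :
      pr P (margin X q @^-1` B `&` margin X q' @^-1` B') =
      mean P (fun w => \1_B (margin X q w) * \1_B' (margin X q' w)).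
    rewrite -mean_indic; last by apply: measurableI; exact: measurable_margin_preimage.
    by congr mean; apply/funext => w; rewrite indicI.
  rewrite !mi sr sr'; apply/esym; apply: (@mean_margin_shift2 _ _ _ _ _ _ _ 1 1).
  - by apply: measurable_indic.
  - by move=> z; rewrite indicE; case: (_ \in _); rewrite ?normr1 ?normr0.
  - by apply: measurable_indic.
  - by move=> z; rewrite indicE; case: (_ \in _); rewrite ?normr1 ?normr0.
by rewrite e1 e2 e3.
Qed.

End Margins.

Section Portmanteau.
Context {d d' : measure_display} {T : measurableType d} {T' : measurableType d'}.
Context {R : realType} {m : nat}.
Variables (P : probability T R) (Q : probability T' R).
Variables (V : nat -> T -> 'rV[R]_m) (C : nat -> set T) (W : T' -> 'rV[R]_m).
Hypothesis mV : forall n i, measurable_fun setT (fun w => V n w 0 i).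
Hypothesis mW : forall i, measurable_fun setT (fun w => W w 0 i).
Hypothesis mC : forall n, measurable (C n).
Hypothesis VW : forall f : 'rV[R]_m -> R, continuous f -> [bounded f x | x in setT] ->
  cond_mean P (fun w => f (V n w)) (C n) @[n --> \oo] --> mean Q (fun w => f (W w)).

Lemma cond_meanE (f : T -> R) (n : nat) : bmf f ->
  cond_mean P f (C n) = mean P (fun w => f w * \1_(C n) w) / pr P (C n).
Proof. by move=> bf; rewrite /cond_mean mean_setI. Qed.

Lemma pr_cond_gt0 : \forall n \near \oo, 0 < pr P (C n).
Proof.
have c1 : continuous (fun _ : 'rV[R]_m => 1 : R).
  by apply: (@lipschitz_continuous_row _ _ _ 0) => x y; rewrite subrr normr0 mul0r.
have b1 : [bounded (fun _ : 'rV[R]_m => 1 : R) x | x in [set: 'rV[R]_m]].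
  by exists 1; split => // M M1 x _ /=; rewrite normr1 ltW.
have := VW c1 b1; rewrite mean_cst => h.
have : \forall n \near \oo, 0 < cond_mean P (fun=> 1) (C n).
  by apply: (cvgr_gt _ h).
apply: filterS => n; rewrite cond_meanE; last exact: bmf_cst.
move=> h1; rewrite lt_neqAle pr_ge0 andbT; apply: contraTneq h1 => <-.
by rewrite invr0 mulr0 ltxx.
Qed.

Lemma cond_pr_closed_le (K : set 'rV[R]_m) (e : R) : closed K -> 0 < e ->
  \forall n \near \oo, cond_pr P (V n @^-1` K) (C n) <= pr Q (W @^-1` K) + e.
Proof.
move=> cK e0; have [K0|/set0P K0] := eqVneq K set0.
  apply: nearW => n; rewrite K0 /cond_pr !preimage_set0 set0I !pr_set0 mul0r.
  by rewrite add0r ltW.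
have e20 : 0 < e / 2 by rewrite divr_gt0.
have := mean_cone_cvg (P := Q) mW cK K0; move/cvgrPdist_le => /(_ _ e20)[k _ /(_ k (leqnn k))] /= hk.
have := VW (@cone_continuous _ _ K k) (@cone_bounded _ _ K k).
move/cvgrPdist_le => /(_ _ e20); apply: filterS => n hn.
have h1 : cond_pr P (V n @^-1` K) (C n) <= cond_mean P (fun w => cone K k (V n w)) (C n).
  have bc := cone_bmf K k (mV n).
  have mK : measurable (V n @^-1` K).
    by apply: measurable_preimage_row => //; exact: closed_borel.
  rewrite cond_meanE// /cond_pr ler_wpM2r ?invr_ge0 ?pr_ge0//.
  rewrite -mean_indic; last exact: measurableI.
  apply: le_mean => [||w].
  - by apply: bmf_indic; exact: measurableI.
  - by apply: bmfM => //; exact: bmf_indic.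
  rewrite indicI /= ler_wpM2r// indicE; case: (boolP (w \in _)) => [/set_mem/= Kw|_].
    by rewrite cone1.
  exact: cone_ge0.
rewrite (le_trans h1)//.
move: hk hn; rewrite !ler_distl => /andP[h2 h3] /andP[h4 h5].
by rewrite (splitr e); lra.
Qed.

Theorem cond_pr_cvg (B : set 'rV[R]_m) : borel_set B -> pr Q (W @^-1` boundary B) = 0 ->
  cond_pr P (V n @^-1` B) (C n) @[n --> \oo] --> pr Q (W @^-1` B).
Proof.
move=> bB B0.
have bcl : borel_set (closure B) by apply: closed_borel; exact: closed_closure.
have bin : borel_set B° by apply: open_borel; exact: open_interior.
have mQ D : borel_set D -> measurable (W @^-1` D) by exact: measurable_preimage_row.
have mP n D : borel_set D -> measurable (V n @^-1` D) by exact: measurable_preimage_row.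
have bbd : borel_set (boundary B) by exact: (@measurableD _ (borel_rV R m)).
have q1 : pr Q (W @^-1` closure B) <= pr Q (W @^-1` B°).
  rewrite -[leRHS]addr0 -B0; apply: le_trans (pr_setU _ (mQ _ bin) (mQ _ bbd)).
  apply: le_pr; [exact: mQ|by apply: measurableU; exact: mQ|].
  move=> w /= cw; have [iw|niw] := pselect (B° (W w)); first by left.
  by right; split.
have q2 : pr Q (W @^-1` B°) <= pr Q (W @^-1` B).
  by apply: le_pr; [exact: mQ|exact: mQ|move=> w; exact: interior_subset].
have q3 : pr Q (W @^-1` B) <= pr Q (W @^-1` closure B).
  by apply: le_pr; [exact: mQ|exact: mQ|move=> w; exact: subset_closure].
apply/cvgrPdist_le => e e0.
have up := cond_pr_closed_le (@closed_closure _ B) e0.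
have cC : closed (~` B°) by apply: open_closedC; exact: open_interior.
have down := cond_pr_closed_le cC e0.
near=> n.
have p0 : 0 < pr P (C n) by near: n; exact: pr_cond_gt0.
have u1 : cond_pr P (V n @^-1` closure B) (C n) <= pr Q (W @^-1` closure B) + e by near: n.
have d1 : cond_pr P (V n @^-1` (~` B°)) (C n) <= pr Q (W @^-1` (~` B°)) + e by near: n.
have u2 : cond_pr P (V n @^-1` B) (C n) <= cond_pr P (V n @^-1` closure B) (C n).
  rewrite /cond_pr ler_wpM2r ?invr_ge0 ?pr_ge0//; apply: le_pr.
  - by apply: measurableI => //; exact: mP.
  - by apply: measurableI => //; exact: mP.
  - by move=> w [/= Bw Cw]; split => //; exact: subset_closure.
have d2 : 1 - cond_pr P (V n @^-1` B) (C n) <= cond_pr P (V n @^-1` (~` B°)) (C n).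
  rewrite lerBlDr /cond_pr -mulrDl ler_pdivlMr// mul1r.
  apply: le_trans (pr_setU _ _ _); last 2 first.
  - by apply: measurableI => //; apply: mP; exact: closed_borel.
  - by apply: measurableI => //; exact: mP.
  apply: le_pr => //.
    by apply: measurableU; apply: measurableI => //; apply: mP => //; exact: closed_borel.
  move=> w Cw; have [Bw|nBw] := pselect (B (V n w)); first by right.
  by left; split => //= /interior_subset.
have d3 : pr Q (W @^-1` (~` B°)) = 1 - pr Q (W @^-1` B°).
  by rewrite -(pr_setC _ (mQ _ bin)).

rewrite ler_distl; apply/andP; split; lra.
Unshelve. all: by end_near. Qed.

End Portmanteau.

Section Coordinates.
Context {R : realType}.

Definition pick_row a b (s : 'I_a -> 'I_b) (x : 'rV[R]_b) : 'rV[R]_a := \row_i x 0 (s i).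

Lemma pick_row_lip a b (s : 'I_a -> 'I_b) (x y : 'rV[R]_b) :
  `|pick_row s x - pick_row s y| <= `|x - y|.
Proof.
apply: row_norm_le => // i; rewrite !mxE.
by have := coord_le_norm (x - y) (s i); rewrite !mxE.
Qed.

Lemma pick_row_open a b (s : 'I_a -> 'I_b) (U : set 'rV[R]_a) : open U ->
  open (pick_row s @^-1` U).
Proof.
move=> oU; rewrite openE => x /= Ux; have [e e0 he] := openP oU Ux.
apply/nbhs_ballP; exists e => // y; rewrite mx_norm_ball /ball_/= => xy.
by apply: he; rewrite (le_lt_trans (pick_row_lip s _ _))// distrC.
Qed.

Lemma pick_row_closed a b (s : 'I_a -> 'I_b) (K : set 'rV[R]_a) : closed K ->
  closed (pick_row s @^-1` K).
Proof.
move=> cK; have -> : pick_row s @^-1` K = ~` (pick_row s @^-1` (~` K)).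
  by rewrite -preimage_setC setCK.
by apply: open_closedC; apply: pick_row_open; rewrite openC.
Qed.

Lemma measurable_pick_row a b (s : 'I_a -> 'I_b) (B : set 'rV[R]_a) : borel_set B ->
  borel_set (pick_row s @^-1` B).
Proof.
apply: (@measurable_preimage_row _ _ _ (borel_rV R b)) => i.
by under eq_fun do rewrite mxE; exact: measurable_coord.
Qed.

Lemma boundary_pick a b (s s' : 'I_a -> 'I_b) (A B : set 'rV[R]_a) :
  boundary (pick_row s @^-1` A `&` pick_row s' @^-1` B) `<=`
  pick_row s @^-1` boundary A `|` pick_row s' @^-1` boundary B.
Proof.
move=> x [cx ix].
have cl (r : 'I_a -> 'I_b) (E : set 'rV[R]_a) :
    closure (pick_row r @^-1` E) `<=` pick_row r @^-1` closure E.
  rewrite [X in _ `<=` X](closure_id _).1; last exact: pick_row_closed (@closed_closure _ E).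
  apply: closureS => y /= Ey; exact: (@subset_closure _ E _ Ey).
have c1 : closure A (pick_row s x) by apply: cl; apply: closureS cx => y [].
have c2 : closure B (pick_row s' x) by apply: cl; apply: closureS cx => y [].
have [i1|n1] := pselect (A° (pick_row s x)); last by left.
have [i2|n2] := pselect (B° (pick_row s' x)); last by right.
exfalso; apply: ix.
have oU : open (pick_row s @^-1` A° `&` pick_row s' @^-1` B°).
  by apply: openI; apply: pick_row_open; exact: open_interior.
have : (pick_row s @^-1` A° `&` pick_row s' @^-1` B°)° x.
  exact: open_nbhs_nbhs.
by apply: interiorS => y [/interior_subset ? /interior_subset ?].
Qed.

End Coordinates.

Section TailLimits.
Context {d d' : measure_display} {T : measurableType d} {T' : measurableType d'}.
Context {R : realType} {P : probability T R} {P' : probability T' R}.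
Variables (X : int -> {RV P >-> R}) (Y : int -> {RV P' >-> R}) (alpha : R).
Hypothesis alpha_gt0 : 0 < alpha.
Hypothesis stat : strictly_stationary X.
Hypothesis tailY : is_tail_process X Y alpha.

Lemma measurable_exceed h (x : R) : measurable (exceed X h x).
Proof.
rewrite -[X in measurable X]setTI.
rewrite (_ : exceed X h x = X h%:Z @^-1` `]x, +oo[%classic).
  exact: measurable_funPT.
by apply/seteqP; split => w /=; rewrite in_itv/= andbT.
Qed.

Lemma measurable_scaled_window (v : R) (a : int) (m : nat) (i : 'I_m) :
  measurable_fun setT (fun w => (v^-1 *: window X a m w) 0 i).
Proof.
rewrite (_ : (fun _ => _) = fun w => v^-1 * X (a + i%:Z) w).
  exact: measurable_funM.
by apply/funext => w; rewrite !mxE.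
Qed.

Section AlongSequence.
Variable v : nat -> R.
Hypothesis v_infty : v n @[n --> \oo] --> +oo.

Lemma tail_window_cvg (s : int) (m : nat) (f : 'rV[R]_m.+2 -> R) :
  continuous f -> [bounded f x | x in setT] ->
  cond_mean P (fun w => f ((v n)^-1 *: window X s m.+2 w)) (exceed X 0 (v n)) @[n --> \oo]
    --> mean P' (fun w => f (window Y s m.+2 w)).
Proof. by move=> cf bf; exact: cvg_comp v_infty (tailY.2 s m f cf bf). Qed.

Lemma exceed_gt0 : \forall n \near \oo, 0 < pr P (exceed X 0 (v n)).
Proof.
apply: (@pr_cond_gt0 _ _ _ _ _ _ P P' (fun n w => (v n)^-1 *: window X 0 2 w)
  (fun n => exceed X 0 (v n)) (window Y 0 2)) => //.
- by move=> n; exact: measurable_exceed.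
- by move=> f cf bf; exact: (@tail_window_cvg 0 0).
Qed.

Lemma v_gt0 : \forall n \near \oo, 0 < v n.
Proof. by have /cvgryPgt := v_infty; exact. Qed.

(** By regular variation, lowering the threshold slightly does not increase the
    exceedance probability by much. *)
Lemma exceed_scaled_ge (y e : R) : 1 <= y -> 0 < e ->
  \forall n \near \oo, (y `^ (- alpha) - e) * pr P (exceed X 0 (v n)) <=
    pr P (exceed X 0 (y * v n)).
Proof.
move=> y1 e0; pose K : set 'rV[R]_2 := [set z | z 0 0 <= y].
have cK : closed K.
  have := closed_comp (f := fun z : 'rV[R]_2 => z 0 0) _ (@closed_le _ y).
  by apply => z _; exact: coord_continuous.
have mY (i : 'I_2) : measurable_fun setT (fun w => window Y 0 2 w 0 i) by exact: measurable_margin.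
have := @cond_pr_closed_le _ _ _ _ _ _ P P' (fun n w => (v n)^-1 *: window X 0 2 w)
  (fun n => exceed X 0 (v n)) (window Y 0 2) (fun n => @measurable_scaled_window (v n) 0 2)
  mY (fun n => measurable_exceed 0 (v n)) (@tail_window_cvg 0 0) K e cK e0.
have -> : pr P' (window Y 0 2 @^-1` K) = 1 - y `^ (- alpha).
  rewrite -(tailY.1 y y1) -pr_setC; last first.
    rewrite -[X in measurable X]setTI (_ : [set w | _] = Y 0 @^-1` `]y, +oo[%classic).
      exact: measurable_funPT.
    by apply/seteqP; split => w /=; rewrite in_itv/= andbT.
  congr pr; apply/seteqP; split => w; rewrite /K /= mxE addr0.
    by rewrite ltNge => ->.
  by move/negP; rewrite -leNgt.
move=> h; near=> n.
have v0 : 0 < v n by near: n; exact: v_gt0.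
have p0 : 0 < pr P (exceed X 0 (v n)) by near: n; exact: exceed_gt0.
have : cond_pr P ((fun w => (v n)^-1 *: window X 0 2 w) @^-1` K) (exceed X 0 (v n)) <=
    1 - y `^ (- alpha) + e by near: n.
rewrite /cond_pr ler_pdivrMr// => h1.
have mE := measurable_exceed 0; have mE1 := mE (v n); have mE2 := mE (y * v n).
have mS : measurable ((fun w => (v n)^-1 *: window X 0 2 w) @^-1` K).
  apply: (@measurable_preimage_row _ _ _ _ (fun w => (v n)^-1 *: window X 0 2 w)).
    exact: measurable_scaled_window.
  exact: closed_borel.
have : pr P (exceed X 0 (v n)) <= pr P (exceed X 0 (y * v n)) +
    pr P ((fun w => (v n)^-1 *: window X 0 2 w) @^-1` K `&` exceed X 0 (v n)).
  apply: (le_trans _ (pr_setU P mE2 (measurableI _ _ mS mE1))).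
  apply: le_pr => //; first by apply: measurableU => //; exact: measurableI.
  move=> w vw; have [h2|h2] := ltP (y * v n) (X 0 w); first by left.
  right; split => //; rewrite /K /= !mxE addr0 mulrC.
  by rewrite ler_pdivrMr.
move=> h2; set q := y `^ _ in h1 *.
rewrite (_ : (q - e) * _ = pr P (exceed X 0 (v n)) - (1 - q + e) * pr P (exceed X 0 (v n))).
  by rewrite lerBlDr (le_trans h2)// lerD2l.
by ring.
Unshelve. all: by end_near. Qed.

End AlongSequence.

Variable u : nat -> R.
Hypothesis u_infty : u n @[n --> \oo] --> +oo.
Local Notation p n := (pr P (exceed X 0 (u n))).

Lemma exceed_ratio_le (eta : R) : 0 < eta -> exists2 y : R, 1 < y &
  \forall n \near \oo, pr P (exceed X 0 (u n / y)) <= (1 + eta) * p n.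
Proof.
move=> eta0; pose y := (1 + eta / 2) `^ alpha^-1.
have h1 : 1 < 1 + eta / 2 by rewrite ltrDl divr_gt0.
have y1 : 1 < y.
  have := @gt0_ltr_powR R alpha^-1 _ 1 (1 + eta / 2).
  by rewrite powR1 invr_gt0 !nnegrE; apply => //; exact/ltW/(lt_trans _ h1).
have yE : y `^ (- alpha) = (1 + eta / 2)^-1.
  by rewrite /y -powRrM mulrN mulVf ?gt_eqF// powRN powRr1// ltW// (lt_trans _ h1).
have y0 : 0 < y by exact: lt_trans y1.
exists y => //; pose e := (1 + eta / 2)^-1 - (1 + eta)^-1.
have e0 : 0 < e.
  rewrite subr_gt0 ltf_pV2 ?posrE ?(lt_trans _ h1)// ?addr_gt0//.
  by rewrite ltrD2l ltr_pdivrMr// ltr_pMr// ltr1n.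
have v_infty : u n / y @[n --> \oo] --> +oo.
  apply/cvgryPge => A; have /cvgryPge/(_ (A * y)) := u_infty.
  by apply: filterS => n; rewrite ler_pdivlMr.
have := exceed_scaled_ge v_infty (ltW y1) e0; apply: filterS => n.
rewrite yE /e opprB addrC subrK (mulrC y) divfK ?gt_eqF//.
by rewrite ler_pdivrMl// addr_gt0.
Qed.

(** The tail process inherits the null sets of its window at time 0: an event
    in which the coordinate of index 1 is at least 1 has, at any lag, at most
    the probability it has at lag 0.  By stationarity the events at lag [h] and
    at lag 0 of the time series are equally likely, and conditioning on
    [X 0 > u] loses only the sliver [(1 - 1/k) u < X 0 <= u]. *)
Lemma tail_shift_null (t : nat) (h : int) (K : set 'rV[R]_t.+2) : closed K ->
  (forall x, K x -> 1 <= x 0 (lift ord0 ord0)) ->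
  pr P' (window Y (-1) t.+2 @^-1` K) = 0 ->
  pr P' (window Y (h - 1) t.+2 @^-1` K) = 0.
Proof.
move=> cK K1 K0; have [->|/set0P Kn] := eqVneq K set0.
  by rewrite preimage_set0 pr_set0.
have mY a (i : 'I_t.+2) : measurable_fun setT (fun w => window Y a t.+2 w 0 i).
  exact: measurable_margin.
have step (eta : R) : 0 < eta -> exists k0, forall k, (k0 <= k)%N ->
    mean P' (fun w => cone K k (window Y (h - 1) t.+2 w)) <=
    mean P' (fun w => cone K k (window Y (-1) t.+2 w)) + eta.
  move=> eta0; have [y y1 hy] := exceed_ratio_le eta0.
  have y0 : 0 < y by exact: lt_trans y1.
  have gap : 0 < 1 - y^-1 by rewrite subr_gt0 invf_lt1.
  exists (Num.truncn (1 - y^-1)^-1) => k kk.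
  have ky : k.+1%:R^-1 <= 1 - y^-1.
    rewrite invf_ple ?posrE ?ltr0n// ltW// (lt_le_trans (truncnS_gt _))//.
    by rewrite ler_nat.
  have cc := @cone_continuous _ _ K k; have cb := @cone_bounded _ _ K k.
  have l1 := @tail_window_cvg u u_infty (h - 1) t _ cc cb.
  have l2 := @tail_window_cvg u u_infty (-1) t _ cc cb.
  apply: (@ler_cvg_to _ _ _ _ _ (fun n =>
    cond_mean P (fun w => cone K k ((u n)^-1 *: window X (-1) t.+2 w)) (exceed X 0 (u n)) + eta)
    _ _ l1); first by apply: cvgD => //; exact: cvg_cst.
  near=> n.
  have u0 : 0 < u n by near: n; exact: v_gt0.
  have p0 : 0 < p n by near: n; exact: exceed_gt0.
  have py : pr P (exceed X 0 (u n / y)) <= (1 + eta) * p n by near: n.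
  have mE := measurable_exceed 0 (u n); have mEy := measurable_exceed 0 (u n / y).
  have bc a : bmf (fun w => cone K k ((u n)^-1 *: window X a t.+2 w)).
    by apply: (cone_bmf K k); exact: measurable_scaled_window.
  rewrite /cond_mean !mean_setI//; set f := fun w => cone K k ((u n)^-1 *: window X (-1) t.+2 w).
  rewrite ler_pdivrMr// mulrDl divfK ?gt_eqF//.
  have e1 : mean P (fun w => cone K k ((u n)^-1 *: window X (h - 1) t.+2 w) *
      \1_(exceed X 0 (u n)) w) <= mean P f.
    apply: (@le_trans _ _ (mean P (fun w => cone K k ((u n)^-1 *: window X (h - 1) t.+2 w)))).
      apply: le_mean => // [|w]; first by apply: bmfM => //; exact: bmf_indic.
      by rewrite ler_piMr ?cone_ge0// indicE; case: (_ \in _).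
    rewrite le_eqVlt; apply/orP; left; apply/eqP.
    pose g (x : 'rV[R]_t.+2) := cone K k ((u n)^-1 *: x).
    have mg : measurable_fun setT (g : borel_rV R t.+2 -> R).
      apply: (@bmf_row _ _ _ (borel_rV R t.+2) (fun x : 'rV[R]_t.+2 => (u n)^-1 *: x) _ _ cc cb).1 => i.
      rewrite (_ : (fun _ => _) = fun x : borel_rV R t.+2 => (u n)^-1 * (x : 'rV[R]_t.+2) 0 i).
        by apply: measurable_funM => //; exact: measurable_coord.
      by apply/funext => x; rewrite mxE.
    have g1 x : `|g x| <= 1 by rewrite ger0_norm ?cone_ge0// cone_le1.
    have := mean_margin_shift stat (fun i : 'I_t.+2 => -1 + i%:Z) h mg g1.
    rewrite /g -/(window X (-1) t.+2) => <-; congr mean; apply/funext => w.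
    congr (cone K k (_ *: margin X _ w)); apply/funext => i.
    by rewrite [RHS]addrAC [-1 + h]addrC.
  apply: (le_trans e1).
  have e2 : mean P f <= mean P (fun w => f w * \1_(exceed X 0 (u n)) w +
      (\1_(exceed X 0 (u n / y)) w - \1_(exceed X 0 (u n)) w)).
    apply: le_mean => [||w].
    - exact: bc.
    - by apply: bmfD; [apply: bmfM; [exact: bc|exact: bmf_indic]|apply: bmfB; exact: bmf_indic].
    have EEy : exceed X 0 (u n) w -> exceed X 0 (u n / y) w.
      move=> /= uX; apply: le_lt_trans uX; rewrite ler_pdivrMr//.
      by rewrite ler_peMr ?(ltW u0)// ltW.
    rewrite !indicE; case: (boolP (w \in exceed X 0 (u n))) => [/set_mem Ew|_].
      by rewrite (mem_set (EEy Ew)) mulr1 subrr addr0.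
    rewrite mulr0 add0r subr0; have [f0|f0] := leP (f w) 0.
      by rewrite (le_trans f0).
    have [a Ka ha] := cone_gt0 Kn f0.
    have a1 := K1 _ Ka.
    have := le_lt_trans (coord_le_norm _ (lift ord0 ord0)) ha; rewrite !mxE.
    rewrite ltr_distl => /andP[h1 _].
    have Ey : exceed X 0 (u n / y) w.
      rewrite /exceed /= mulrC -ltr_pdivlMr// mulrC; apply: le_lt_trans; last exact: h1.
      by rewrite lerBrDr (le_trans _ a1)// -lerBrDl.
    by rewrite (mem_set Ey) cone_le1.
  apply: (le_trans e2); rewrite meanD; last 2 first.
  - by apply: bmfM; [exact: bc|exact: bmf_indic].
  - by apply: bmfB; exact: bmf_indic.
  rewrite meanB ?mean_indic//; [|exact: bmf_indic..].
  by rewrite lerD2l lerBlDr addrC -[X in X + _]mul1r -mulrDl.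
apply/eqP; rewrite eq_le pr_ge0 andbT; apply/ler_addgt0Pr => e e0; rewrite add0r.
have e20 : 0 < e / 2 by rewrite divr_gt0.
have [k0 hk0] := step _ e20.
have := mean_cone_cvg (P := P') (mY (-1)) cK Kn; rewrite K0.
move/cvgrPdist_le => /(_ _ e20)[k1 _ hk1].
pose k := maxn k0 k1; have /= := hk1 k (leq_maxr _ _); rewrite sub0r normrN => hk.
apply: (@le_trans _ _ (mean P' (fun w => cone K k (window Y (h - 1) t.+2 w)))).
  have mW : measurable (window Y (h - 1) t.+2 @^-1` K).
    by apply: measurable_preimage_row => //; exact: closed_borel.
  rewrite -mean_indic//; apply: le_mean => [||w].
  - exact: bmf_indic.
  - exact: cone_bmf.
  - rewrite indicE; case: (boolP (w \in _)) => [/set_mem/= Kw|_].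
      by rewrite cone1.
    exact: cone_ge0.
apply: (le_trans (hk0 k (leq_maxl _ _))); rewrite [leRHS]splitr lerD2r.
exact: le_trans (ler_norm _) hk.
Unshelve. all: by end_near. Qed.

End TailLimits.

Section Hits.
Context {R : realType} {t : nat}.
Implicit Types (A B : set 'rV[R]_t.+2) (x : 'rV[R]_t.+2) (v : R).

(** The indicator of [scaled_set v A] for [0 < v], set to zero otherwise so that
    it is measurable and dominated by an exceedance for every [v]. *)
Definition hit v A x : R := if 0 < v then \1_A (v^-1 *: x) else 0.

Lemma indic01 (S : Type) (E : set S) (s : S) : 0 <= (\1_E s : R) <= 1.
Proof. by rewrite indicE; case: (_ \in _); rewrite ?lexx ?ler01. Qed.

Lemma hit_ge0 v A x : 0 <= hit v A x.
Proof. by rewrite /hit; case: ifP => // _; case/andP: (indic01 A (v^-1 *: x)). Qed.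

Lemma hit_le1 v A x : hit v A x <= 1.
Proof. by rewrite /hit; case: ifP => // _; case/andP: (indic01 A (v^-1 *: x)). Qed.

Lemma hit_norm v A x : `|hit v A x| <= 1.
Proof. by rewrite ger0_norm ?hit_ge0 ?hit_le1. Qed.

Lemma hitI v A B x : hit v A x * hit v B x = hit v (A `&` B) x.
Proof. by rewrite /hit; case: ifP => _; rewrite ?mulr0// indicI. Qed.

Lemma hit_scaled v A x : 0 < v -> \1_(scaled_set v A) x = hit v A x.
Proof.
move=> v0; rewrite /hit v0 !indicE; congr (nat_of_bool _)%:R.
apply/idP/idP => /set_mem h; apply/mem_set.
  by case: h => a Aa <-; rewrite scalerA mulVf ?gt_eqF// scale1r.
by exists (v^-1 *: x) => //; rewrite scalerA mulfV ?gt_eqF// scale1r.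
Qed.

Lemma measurable_hit v A : borel_set A -> measurable_fun setT (hit v A : borel_rV R t.+2 -> R).
Proof.
move=> bA; rewrite (_ : hit v A = if 0 < v then (fun x => \1_A (v^-1 *: x)) else cst 0); last first.
  by apply/funext => x; rewrite /hit; case: ifP.
case: ifP => _; last exact: measurable_cst.
have mA : measurable_fun setT (\1_A : borel_rV R t.+2 -> R) by exact: measurable_indic.
apply: (measurableT_comp mA).
apply: (@measurable_row _ _ _ (borel_rV R t.+2) (fun x : 'rV[R]_t.+2 => v^-1 *: x)) => i.
rewrite (_ : (fun _ => _) = fun x : borel_rV R t.+2 => v^-1 * (x : 'rV[R]_t.+2) 0 i).
  by apply: measurable_funM => //; exact: measurable_coord.
by apply/funext => x; rewrite mxE.
Qed.

Lemma hit_le_exceed v A x : in_extreme_region A ->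
  hit v A x <= \1_[set y : 'rV[R]_t.+2 | v < y 0 (lift ord0 ord0)] x.
Proof.
move=> rA; rewrite /hit; case: ifP => [v0|_]; last by case/andP: (indic01 [set y : 'rV[R]_t.+2 | v < y 0 (lift ord0 ord0)] x).
rewrite !indicE; case: (boolP (_ \in A)) => [/set_mem Ax|_]; last by rewrite ler0n.
have := rA _ Ax (lift ord0 ord0); rewrite /= mxE mulrC ltr_pdivlMr// mul1r => h.
by rewrite mem_set.
Qed.

End Hits.

Section PairLimits.
Context {d d' : measure_display} {T : measurableType d} {T' : measurableType d'}.
Context {R : realType} {P : probability T R} {P' : probability T' R}.
Variables (X : int -> {RV P >-> R}) (Y : int -> {RV P' >-> R}) (alpha : R).
Hypothesis alpha_gt0 : 0 < alpha.
Hypothesis stat : strictly_stationary X.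
Hypothesis tailY : is_tail_process X Y alpha.
Variable u : nat -> R.
Hypothesis u_infty : u n @[n --> \oo] --> +oo.
Local Notation p n := (pr P (exceed X 0 (u n))).
Variable t : nat.
Implicit Types A B : set 'rV[R]_t.+2.

Lemma boundary_region A : in_extreme_region A ->
  forall x, boundary A x -> 1 <= x 0 (lift ord0 ord0).
Proof.
move=> rA x [cx _].
have cK : closed [set z : 'rV[R]_t.+2 | 1 <= z 0 (lift ord0 ord0)].
  have := closed_comp (f := fun z : 'rV[R]_t.+2 => z 0 (lift ord0 ord0)) _ (@closed_ge _ 1).
  by apply => z _; exact: coord_continuous.
suff : closure [set z : 'rV[R]_t.+2 | 1 <= z 0 (lift ord0 ord0)] x by rewrite -(closure_id _).1.
by apply: closureS cx => z /rA /(_ (lift ord0 ord0)) /ltW.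
Qed.

Lemma closed_boundary A : closed (boundary A).
Proof.
rewrite /boundary setDE; apply: closedI; first exact: closed_closure.
by apply: open_closedC; exact: open_interior.
Qed.

Definition cross (h : nat) A B : R :=
  pr P' (window Y (-1) t.+2 @^-1` A `&` window Y (h%:Z - 1) t.+2 @^-1` B).

(** Two windows at lag [h] are read off one longer window; the boundary of the
    resulting event is null because both windows of the tail process give no
    mass to the boundaries of [A] and [B]. *)
Lemma pair_cvg (h : nat) A B : in_extreme_region A -> in_extreme_region B ->
  tail_continuity_set Y A -> tail_continuity_set Y B ->
  mean P (fun w => hit (u n) A (window X (-1) t.+2 w) * hit (u n) B (window X (h%:Z - 1) t.+2 w))
    / p n @[n --> \oo] --> cross h A B.
Proof.
move=> rA rB [bA A0] [bB B0].
pose s1 (i : 'I_t.+2) : 'I_(t + h).+2 := inord i.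
pose s2 (i : 'I_t.+2) : 'I_(t + h).+2 := inord (h + i).
have s1E i : s1 i = i :> nat by rewrite inordK//; have := ltn_ord i; lia.
have s2E i : s2 i = (h + i)%N :> nat by rewrite inordK//; have := ltn_ord i; lia.
pose D := pick_row s1 @^-1` A `&` pick_row s2 @^-1` B.
have bD : borel_set D by apply: (@measurableI _ (borel_rV R _)); exact: measurable_pick_row.
have Y1 w : pick_row s1 (window Y (-1) (t + h).+2 w) = window Y (-1) t.+2 w.
  by apply/rowP => i; rewrite !mxE s1E.
have Y2 w : pick_row s2 (window Y (-1) (t + h).+2 w) = window Y (h%:Z - 1) t.+2 w.
  by apply/rowP => i; rewrite !mxE s2E; congr (Y _ w); lia.
have X1 v w : pick_row s1 (v *: window X (-1) (t + h).+2 w) = v *: window X (-1) t.+2 w.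
  by apply/rowP => i; rewrite !mxE s1E.
have X2 v w : pick_row s2 (v *: window X (-1) (t + h).+2 w) = v *: window X (h%:Z - 1) t.+2 w.
  by apply/rowP => i; rewrite !mxE s2E; congr (_ * X _ w); lia.
have mY m a (E : set 'rV[R]_m) : borel_set E -> measurable (window Y a m @^-1` E).
  by move=> bE; exact: measurable_margin_preimage.
have bb E : borel_set (@boundary R t.+2 E) by apply: closed_borel; exact: closed_boundary.
have D0 : pr P' (window Y (-1) (t + h).+2 @^-1` boundary D) = 0.
  have B0' := tail_shift_null alpha_gt0 stat tailY u_infty h%:Z (@closed_boundary B) (boundary_region rB) B0.
  apply/eqP; rewrite eq_le pr_ge0 andbT.
  have m1 := mY _ (-1) _ (bb A); have m2 := mY _ (h%:Z - 1) _ (bb B).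
  have U0 := pr_setU P' m1 m2; rewrite B0' addr0 (A0 : pr P' (window Y (-1) t.+2 @^-1` boundary A) = 0) in U0.
  apply: le_trans U0.
  apply: le_pr; [|exact: measurableU|].
    by apply: mY; apply: closed_borel; rewrite /boundary setDE; apply: closedI;
      [exact: closed_closure|apply: open_closedC; exact: open_interior].
  by move=> w /= /boundary_pick[] /=; rewrite ?Y1 ?Y2; [left|right].
have := @cond_pr_cvg _ _ _ _ _ _ P P' (fun n w => (u n)^-1 *: window X (-1) (t + h).+2 w)
  (fun n => exceed X 0 (u n)) (window Y (-1) (t + h).+2)
  (fun n => @measurable_scaled_window _ _ _ _ X (u n) (-1) _) (@measurable_margin _ _ _ _ Y _ _)
  (fun n => measurable_exceed X 0 (u n)) (@tail_window_cvg _ _ _ _ _ _ _ _ _ _ tailY u u_infty (-1) _) D bD D0.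
have -> : window Y (-1) (t + h).+2 @^-1` D =
    window Y (-1) t.+2 @^-1` A `&` window Y (h%:Z - 1) t.+2 @^-1` B.
  by apply/funext => w; rewrite /D /= Y1 Y2.
apply: cvg_trans; apply: near_eq_cvg; near=> n.
have u0 : 0 < u n by near: n; exact: v_gt0.
rewrite /cond_pr -mean_indic; last first.
  apply: measurableI; last exact: measurable_exceed.
  apply: (@measurable_preimage_row _ _ _ _ (fun w => (u n)^-1 *: window X (-1) (t + h).+2 w)) => //.
  exact: measurable_scaled_window.
congr (mean P _ / _); apply/funext => w.
rewrite /hit u0 !indicE -natrM mulnb; congr (nat_of_bool _)%:R.
apply/idP/idP => [/set_mem[]|/andP[/set_mem h1 /set_mem h2]].
  by rewrite /D /= X1 X2 => -[h1 h2] _; apply/andP; split; exact: mem_set.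
apply: mem_set; split; first by rewrite /D /= X1 X2.
have := rA _ h1 (lift ord0 ord0); rewrite /= !mxE mulrC ltr_pdivlMr// mul1r.
by [].
Unshelve. all: by end_near. Qed.

Lemma hit_cvg A : in_extreme_region A -> tail_continuity_set Y A ->
  mean P (fun w => hit (u n) A (window X (-1) t.+2 w)) / p n @[n --> \oo] --> tail_law Y A.
Proof.
move=> rA cA; have := @pair_cvg 0 A A rA rA cA cA.
rewrite /cross sub0r setIid; apply: cvg_trans; apply: near_eq_cvg.
apply: nearW => n; congr (mean P _ / _); apply/funext => w.
by rewrite hitI setIid.
Qed.

Lemma cross_0 A B : cross 0 A B = tail_law Y (A `&` B).
Proof. by rewrite /cross sub0r. Qed.

End PairLimits.

Section ConditionM.
Context {d : measure_display} {T : measurableType d} {R : realType}.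
Context {P : probability T R}.
Variables (X : int -> {RV P >-> R}) (u : nat -> R).
Local Notation p n := (pr P (exceed X 0 (u n))).
Local Notation q n h := (pr P (exceed X h (u n) `&` exceed X 0 (u n))).

Lemma cvge0_lt (f : nat -> \bar R) (e : R) : 0 < e -> f n @[n --> \oo] --> 0%E ->
  \forall n \near \oo, (f n < e%:E)%E.
Proof.
move=> e0 f0; suff : nbhs 0%E [set x : \bar R | (x < e%:E)%E] by move=> /f0.
exists e => // x /=; rewrite sub0r normrN lte_fin.
exact: le_lt_trans (ler_norm _).
Qed.

Lemma limn_esup_lt_near (v : nat -> R) (e : R) :
  (limn_esup (fun n => (v n)%:E) < e%:E)%E -> \forall n \near \oo, v n <= e.
Proof.
rewrite limn_esup_lim (cvg_lim (@ereal_hausdorff R) (@cvg_esups_inf R _)) => /ereal_inf_lt[_ [m _ <-] me].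
exists m => // n /= mn; rewrite -lee_fin; apply/ltW/(le_lt_trans _ me).
by apply: ereal_sup_ubound; exists n.
Qed.

Lemma gt0_of_infty : n%:R * p n @[n --> \oo] --> +oo -> \forall n \near \oo, 0 < p n.
Proof.
move=> /cvgryPgt/(_ 0); apply: filterS => n h.
rewrite lt_neqAle pr_ge0 andbT; apply: contraTneq h => <-.
by rewrite mulr0 ltxx.
Qed.

Lemma sum_shift_iota (f : nat -> R) r L : \sum_(r <= h < r + L) f h = \sum_(i < L) f (r + i)%N.
Proof. by rewrite -{1}[r]add0n big_addn addKn big_mkord; apply: eq_bigr => i _; rewrite addnC. Qed.

(** The three consequences of the condition that are used: vanishing
    exceedance probabilities, negligible mixing beyond the lag [r n], and
    uniformly small clustering probabilities up to that lag. *)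
Lemma condition_M_bounds : condition_M X u -> exists r : nat -> nat,
  [/\ u n @[n --> \oo] --> +oo, r n @[n --> \oo] --> \oo,
      n%:R * p n @[n --> \oo] --> +oo & (r n)%:R * p n @[n --> \oo] --> 0] /\
  [/\ p n @[n --> \oo] --> 0,
      forall e, 0 < e -> \forall n \near \oo, forall L,
        \sum_(i < L) alpha_mixing X (r n + i) <= e * p n &
      forall e, 0 < e -> exists k, \forall n \near \oo,
        \sum_(k <= h < (r n).+1) q n h <= e * p n].
Proof.
move=> [r [[uoo roo npoo rp0] [mix clus]]]; exists r; split => //.
have pg0 := gt0_of_infty npoo.
have r1 : \forall n \near \oo, (1 <= r n)%N by exact: (cvgnyPge _).1 roo 1%N.
split.
- apply/cvgrPdist_le => e e0; move/cvgrPdist_le/(_ _ e0) : rp0 => h.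
  near=> n.
  have h1 : `|0 - (r n)%:R * p n| <= e by near: n.
  have h2 : (1 <= r n)%N by near: n.
  move: h1; rewrite !sub0r !normrN !ger0_norm ?mulr_ge0 ?pr_ge0//; apply: le_trans.
  by rewrite ler_peMl ?pr_ge0// ler1n.
- move=> e e0; near=> n => L.
  have p0 : 0 < p n by near: n.
  have : ((p n)^-1%:E * \sum_(r n <= h <oo) (alpha_mixing X h)%:E < e%:E)%E.
    by near: n; exact: cvge0_lt mix.
  move=> /ltW h.
  have a0 : forall i, (r n <= i)%N -> true -> (0 <= (alpha_mixing X i)%:E)%E.
    by move=> i _ _; rewrite lee_fin alpha_mixing_ge0.
  have := @nneseries_lim_ge R (fun h => (alpha_mixing X h)%:E) xpredT (r n) (r n + L)%N a0.
  move=> h1; rewrite -ler_pdivrMr// mulrC -lee_fin EFinM; apply: le_trans h.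
  rewrite lee_pmul2l ?lte_fin ?invr_gt0//; apply: le_trans h1.
  by rewrite sumEFin sum_shift_iota.
- move=> e e0.
  have : \forall k \near \oo, (limn_esup (fun n => (\sum_(k <= h < (r n).+1)
      cond_pr P (exceed X h (u n)) (exceed X 0 (u n)))%:E) < e%:E)%E.
    exact: cvge0_lt clus.
  case=> k _ /(_ k (leqnn k)) /= /limn_esup_lt_near h; exists k.
  near=> n; have p0 : 0 < p n by near: n.
  have : \sum_(k <= h < (r n).+1) cond_pr P (exceed X h (u n)) (exceed X 0 (u n)) <= e by near: n.
  by rewrite /cond_pr -big_distrl /= ler_pdivrMr.
Unshelve. all: by end_near. Qed.

End ConditionM.

Section WindowSums.
Context {d d' : measure_display} {T : measurableType d} {T' : measurableType d'}.
Context {R : realType} {P : probability T R} {P' : probability T' R}.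
Variables (X : int -> {RV P >-> R}) (Y : int -> {RV P' >-> R}).
Hypothesis stat : strictly_stationary X.
Variable u : nat -> R.
Hypothesis X_M : condition_M X u.
Local Notation p n := (pr P (exceed X 0 (u n))).
Local Notation q n h := (pr P (exceed X h (u n) `&` exceed X 0 (u n))).
Variables (t m : nat) (A : 'I_m -> set 'rV[R]_t.+2) (a : 'I_m -> R).
Hypothesis rA : forall j, in_extreme_region (A j).
Hypothesis cA : forall j, tail_continuity_set Y (A j).

Definition comb (n : nat) (x : 'rV[R]_t.+2) : R := \sum_j a j * hit (u n) (A j) x.

Definition comb_mean n : R := mean P (fun w => comb n (window X (-1) t.+2 w)).

Definition summand n (i : nat) (w : T) : R := comb n (window X i%:Z t.+2 w) - comb_mean n.

Definition gamma n (h : nat) : R := mean P (fun w => summand n 0 w * summand n h w).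

Definition weight : R := 1 + \sum_j `|a j|.

Lemma weight_ge1 : 1 <= weight.
Proof. by rewrite lerDl sumr_ge0. Qed.

Lemma weight_gt0 : 0 < weight.
Proof. exact: lt_le_trans weight_ge1. Qed.

Lemma measurable_comb n : measurable_fun setT (comb n : borel_rV R t.+2 -> R).
Proof.
apply: (measurable_sum) => j; apply: measurable_funM => //.
exact: measurable_hit (cA j).1.
Qed.

Lemma comb_le_exceed n x :
  `|comb n x| <= weight * \1_[set y : 'rV[R]_t.+2 | u n < y 0 (lift ord0 ord0)] x.
Proof.
case/andP: (@indic01 R _ [set y : 'rV[R]_t.+2 | u n < y 0 (lift ord0 ord0)] x) => e0 _.
apply: (le_trans (ler_norm_sum _ _ _)).
apply: (@le_trans _ _ (\sum_j `|a j| * \1_[set y : 'rV[R]_t.+2 | u n < y 0 (lift ord0 ord0)] x)).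
  apply: ler_sum => j _; rewrite normrM ler_wpM2l// ger0_norm ?hit_ge0//.
  exact: hit_le_exceed.
by rewrite -mulr_suml ler_wpM2r// lerDr.
Qed.

Lemma comb_le n x : `|comb n x| <= weight.
Proof.
apply: (le_trans (comb_le_exceed n x)); rewrite ler_piMr ?(ltW weight_gt0)//.
Qed.

Lemma window_exceed v (h : nat) w :
  \1_[set y : 'rV[R]_t.+2 | v < y 0 (lift ord0 ord0)] (window X (h%:Z - 1) t.+2 w) =
  \1_(exceed X h v) w :> R.
Proof.
rewrite !indicE; congr (nat_of_bool _)%:R.
have E : (v < window X (h%:Z - 1) t.+2 w 0 (lift ord0 ord0)) = (v < X h%:Z w).
  by rewrite mxE /= subrK.
by apply/idP/idP => /set_mem /= h1; apply/mem_set => /=; [rewrite /exceed /= -E|rewrite E].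
Qed.

Lemma window_shift f M (b : int) : measurable_fun setT (f : borel_rV R t.+2 -> R) ->
  (forall x, `|f x| <= M) ->
  mean P (fun w => f (window X b t.+2 w)) = mean P (fun w => f (window X (-1) t.+2 w)).
Proof.
move=> mf fM; apply: etrans (mean_margin_shift stat (fun i : 'I_t.+2 => -1 + i%:Z) (b + 1) mf fM).
congr mean; apply/funext => w; congr (f (margin X _ w)); apply/funext => i; lia.
Qed.

Lemma window_shift2 f g M (b h : int) :
  measurable_fun setT (f : borel_rV R t.+2 -> R) -> (forall x, `|f x| <= M) ->
  measurable_fun setT (g : borel_rV R t.+2 -> R) -> (forall x, `|g x| <= M) ->
  mean P (fun w => f (window X b t.+2 w) * g (window X (b + h) t.+2 w)) =
  mean P (fun w => f (window X (-1) t.+2 w) * g (window X (h - 1) t.+2 w)).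
Proof.
move=> mf fM mg gM; apply: etrans (mean_margin_shift2 stat (fun i : 'I_t.+2 => -1 + i%:Z)
  (fun i : 'I_t.+2 => h - 1 + i%:Z) (b + 1) mf fM mg gM).
congr mean; apply/funext => w; congr (f (margin X _ w) * g (margin X _ w)).
  by apply/funext => i; lia.
by apply/funext => i; lia.
Qed.

Lemma bmf_comb n b : bmf (fun w => comb n (window X b t.+2 w)).
Proof. exact: (@bmf_margin _ _ _ _ X _ _ _ _ (measurable_comb n) (comb_le n)). Qed.

Lemma comb_mean_le n : `|comb_mean n| <= weight * p n.
Proof.
have bE := bmf_indic (measurable_exceed X 0 (u n)) : bmf (\1_(exceed X 0 (u n)) : T -> R).
apply: (le_trans (mean_norm _ (bmf_comb n _))).
rewrite -mean_indic; last exact: measurable_exceed.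
rewrite -meanZ//; apply: le_mean => [||w].
- exact/bmf_norm/bmf_comb.
- exact: bmfZ.
- by have := window_exceed (u n) 0 w; rewrite sub0r => <-; exact: comb_le_exceed.
Qed.

Lemma comb_mean_le_weight n : `|comb_mean n| <= weight.
Proof.
apply: (le_trans (comb_mean_le n)); rewrite ler_piMr ?(ltW weight_gt0)//.
by apply: pr_le1; exact: measurable_exceed.
Qed.

Lemma summand_le n i w : `|summand n i w| <= 2 * weight.
Proof.
apply: (le_trans (ler_normB _ _)); rewrite mulrDl mul1r.
by apply: lerD; [exact: comb_le|exact: comb_mean_le_weight].
Qed.

Lemma bmf_summand n i : bmf (summand n i).
Proof. by apply: bmfB; [exact: bmf_comb|exact: bmf_cst]. Qed.

Lemma summand_mean n i : mean P (summand n i) = 0.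
Proof.
rewrite meanB; [|exact: bmf_comb|exact: bmf_cst].
by rewrite (window_shift _ (measurable_comb n) (comb_le n)) mean_cst subrr.
Qed.

Lemma summand_cov_le n i h :
  mean P (fun w => summand n i w * summand n (i + h)%N w) = gamma n h.
Proof.
pose f x := comb n x - comb_mean n.
have mf : measurable_fun setT (f : borel_rV R t.+2 -> R).
  by apply: measurable_funB => //; exact: measurable_comb.
have fM x : `|f x| <= 2 * weight.
  apply: (le_trans (ler_normB _ _)); rewrite mulrDl mul1r.
  by apply: lerD; [exact: comb_le|exact: comb_mean_le_weight].
have := window_shift2 i%:Z h%:Z mf fM mf fM.
have := window_shift2 0 h%:Z mf fM mf fM; rewrite add0r => <-.
by rewrite -PoszD.
Qed.

Lemma summand_cov n i j :
  mean P (fun w => summand n i w * summand n j w) = gamma n ((i - j) + (j - i))%N.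
Proof.
have [ij|/ltnW ij] := leqP i j.
  by rewrite (eqP ij) add0n -(summand_cov_le n i) subnKC.
have -> : (i - j + (j - i) = i - j)%N by lia.
have E : (j + (i - j) = i)%N by lia.
have := summand_cov_le n j (i - j); rewrite E => <-.
by congr mean; apply/funext => w; rewrite mulrC.
Qed.

Lemma gamma_cov n h : gamma n h =
  cov P (fun w => comb n (window X 0 t.+2 w)) (fun w => comb n (window X h%:Z t.+2 w)).
Proof.
rewrite /gamma /summand /cov !(window_shift _ (measurable_comb n) (comb_le n)).
rewrite -/(comb_mean n).
set f := fun w => comb n (window X 0 t.+2 w); set g := fun w => comb n (window X h%:Z t.+2 w).
have bf : bmf f by exact: bmf_comb.
have bg : bmf g by exact: bmf_comb.
rewrite (_ : (fun _ => _) = fun w => f w * g w - (comb_mean n * f w + comb_mean n * g w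
    - comb_mean n * comb_mean n)); last by apply/funext => w; rewrite /f /g; ring.
have bc : bmf (fun _ : T => comb_mean n * comb_mean n) by exact: bmf_cst.
have b1 := bmfZ (comb_mean n) bf; have b2 := bmfZ (comb_mean n) bg.
have b3 := bmfD b1 b2; have b4 := bmfB b3 bc; have b5 := bmfM bf bg.
rewrite (meanB P b5 b4) (meanB P b3 bc) (meanD P b1 b2) mean_cst !meanZ//.
rewrite !(window_shift _ (measurable_comb n) (comb_le n)) -/(comb_mean n); ring.
Qed.

Lemma gammaE n h : gamma n h =
  mean P (fun w => comb n (window X (-1) t.+2 w) * comb n (window X (h%:Z - 1) t.+2 w))
  - comb_mean n * comb_mean n.
Proof.
rewrite gamma_cov /cov !(window_shift _ (measurable_comb n) (comb_le n)) -/(comb_mean n).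
have := window_shift2 0 h%:Z (measurable_comb n) (comb_le n) (measurable_comb n) (comb_le n).
by rewrite add0r => ->.
Qed.

Lemma gamma_le_q n h : `|gamma n h| <= weight ^+ 2 * (q n h + p n ^+ 2).
Proof.
rewrite gammaE mulrDr; apply: (le_trans (ler_normB _ _)); apply: lerD; last first.
  by rewrite normrM -exprMn expr2 ler_pM// comb_mean_le.
have mE : measurable (exceed X h (u n) `&` exceed X 0 (u n)).
  by apply: measurableI; exact: measurable_exceed.
have bm := bmfM (bmf_comb n (-1)) (bmf_comb n (h%:Z - 1)).
apply: (le_trans (mean_norm P bm)).
rewrite -mean_indic// -meanZ; last exact: bmf_indic.
apply: le_mean => [||w]; [exact: bmf_norm|by apply: bmfZ; exact: bmf_indic|].
rewrite normrM indicI /= [_ * \1__ w]mulrC.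
rewrite expr2 mulrACA; have := window_exceed (u n) 0 w; rewrite sub0r => <-.
by rewrite -(window_exceed (u n) h w) ler_pM// comb_le_exceed.
Qed.

Lemma gamma_le_alpha n h : `|gamma n (h + t.+1)| <= 4 * weight ^+ 2 * alpha_mixing X h.
Proof.
rewrite gamma_cov expr2; have w0 := weight_gt0.
apply: (@cov_margin_le _ _ _ _ X stat _ _ _ _ t.+1%:Z) => //; first 2 last.
- exact: measurable_comb.
- exact: comb_le.
- exact: measurable_comb.
- exact: comb_le.
- by move=> i; have := ltn_ord i; lia.
- by move=> i; lia.
Qed.

Lemma q_le_alpha n h : q n h <= p n ^+ 2 + 4 * alpha_mixing X h.
Proof.
pose B : set 'rV[R]_1 := [set x | u n < x 0 ord0].
have bB : borel_set B.
  apply: open_borel; have := open_comp (f := fun z : 'rV[R]_1 => z 0 ord0) _ (@open_gt _ (u n)).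
  by apply => z _; exact: coord_continuous.
have mB : measurable_fun setT (\1_B : borel_rV R 1 -> R) by exact: measurable_indic.
have B1 (x : 'rV[R]_1) : `|\1_B x : R| <= 1.
  by case/andP: (@indic01 R _ B x) => h0 h1; rewrite ger0_norm.
have E k w : \1_B (margin X (fun _ : 'I_1 => k%:Z) w) = \1_(exceed X k (u n)) w :> R.
  rewrite !indicE; congr (nat_of_bool _)%:R.
  by apply/idP/idP => /set_mem /=; rewrite /B /= => h1; apply/mem_set; move: h1; rewrite /= mxE.
have := @cov_margin_le _ _ _ _ X stat _ _ (fun _ : 'I_1 => 0%:Z) (fun _ : 'I_1 => h%:Z)
  0 h (\1_B) (\1_B) 1 1 (fun=> lexx _) _ ltr01 ltr01 mB B1 mB B1.
rewrite mulr1 mulr1; under [X in cov P X _]eq_fun do rewrite E.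
under [X in cov P _ X]eq_fun do rewrite E.
have mE := measurable_exceed X.
rewrite /cov !mean_indic// => H.
have /H : 'I_1 -> 0 + h%:Z <= h%:Z by move=> _; rewrite add0r.
have -> : pr P (exceed X h (u n)) = p n.
  have := stat (fun _ : 'I_1 => 0) h%:Z bB.
  rewrite /pr => e; congr fine; rewrite -[RHS](_ : P (margin X (fun _ : 'I_1 => 0) @^-1` B) = _); last first.
    by congr (P _); apply/seteqP; split => w /=; rewrite /B /= mxE.
  by rewrite -e; congr (P _); apply/seteqP; split => w; rewrite /B /= mxE add0r.
rewrite -(_ : q n h = mean P (fun w => \1_(exceed X 0 (u n)) w * \1_(exceed X h (u n)) w)).
  by move=> /(le_trans (ler_norm _)); rewrite lerBlDl expr2.
rewrite -mean_indic; last exact: measurableI.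
by congr mean; apply/funext => w; rewrite indicI /= mulrC.
Qed.

Lemma sum_split3 (f : nat -> R) k B s L : (forall i, 0 <= f i) ->
  \sum_(i < L | (k <= i)%N) f i <=
  \sum_(k <= i < B) f i + \sum_(i < s) f (B + i)%N + \sum_(i < L) f (B + s + i)%N.
Proof.
move=> f0; rewrite -!sum_shift_iota (@big_nat_widenl _ _ _ k 0%N)//.
pose g i := if (k <= i)%N then f i else 0.
have g0 i : 0 <= g i by rewrite /g; case: ifP.
have gf i : g i <= f i by rewrite /g; case: ifP.
rewrite -(big_mkord (fun i => (k <= i)%N)) [X in X <= _](_ : _ = \sum_(0 <= i < L) g i); last first.
  by rewrite big_mkcond.
rewrite [X in _ <= X + _ + _](_ : _ = \sum_(0 <= i < B) g i); last by rewrite big_mkcond.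
apply: (@le_trans _ _ (\sum_(0 <= i < B + s + L) g i)).
  rewrite (@big_cat_nat _ _ _ L 0 (B + s + L)%N)//=; last by lia.
  by rewrite lerDl; apply: sumr_ge0 => i _.
rewrite (@big_cat_nat _ _ _ (B + s)%N 0 (B + s + L)%N)//=; last by lia.
rewrite (@big_cat_nat _ _ _ B 0 (B + s)%N)//=; last by lia.
by rewrite !lerD// ler_sum.
Qed.

(** Covariances are summable uniformly in [n] on the scale [p n]: up to the lag
    [r n] by the clustering bound, beyond it by mixing. *)
Lemma gamma_tail e : 0 < e -> exists k, \forall n \near \oo,
  forall L, \sum_(i < L | (k <= i)%N) `|gamma n i| <= e * p n.
Proof.
move=> e0; have [r [[_ _ npoo rp0] [p0 mix clus]]] := condition_M_bounds X_M.
pose c := weight ^+ 2; have c0 : 0 < c by rewrite exprn_gt0// weight_gt0.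
pose e' := e / (10 * c); have e'0 : 0 < e' by rewrite divr_gt0// mulr_gt0.
have [k hk] := clus _ e'0; exists k.
have hrest : (r n)%:R * p n + (1 + 2 * t%:R) * p n @[n --> \oo] --> (0 : R).
  rewrite -[X in _ --> X](addr0 0) -[X in _ --> _ + X](mulr0 (1 + 2 * t%:R)).
  by apply: cvgD => //; apply: cvgZr.
move/cvgrPdist_le/(_ _ e'0) : hrest => hrest.
have hmix := mix _ e'0.
near=> n => L; have P0 : 0 < p n by near: n; exact: gt0_of_infty npoo.
have h1 : \sum_(k <= h < (r n).+1) q n h <= e' * p n by near: n.
have h2 : forall L, \sum_(i < L) alpha_mixing X (r n + i) <= e' * p n by near: n.
have h3 : `|0 - ((r n)%:R * p n + (1 + 2 * t%:R) * p n)| <= e' by near: n.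
apply: (le_trans (sum_split3 k (r n).+1 t L (fun i => normr_ge0 (gamma n i)))).
have s1 : \sum_(k <= i < (r n).+1) `|gamma n i| <= c * (e' * p n + (r n).+1%:R * p n ^+ 2).
  apply: (@le_trans _ _ (\sum_(k <= i < (r n).+1) c * (q n i + p n ^+ 2))).
    by apply: ler_sum => i _; exact: gamma_le_q.
  rewrite -mulr_sumr big_split /= ler_wpM2l ?(ltW c0)// lerD// sumr_const_nat.
  by rewrite -[leLHS]mulr_natl ler_wpM2r ?sqr_ge0// ler_nat leq_subr.
have s2 : \sum_(i < t) `|gamma n ((r n).+1 + i)| <= c * (2 * t%:R * p n ^+ 2 + 4 * (e' * p n)).
  apply: (@le_trans _ _ (\sum_(i < t) c * (2 * p n ^+ 2 + 4 * alpha_mixing X ((r n).+1 + i)))).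
    apply: ler_sum => i _; apply: (le_trans (gamma_le_q _ _)); rewrite ler_wpM2l ?(ltW c0)//.
    have := q_le_alpha n ((r n).+1 + i); set z := 4 * _; set y := p n ^+ 2.
    by move=> qz; rewrite mulrDl mul1r addrC -addrA lerD2l.
  rewrite -mulr_sumr ler_wpM2l ?(ltW c0)// big_split /= sumr_const card_ord -[_ *+ t]mulr_natl.
  rewrite lerD//; first by rewrite le_eqVlt; apply/orP; left; apply/eqP; ring.
  rewrite -mulr_sumr ler_wpM2l//; apply: (le_trans _ (h2 t.+1)).
  rewrite big_ord_recl /=; apply: ler_wpDl; first exact: alpha_mixing_ge0.
  by apply: ler_sum => i _; rewrite /bump /= addnA addn1.
have s3 : \sum_(i < L) `|gamma n ((r n).+1 + t + i)| <= c * (4 * (e' * p n)).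
  apply: (@le_trans _ _ (\sum_(i < L) c * (4 * alpha_mixing X (r n + i)))).
    apply: ler_sum => i _; rewrite (_ : ((r n).+1 + t + i = (r n + i) + t.+1)%N); last by lia.
    by apply: (le_trans (gamma_le_alpha _ _)); rewrite -/c mulrA (mulrC c).
  rewrite -mulr_sumr -mulr_sumr ler_wpM2l ?(ltW c0)// ler_wpM2l//.
apply: (le_trans (lerD (lerD s1 s2) s3)).
move: h3; rewrite sub0r normrN ger0_norm; last first.
  by rewrite addr_ge0 ?mulr_ge0 ?addr_ge0// ?ltW// ?mulr_ge0.
move=> h3; rewrite [X in X <= _](_ : _ = c * (9 * e' + ((r n)%:R * p n + (1 + 2 * t%:R) * p n)) * p n); last first.
  by rewrite -natr1; ring.
rewrite ler_wpM2r ?(ltW P0)// (@le_trans _ _ (c * (9 * e' + e')))//.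
  by rewrite ler_wpM2l ?(ltW c0)// lerD2l.
rewrite /e' (_ : c * _ = e)//; field; exact: lt0r_neq0.
Unshelve. all: by end_near. Qed.

End WindowSums.

Lemma cvg_fin_sum (R : realType) (I : Type) (r : seq I) (f : I -> nat -> R) (l : I -> R) :
  (forall i, f i n @[n --> \oo] --> l i) ->
  \sum_(i <- r) f i n @[n --> \oo] --> \sum_(i <- r) l i.
Proof.
move=> fl; elim: r => [|i r IH].
  by rewrite big_nil; under eq_fun do rewrite big_nil; exact: cvg_cst.
by rewrite big_cons; under eq_fun do rewrite big_cons; exact: cvgD.
Qed.

Lemma tail_sum_le (R : realType) (f : nat -> R) (k1 k j : nat) : (forall i, 0 <= f i) ->
  (k1 <= k.+1)%N -> (k <= j)%N ->
  \sum_(k <= h < j) f h.+1 <= \sum_(i < j.+1 | (k1 <= i)%N) f i.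
Proof.
move=> f0 k1k kj; rewrite -(big_mkord (fun i => (k1 <= i)%N) f).
rewrite [leRHS](_ : _ = \sum_(k1 <= i < j.+1) f i); last by rewrite [RHS](@big_nat_widenl _ _ _ k1 0%N).
rewrite [leRHS](@big_cat_nat _ _ _ k.+1)//= [X in _ <= _ + X]big_add1 /=.
by apply: ler_wpDl => //; apply: sumr_ge0.
Qed.

(** A nonnegative series with bounded partial sums, whose sum is read in the
    extended reals, is finite and is the limit of its partial sums. *)
Lemma bounded_series (R : realType) (f : nat -> R) (M : R) :
  (forall h, 0 <= f h) -> (forall n, \sum_(1 <= h < n) f h <= M) ->
  (\sum_(1 <= h <oo) (f h)%:E)%E \is a fin_num /\
  \sum_(1 <= h < n) f h @[n --> \oo] --> fine (\sum_(1 <= h <oo) (f h)%:E)%E.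
Proof.
move=> f0 fM.
have f0' : forall h, (1 <= h)%N -> true -> (0 <= (f h)%:E)%E by move=> h _ _; rewrite lee_fin.
have cv := is_cvg_nneseries f0'.
have fin : (\sum_(1 <= h <oo) (f h)%:E)%E \is a fin_num.
  rewrite ge0_fin_numE; last exact: nneseries_ge0.
  apply: (@le_lt_trans _ _ M%:E); last by rewrite ltry.
  by apply: lime_le => //; apply: nearW => n; rewrite sumEFin lee_fin.
split => //; move: cv => /cvg_ex[l hl].
have ll : (\sum_(1 <= h <oo) (f h)%:E)%E = l by apply/cvg_lim.
rewrite ll in fin *; move: hl; rewrite -(fineK fin) => /fine_cvg.
by apply: cvg_trans; apply: near_eq_cvg; apply: nearW => n /=; rewrite sumEFin.
Qed.

Section LimitVariance.
Context {d d' : measure_display} {T : measurableType d} {T' : measurableType d'}.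
Context {R : realType} {P : probability T R} {P' : probability T' R}.
Variables (X : int -> {RV P >-> R}) (Y : int -> {RV P' >-> R}) (alpha : R).
Hypothesis alpha_gt0 : 0 < alpha.
Hypothesis stat : strictly_stationary X.
Hypothesis tailY : is_tail_process X Y alpha.
Variable u : nat -> R.
Hypothesis X_M : condition_M X u.
Local Notation p n := (pr P (exceed X 0 (u n))).
Local Notation q n h := (pr P (exceed X h (u n) `&` exceed X 0 (u n))).
Variables (t m : nat) (A : 'I_m -> set 'rV[R]_t.+2).
Hypothesis rA : forall j, in_extreme_region (A j).
Hypothesis cA : forall j, tail_continuity_set Y (A j).
Local Notation cross := (@cross _ _ _ P' Y t).

Lemma threshold_infty : u n @[n --> \oo] --> +oo.
Proof. by have [r [[]]] := condition_M_bounds X_M. Qed.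

Lemma cross_ge0 h j l : 0 <= cross h (A j) (A l).
Proof. exact: pr_ge0. Qed.

Lemma pair_le_q n h j l :
  mean P (fun w => hit (u n) (A j) (window X (-1) t.+2 w) *
                   hit (u n) (A l) (window X (h%:Z - 1) t.+2 w)) <= q n h.
Proof.
have mE : measurable (exceed X h (u n) `&` exceed X 0 (u n)).
  by apply: measurableI; exact: measurable_exceed.
have bh b i : bmf (fun w => hit (u n) (A i) (window X b t.+2 w)).
  exact: (@bmf_margin _ _ _ _ X _ _ _ _ (measurable_hit (u n) (cA i).1) (hit_norm (u n) (A i))).
rewrite -mean_indic//; apply: le_mean => [||w].
- by apply: bmfM; exact: bh.
- exact: bmf_indic.
rewrite indicI /= mulrC; have := window_exceed X t (u n) 0 w; rewrite sub0r => <-.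
by rewrite -(window_exceed X t (u n) h w) ler_pM ?hit_ge0// hit_le_exceed.
Qed.

Lemma cross_sum_le j l : exists M : R, forall n, \sum_(1 <= h < n) cross h (A j) (A l) <= M.
Proof.
have [r [[_ roo npoo rp0] [p0 mix clus]]] := condition_M_bounds X_M.
have [k hk] := clus 1 ltr01.
have mY b E : borel_set E -> measurable (window Y b t.+2 @^-1` E).
  by move=> bE; exact: measurable_margin_preimage.
have c1 h : cross h (A j) (A l) <= 1.
  by apply: pr_le1; apply: measurableI; apply: mY; exact: (cA _).1.
have tail L : \sum_(k <= h < L) cross h (A j) (A l) <= 1.
  have lim : \sum_(k <= h < L) (mean P (fun w => hit (u n) (A j) (window X (-1) t.+2 w) *
      hit (u n) (A l) (window X (h%:Z - 1) t.+2 w)) / p n) @[n --> \oo]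
      --> \sum_(k <= h < L) cross h (A j) (A l).
    apply: cvg_fin_sum => h; exact: (pair_cvg alpha_gt0 stat tailY threshold_infty).
  apply: (cvgr_to_le lim); near=> n.
  have P0 : 0 < p n by near: n; exact: gt0_of_infty npoo.
  have Lr : (L <= r n)%N by near: n; exact: (cvgnyPge _).1 roo L.
  have h1 : \sum_(k <= h < (r n).+1) q n h <= 1 * p n by near: n.
  rewrite -big_distrl /= ler_pdivrMr//; apply: le_trans h1.
  apply: (@le_trans _ _ (\sum_(k <= h < L) q n h)).
    by apply: ler_sum => h _; exact: pair_le_q.
  have [kL|Lk] := leqP k L; last by rewrite big_geq ?sumr_ge0// => *; rewrite ?pr_ge0// ltnW.
  rewrite [leRHS](@big_cat_nat _ _ _ L)//=; last exact: leqW.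
  by rewrite lerDl sumr_ge0// => i _; exact: pr_ge0.
exists (k%:R + 1) => n.
apply: (@le_trans _ _ (\sum_(0 <= h < k + n) cross h (A j) (A l))).
  case: n => [|n]; first by rewrite big_geq// sumr_ge0// => h _; exact: cross_ge0.
  rewrite [leRHS](@big_cat_nat _ _ _ n.+1)//= ?leq_addl//.
  apply: ler_wpDr; first by apply: sumr_ge0 => h _; exact: cross_ge0.
  by rewrite [leRHS]big_ltn//; apply: ler_wpDl => //; exact: cross_ge0.
rewrite (@big_cat_nat _ _ _ k)//= ?leq_addr//; apply: lerD => //.
apply: (@le_trans _ _ (\sum_(0 <= h < k) 1)); first by apply: ler_sum => h _.
by rewrite sumr_const_nat subn0.
Unshelve. all: by end_near. Qed.

Lemma sigma_entryE j l :
  sigma_entry Y (A j) (A l) = ((cross 0 (A j) (A l))%:E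
    + \sum_(1 <= h <oo) (cross h (A j) (A l))%:E + \sum_(1 <= h <oo) (cross h (A l) (A j))%:E)%E.
Proof.
have E h i i' : P' (window Y (-1) t.+2 @^-1` A i `&` window Y (h%:Z - 1) t.+2 @^-1` A i') =
    (cross h (A i) (A i'))%:E.
  by apply: prE; apply: measurableI; apply: measurable_margin_preimage; exact: (cA _).1.
rewrite /sigma_entry cross_0; congr (_ + _ + _)%E.
  by apply: eq_eseriesr => h _; exact: E.
by apply: eq_eseriesr => h _; exact: E.
Qed.

Lemma sigma_entry_fin_num j l : sigma_entry Y (A j) (A l) \is a fin_num.
Proof.
have [M1 h1] := cross_sum_le j l; have [M2 h2] := cross_sum_le l j.
have [f1 _] := bounded_series (fun h => cross_ge0 h j l) h1.
have [f2 _] := bounded_series (fun h => cross_ge0 h l j) h2.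
by rewrite sigma_entryE !fin_numD f1 f2.
Qed.

Lemma sigma_entry_cvg j l :
  cross 0 (A j) (A l) + \sum_(1 <= h < n) cross h (A j) (A l)
    + \sum_(1 <= h < n) cross h (A l) (A j) @[n --> \oo]
    --> fine (sigma_entry Y (A j) (A l)).
Proof.
have [M1 h1] := cross_sum_le j l; have [M2 h2] := cross_sum_le l j.
have [f1 l1] := bounded_series (fun h => cross_ge0 h j l) h1.
have [f2 l2] := bounded_series (fun h => cross_ge0 h l j) h2.
rewrite sigma_entryE !fineD ?fin_numD ?f1 ?f2//.
by apply: cvgD => //; apply: cvgD => //; exact: cvg_cst.
Qed.

Lemma sigma_entryC j l : fine (sigma_entry Y (A j) (A l)) = fine (sigma_entry Y (A l) (A j)).
Proof.
rewrite !sigma_entryE !cross_0 setIC; congr fine.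
by rewrite -!addeA; congr (_ + _)%E; rewrite addeC.
Qed.

Section Combination.
Variable a : 'I_m -> R.
Local Notation gamma := (gamma X u A a).
Local Notation comb_mean := (comb_mean X u A a).

Definition limit_cov h : R := \sum_j \sum_l a j * a l * cross h (A j) (A l).

Definition limit_var : R := \sum_j \sum_l a j * a l * fine (sigma_entry Y (A j) (A l)).

Lemma comb_mean_cvg0 : comb_mean n @[n --> \oo] --> 0.
Proof.
have [r [_ [p0 _ _]]] := condition_M_bounds X_M.
apply/cvgrPdist_le => e e0.
have w0 := @weight_gt0 R m a.
have := p0; move/cvgrPdist_le => /(_ (e / weight a)); rewrite divr_gt0// => /(_ isT).
apply: filterS => n; rewrite !sub0r !normrN ger0_norm ?pr_ge0// => h.
apply: (le_trans (comb_mean_le X u a rA cA n)).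
by rewrite mulrC -ler_pdivlMr.
Qed.

Lemma gamma_cvg h : gamma n h / p n @[n --> \oo] --> limit_cov h.
Proof.
have [r [[_ _ npoo _] [p0 _ _]]] := condition_M_bounds X_M.
have bh n b i : bmf (fun w => hit (u n) (A i) (window X b t.+2 w)).
  exact: (@bmf_margin _ _ _ _ X _ _ _ _ (measurable_hit (u n) (cA i).1) (hit_norm (u n) (A i))).
pose D n j l := mean P (fun w => hit (u n) (A j) (window X (-1) t.+2 w) *
                   hit (u n) (A l) (window X (h%:Z - 1) t.+2 w)).
have bD n j l : bmf (fun w => hit (u n) (A j) (window X (-1) t.+2 w) *
    hit (u n) (A l) (window X (h%:Z - 1) t.+2 w)) by exact: bmfM.
have E n : gamma n h / p n = \sum_j \sum_l a j * a l * (D n j l / p n)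
    - (comb_mean n / p n) * comb_mean n.
  rewrite (gammaE stat u a rA cA) mulrBl; congr (_ - _); last by rewrite mulrAC.
  rewrite (_ : mean P _ = \sum_j \sum_l a j * a l * D n j l).
    rewrite mulr_suml; apply: eq_bigr => j _; rewrite mulr_suml; apply: eq_bigr => l _.
    by rewrite mulrA.
  rewrite (_ : (fun _ => _) = fun w => \sum_j \sum_l a j * a l *
      (hit (u n) (A j) (window X (-1) t.+2 w) * hit (u n) (A l) (window X (h%:Z - 1) t.+2 w))).
    rewrite mean_sum; last by move=> j _; apply: bmf_sum => l _; exact: bmfZ.
    apply: eq_bigr => j _; rewrite mean_sum; last by move=> l _; exact: bmfZ.
    by apply: eq_bigr => l _; rewrite meanZ.
  apply/funext => w; rewrite /comb big_distrlr /=; apply: eq_bigr => j _.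
  by apply: eq_bigr => l _; rewrite mulrACA.
under eq_fun do rewrite E.
rewrite -[limit_cov h]subr0; apply: cvgB.
  apply: cvg_fin_sum => j; apply: cvg_fin_sum => l; apply: cvgZr.
  exact: (pair_cvg alpha_gt0 stat tailY threshold_infty).
apply/cvgrPdist_le => e e0.
have w0 := @weight_gt0 R m a.
have := comb_mean_cvg0; move/cvgrPdist_le => /(_ (e / weight a)); rewrite divr_gt0// => /(_ isT) hc.
near=> n; have P0 : 0 < p n by near: n; exact: gt0_of_infty npoo.
have h1 : `|0 - comb_mean n| <= e / weight a by near: n.
rewrite sub0r normrN in h1; rewrite sub0r normrN normrM normrM normfV (ger0_norm (ltW P0)).
apply: (@le_trans _ _ (weight a * (e / weight a))); last by rewrite mulrC divfK ?gt_eqF.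
rewrite ler_pM// ?mulr_ge0// ?invr_ge0 ?(ltW P0)// ler_pdivrMr//.
exact: comb_mean_le.
Unshelve. all: by end_near. Qed.

Lemma partial_limit_cov k : partial_cov limit_cov k =
  \sum_j \sum_l a j * a l * (cross 0 (A j) (A l) + \sum_(1 <= h < k.+1) cross h (A j) (A l)
    + \sum_(1 <= h < k.+1) cross h (A l) (A j)).
Proof.
have S : \sum_j \sum_l a j * a l * \sum_(1 <= h < k.+1) cross h (A j) (A l) =
    \sum_(h < k) limit_cov h.+1.
  rewrite /limit_cov [RHS]exchange_big; apply: eq_bigr => j _ /=.
  rewrite [RHS]exchange_big; apply: eq_bigr => l _ /=.
  by rewrite mulr_sumr big_add1 big_mkord.
have S' : \sum_j \sum_l a j * a l * \sum_(1 <= h < k.+1) cross h (A l) (A j) =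
    \sum_(h < k) limit_cov h.+1.
  rewrite -S exchange_big; apply: eq_bigr => j _; apply: eq_bigr => l _.
  by rewrite (mulrC (a l)).
under eq_bigr => j _ do (under eq_bigr => l _ do rewrite !mulrDr; rewrite !big_split /=).
by rewrite !big_split /= S S' /partial_cov mulr2n mulrDl mul1r addrA.
Qed.

Lemma partial_limit_cov_cvg : partial_cov limit_cov k @[k --> \oo] --> limit_var.
Proof.
under eq_fun do rewrite partial_limit_cov.
apply: cvg_fin_sum => j; apply: cvg_fin_sum => l; apply: cvgZr.
have := @sigma_entry_cvg j l; rewrite -(cvg_shiftS _) /=.
exact.
Qed.

Lemma partial_gamma_lim k :
  partial_cov (gamma n) k / p n @[n --> \oo] --> partial_cov limit_cov k.
Proof.
rewrite /partial_cov; under eq_fun do rewrite mulrDl -mulrA mulr_suml.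
apply: cvgD; first exact: gamma_cvg.
by apply: cvgZr; apply: cvg_fin_sum => h; exact: gamma_cvg.
Qed.

Lemma partial_gamma_cvg e : 0 < e -> exists k, \forall n \near \oo,
  forall j, (k <= j)%N -> `|partial_cov (gamma n) j / p n - limit_var| <= e.
Proof.
move=> e0; have e40 : 0 < e / 4 by rewrite divr_gt0.
have [r [[_ _ npoo _] _]] := condition_M_bounds X_M.
have [k1 hk1] := gamma_tail stat X_M a rA cA e40.
have [k2 _ hk2] := (cvgrPdist_le _ _).1 partial_limit_cov_cvg _ e40.
pose k := maxn k1 k2; exists k.
have hl := (cvgrPdist_le _ _).1 (@partial_gamma_lim k) _ e40.
near=> n => j kj; have P0 : 0 < p n by near: n; exact: gt0_of_infty npoo.
have h1 : forall L, \sum_(i < L | (k1 <= i)%N) `|gamma n i| <= e / 4 * p n by near: n.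
have h2 : `|partial_cov limit_cov k - partial_cov (gamma n) k / p n| <= e / 4 by near: n; exact: hl.
have h3 := hk2 k (leq_maxr _ _); rewrite /= in h3.
have h4 : `|partial_cov (gamma n) j / p n - partial_cov (gamma n) k / p n| <= 2 * (e / 4).
  rewrite -mulrBl normrM normfV (gtr0_norm P0) ler_pdivrMr//.
  have -> : partial_cov (gamma n) j - partial_cov (gamma n) k =
      2 * \sum_(k <= h < j) gamma n h.+1.
    rewrite /partial_cov -!(big_mkord xpredT (fun h => gamma n h.+1)).
    by rewrite (@big_cat_nat _ _ _ k 0 j)//=; ring.
  rewrite normrM ger0_norm// -mulrA ler_wpM2l//; apply: le_trans (h1 j.+1).
  apply: (le_trans (ler_norm_sum _ _ _)).
  apply: (@tail_sum_le _ (fun i => `|gamma n i|)) => //.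
  by rewrite leqW// leq_maxl.
rewrite (_ : e = 2 * (e / 4) + (e / 4 + e / 4)); last by field.
rewrite (_ : _ - limit_var = (partial_cov (gamma n) j / p n - partial_cov (gamma n) k / p n) +
  ((partial_cov (gamma n) k / p n - partial_cov limit_cov k) + (partial_cov limit_cov k - limit_var)));
  last by ring.
apply: (le_trans (ler_normD _ _)); apply: lerD => //.
by apply: (le_trans (ler_normD _ _)); apply: lerD; rewrite distrC.
Unshelve. all: by end_near. Qed.

Lemma gamma_sum_le : exists2 G : R, 0 < G & \forall n \near \oo,
  forall L, \sum_(h < L) `|gamma n h| <= G * p n.
Proof.
have [r [[_ _ npoo _] _]] := condition_M_bounds X_M.
have [k hk] := gamma_tail stat X_M a rA cA ltr01.
have w0 := @weight_gt0 R m a.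
exists (1 + k%:R * (2 * weight a ^+ 2)).
  by apply: ltr_pwDl => //; rewrite !mulr_ge0 ?exprn_ge0 ?(ltW w0).
near=> n => L; have P0 : 0 < p n by near: n; exact: gt0_of_infty npoo.
have h1 : forall L, \sum_(i < L | (k <= i)%N) `|gamma n i| <= 1 * p n by near: n.
rewrite (bigID (fun i : 'I_L => (k <= i)%N)) /= mulrDl; apply: lerD; first exact: h1.
apply: (@le_trans _ _ (\sum_(0 <= i < k) 2 * weight a ^+ 2 * p n)); last first.
  by rewrite sumr_const_nat subn0 -[leLHS]mulr_natl mulrA.
apply: (@le_trans _ _ (\sum_(i < L | ~~ (k <= i)%N) 2 * weight a ^+ 2 * p n)).
  apply: ler_sum => i _; apply: (le_trans (gamma_le_q stat u a rA cA n i)).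
  rewrite [2 * _]mulrC -[leRHS]mulrA ler_wpM2l ?exprn_ge0 ?(ltW w0)// mulr2n mulrDl mul1r lerD//.
    by apply: le_pr => [||w []//]; [apply: measurableI; exact: measurable_exceed|exact: measurable_exceed].
  by rewrite expr2 ler_piMl ?pr_ge0 ?pr_le1//; exact: measurable_exceed.
have cc : 0 <= 2 * weight a ^+ 2 * p n by rewrite !mulr_ge0 ?exprn_ge0 ?(ltW w0)// pr_ge0.
rewrite big_mkcond (eq_bigr (fun i : 'I_L => (nat_of_bool (i < k)%N)%:R * (2 * weight a ^+ 2 * p n))).
  by rewrite sumr_const_nat subn0 -[leRHS]mulr_natl -mulr_suml -natr_sum ler_wpM2r// ler_nat sum_ltn_le.
by move=> i _; rewrite -ltnNge; case: ifP => _; rewrite ?mul1r ?mul0r.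
Unshelve. all: by end_near. Qed.

(** The limit variance is nonnegative because it is the limit of the normalized
    variances of long blocks. *)
Lemma limit_var_ge0 : 0 <= limit_var.
Proof.
have b0 b : 0 <= series (partial_cov limit_cov) b.
  rewrite /series /= big_mkord.
  have lim : (\sum_(j < b) partial_cov (gamma n) j) / p n @[n --> \oo]
      --> \sum_(j < b) partial_cov limit_cov j.
    under eq_fun do rewrite mulr_suml.
    by apply: cvg_fin_sum => j; exact: (@partial_gamma_lim j).
  apply: (cvgr_to_ge lim); apply: nearW => n.
  rewrite mulr_ge0 ?invr_ge0 ?pr_ge0//.
  rewrite -(mean_sqr_block (fun i => (bmf_summand X u a rA cA n i).1) (summand_le X u a rA cA n)
    (summand_cov stat u a rA cA n) 0).
  by apply: mean_ge0 => w; exact: sqr_ge0.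
apply: (cvgr_to_ge (cesaro partial_limit_cov_cvg)); apply: nearW => n.
by rewrite /arithmetic_mean /= mulr_ge0.
Qed.

End Combination.
End LimitVariance.

Lemma gap_aux (R : realType) (t n z s : R) : 0 <= t -> 0 <= n -> 4 * (t + 1 + n) <= z ->
  z < s + 1 -> t + z / 4 <= s.
Proof. by move=> *; lra. Qed.

Section Rates.
Context {R : realType}.
Variables (p : nat -> R) (delta : R).
Hypothesis p_ge0 : forall n, 0 <= p n.
Hypothesis p_cvg0 : p n @[n --> \oo] --> 0.
Hypothesis np_infty : n%:R * p n @[n --> \oo] --> +oo.
Hypothesis delta_ge2 : 2 <= delta.
Hypothesis delta_gt2 : 2 < delta -> n%:R `^ (delta / (4 + delta)) * p n @[n --> \oo] --> +oo.
Hypothesis delta_eq2 : delta = 2 ->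
  n%:R `^ (1 / 2) * (p n `^ (3 / 2) / `|ln (p n)|) @[n --> \oo] --> +oo.
Local Notation rho n := (Num.sqrt (n%:R * p n)).

Lemma rate_gt0 : \forall n \near \oo, 0 < p n.
Proof.
move/cvgryPgt/(_ 0) : np_infty; apply: filterS => n h.
by rewrite lt_neqAle p_ge0 andbT; apply: contraTneq h => <-; rewrite mulr0 ltxx.
Qed.

Lemma rho_pow n r : rho n `^ r = (n%:R * p n) `^ (r / 2).
Proof. by rewrite -powR12_sqrt ?mulr_ge0// -powRrM (mulrC 2^-1). Qed.

(** Both rate conditions are used in the form [rho ^ (delta - 1) * p -> oo].
    For [delta > 2] the quantity is [(n ^ s * p) ^ ((delta + 1) / 2)] with
    [s = (delta - 1) / (delta + 1)], and [s] is at least [delta / (4 + delta)]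
    exactly when [delta] is at least [2]. *)
Lemma rate_infty : rho n `^ (delta - 1) * p n @[n --> \oo] --> +oo.
Proof.
have [d2|d2|d2] := ltrgtP delta 2; first by move: d2; rewrite ltNge delta_ge2.
- apply/cvgryPge => M.
  have /cvgryPge/(_ (Num.max 1 M)) := delta_gt2 d2; move=> h.
  near=> n; have P0 : 0 < p n by near: n; exact: rate_gt0.
  have n1 : (1 <= n)%N by near: n; exact: nbhs_infty_ge.
  have : Num.max 1 M <= n%:R `^ (delta / (4 + delta)) * p n by near: n.
  rewrite ge_max => /andP[h1 hM]; apply: (le_trans hM).
  have n1' : (1 : R) <= n%:R by rewrite ler1n.
  pose s := (delta - 1) / (delta + 1); have d0 : 0 < delta by exact: lt_trans d2.
  have hs : delta / (4 + delta) <= s.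
    rewrite /s ler_pdivrMr ?addr_gt0// mulrAC ler_pdivlMr ?addr_gt0//.
    by move: (ltW d2) => d2'; nra.
  have h2 : n%:R `^ (delta / (4 + delta)) * p n <= n%:R `^ s * p n.
    by rewrite ler_wpM2r// ler_powR.
  apply: (le_trans h2).
  have E : rho n `^ (delta - 1) * p n = (n%:R `^ s * p n) `^ ((delta + 1) / 2).
    rewrite rho_pow !powRM ?powR_ge0// -powRrM -mulrA; congr (_ * _).
      by congr powR; rewrite /s mulrA divfK// gt_eqF// addr_gt0.
    rewrite -[X in _ * X](powRr1 (p_ge0 n)) -powRD; last by rewrite (gt_eqF P0) implybT.
    by congr powR; field.
  have h3 := le_trans h1 h2.
  rewrite E -[leLHS]powRr1; last exact: le_trans h3.
  by apply: ler_powR => //; rewrite ler_pdivlMr// mul1r; lra.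
- have := delta_eq2 d2 => /cvgryPge h; apply/cvgryPge => M; have hM := h M.
  near=> n; have P0 : 0 < p n by near: n; exact: rate_gt0.
  have : M <= n%:R `^ (1 / 2) * (p n `^ (3 / 2) / `|ln (p n)|) by near: n.
  move=> /le_trans; apply.
  have Pe : p n <= expR (-1).
    have : `|0 - p n| <= expR (-1).
      by near: n; move/cvgrPdist_le : p_cvg0; apply; exact: expR_gt0.
    by rewrite sub0r normrN ger0_norm.
  have l1 : 1 <= `|ln (p n)|.
    rewrite ler_normr; apply/orP; right; rewrite lerNr -[leRHS]expRK.
    by rewrite ler_ln// posrE expR_gt0.
  rewrite d2 rho_pow powRM// -mulrA (_ : 2 - 1 = 1); last by ring.
  rewrite ler_wpM2l ?powR_ge0// ler_pdivrMr ?(lt_le_trans ltr01)//.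
  rewrite (_ : p n `^ (1 / 2) * p n = p n `^ (3 / 2)); first by rewrite ler_peMr// powR_ge0.
  rewrite -[X in _ * X](powRr1 (p_ge0 n)) -powRD; last by rewrite (gt_eqF P0) implybT.
  by congr powR; field.
Unshelve. all: by end_near. Qed.

Variables (al : nat -> R) (t : nat).
Hypothesis al_ge0 : forall h, 0 <= al h.
Hypothesis al_rate : al =O_\oo (fun n : nat => n%:R `^ (- delta)).

Definition gap_bound s : R := if (s <= t)%N then 1 else al (s - t).

Lemma gap_bound_ge0 s : 0 <= gap_bound s.
Proof. by rewrite /gap_bound; case: ifP. Qed.

Lemma gap_bound_small (c : R) : 0 < c ->
  rho n / p n * gap_bound (Num.truncn (c * rho n)) @[n --> \oo] --> 0.
Proof.
move=> c0.
have [C C0 hC] : exists2 k, 0 < k & \forall n \near \oo, `|al n| <= k * `|n%:R `^ (- delta)|.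
  by have /eqO_exP[k k0 h] := al_rate; exists k.
have d0 : 0 < delta by exact: lt_le_trans delta_ge2.
pose D := C * ((c / 4) `^ delta)^-1.
have D0 : 0 < D by rewrite mulr_gt0// invr_gt0 powR_gt0// divr_gt0.
have rho_ge (M : R) : \forall n \near \oo, M <= rho n.
  have /cvgryPge/(_ (M ^+ 2)) := np_infty; apply: filterS => n h.
  have [M0|M0] := leP 0 M; last by rewrite (le_trans (ltW M0))// sqrtr_ge0.
  by rewrite -(ger0_norm M0) -sqrtr_sqr ler_wsqrtr.
case: hC => n0 _ hC.
apply/cvgrPdist_le => e e0.
have /cvgryPge/(_ (D / e)) hr := rate_infty.
near=> n; have P0 : 0 < p n by near: n; exact: rate_gt0.
have r1 : (4 * (t.+1%:R + n0%:R)) / c <= rho n by near: n; exact: rho_ge.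
have r2 : D / e <= rho n `^ (delta - 1) * p n by near: n.
have rho0 : 0 < rho n by rewrite (lt_le_trans _ r1)// divr_gt0// mulr_gt0// ltr_pwDl.
set s := Num.truncn _.
have s1 : c * rho n < s%:R + 1 by rewrite natr1 truncnS_gt.
have r1' : 4 * (t.+1%:R + n0%:R) <= c * rho n by rewrite (mulrC c) -ler_pdivrMr.
have T0 : (0 : R) <= t%:R by []. have N0 : (0 : R) <= n0%:R by [].
have s2 : t%:R + c * rho n / 4 <= s%:R.
  by apply: gap_aux T0 N0 _ s1; rewrite natr1.
have st : (t < s)%N.
  rewrite -(ltr_nat R) (lt_le_trans _ s2)// ltrDl divr_gt0// mulr_gt0//.
have s3 : c / 4 * rho n <= (s - t)%:R.
  by rewrite natrB ?(ltnW st)// lerBrDl mulrAC.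
have s4 : (n0 <= s - t)%N.
  rewrite -(ler_nat R) (le_trans _ s3)// mulrAC ler_pdivlMr//.
  by apply: (le_trans _ r1'); rewrite mulrC ler_wpM2l// lerDr.
have a1 : gap_bound s <= D * (rho n `^ delta)^-1.
  rewrite /gap_bound leqNgt st /=; have := hC _ s4; rewrite /= ger0_norm// => /le_trans; apply.
  rewrite ger0_norm ?powR_ge0// /D -mulrA ler_wpM2l ?(ltW C0)// powRN -invfM.
  have q0 : 0 < c / 4 * rho n by rewrite mulr_gt0// divr_gt0.
  rewrite -powRM ?(ltW rho0) ?divr_ge0 ?(ltW c0)//.
  rewrite lef_pV2 ?posrE ?powR_gt0// ?(lt_le_trans q0)//.
  by apply: ge0_ler_powR; rewrite ?nnegrE ?(ltW q0) ?(ltW d0)// ltW// (lt_le_trans q0).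
rewrite sub0r normrN ger0_norm; last first.
  by rewrite mulr_ge0 ?gap_bound_ge0// divr_ge0 ?p_ge0// ltW.
apply: (@le_trans _ _ (rho n / p n * (D * (rho n `^ delta)^-1))).
  by rewrite ler_wpM2l// divr_ge0 ?p_ge0// ltW.
have E : rho n `^ delta = rho n * rho n `^ (delta - 1) by rewrite mulr_powRB1// ltW.
rewrite E [leLHS](_ : _ = D / (rho n `^ (delta - 1) * p n)); last first.
  by field; rewrite !gt_eqF ?powR_gt0.
have W0 : 0 < rho n `^ (delta - 1) * p n by rewrite mulr_gt0// powR_gt0.
by rewrite ler_pdivrMr// mulrC -ler_pdivrMr.
Unshelve. all: by end_near. Qed.

End Rates.

Section WindowMixing.
Context {d d' : measure_display} {T : measurableType d} {T' : measurableType d'}.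
Context {R : realType} {P : probability T R} {P' : probability T' R}.
Variables (X : int -> {RV P >-> R}) (Y : int -> {RV P' >-> R}).
Hypothesis stat : strictly_stationary X.
Variables (u : nat -> R) (t m : nat) (A : 'I_m -> set 'rV[R]_t.+2) (a : 'I_m -> R).
Hypothesis rA : forall j, in_extreme_region (A j).
Hypothesis cA : forall j, tail_continuity_set Y (A j).
Local Notation summand := (summand X u A a).

Definition summand_of (n L i : nat) (z : 'rV[R]_L.+1) : R :=
  comb u A a n (pick_row (fun j : 'I_t.+2 => inord (i + j)) z) - comb_mean X u A a n.

Lemma measurable_summand_of n L i :
  measurable_fun setT (summand_of n i : borel_rV R L.+1 -> R).
Proof.
apply: measurable_funB => //.
apply: (measurableT_comp (measurable_comb u a cA n)).
apply: (@measurable_row _ _ _ (borel_rV R L.+1) (pick_row (fun j : 'I_t.+2 => inord (i + j)))) => j.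
by under eq_fun do rewrite mxE; exact: measurable_coord.
Qed.

Lemma summand_ofE n (k0 L i : nat) w : (i + t.+1 <= L)%N ->
  summand_of n i (window X k0%:Z L.+1 w) = summand n (k0 + i) w.
Proof.
move=> iL; rewrite /summand_of /summand; congr (comb _ _ _ _ _ - _).
apply/rowP => j; rewrite !mxE inordK; last by have := ltn_ord j; lia.
by congr (X _ w); lia.
Qed.

(** Sums over two blocks of summands are functions of two windows of the series
    that are as far apart as the blocks, up to the length of one window. *)
Lemma summand_mixing n s b (K : pred nat) (k0 : nat) (c y M' : R) (g : R -> R) :
  continuous g -> 0 < M' ->
  (forall w, `|g (\sum_(k0 + s <= i < k0 + s + b) summand n i w)| <= M') ->
  `|cov P (fun w => cos (c * \sum_(i < k0 | K i) summand n i w + y))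
     (fun w => g (\sum_(k0 + s <= i < k0 + s + b) summand n i w))|
  <= 4 * M' * gap_bound (alpha_mixing X) t s.
Proof.
move=> cg M'0 gM; have mg := continuous_measurable_fun cg.
have mS (r : seq nat) (q : pred nat) : measurable_fun setT (fun w => \sum_(i <- r | q i) summand n i w).
  have bS : bmf (fun w => \sum_(i <- r | q i) summand n i w).
    by apply: bmf_sum => i _; exact: (bmf_summand X u a rA cA n i).
  exact: bS.1.
have mF : measurable_fun setT (fun w => c * \sum_(i < k0 | K i) summand n i w + y).
  apply: measurable_funD => //; apply: measurable_funM => //.
  rewrite (_ : (fun _ => _) = fun w => \sum_(i <- iota 0 k0 | K i) summand n i w) //.
  by apply/funext => w; rewrite -(big_mkord K (fun i => summand n i w)) /index_iota subn0.
rewrite /gap_bound; case: ifP => st.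
  have := @cov_norm_le _ _ _ P _ _ 1 M' (bmf_cos mF) _ (fun w => cos_max _) gM.
  rewrite mul1r mulr1 => h; apply: le_trans (h _) _.
    split; last by exists M'.
    by apply: (measurableT_comp mg).
  by rewrite ler_wpM2r ?(ltW M'0)// ler_nat.
move/negbT: st; rewrite -ltnNge => st.
pose f (z : 'rV[R]_(k0 + t).+1) : R := cos (c * \sum_(i < k0 | K i) summand_of n i z + y).
pose h (z : 'rV[R]_(b + t).+1) : R := Num.max (- M') (Num.min M' (g (\sum_(i < b) summand_of n i z))).
have mf : measurable_fun setT (f : borel_rV R (k0 + t).+1 -> R).
  have mc : measurable_fun setT (@cos R) by apply: continuous_measurable_fun; exact: continuous_cos.
  apply: (measurableT_comp mc).
  apply: measurable_funD => //; apply: measurable_funM => //.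
  rewrite (_ : (fun _ => _) = fun z => \sum_(i <- [seq i <- iota 0 k0 | K i]) summand_of n i z); last first.
    by apply/funext => z; rewrite big_filter -(big_mkord K (fun i => summand_of n i z)) /index_iota subn0.
  by apply: measurable_sum => i; exact: measurable_summand_of.
have mh : measurable_fun setT (h : borel_rV R (b + t).+1 -> R).
  apply: measurable_maxr => //; apply: measurable_minr => //.
  apply: (measurableT_comp mg).
  by apply: measurable_sum => i; exact: measurable_summand_of.
have f1 z : `|f z| <= 1 by exact: cos_max.
have h1 z : `|h z| <= M'.
  rewrite ler_norml le_max lexx /= ge_max ge_min lexx /= andbT.
  by rewrite (le_trans _ (ltW M'0))// oppr_le0 ltW.
have := @cov_margin_le _ _ _ _ X stat _ _ (fun i : 'I_(k0 + t).+1 => 0%:Z + i%:Z)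
  (fun i : 'I_(b + t).+1 => (k0 + s)%:Z + i%:Z) (k0 + t)%:Z (s - t) f h 1 M' _ _ ltr01 M'0 mf f1 mh h1.
rewrite mul1r => H.
rewrite (_ : (fun w => cos _) = fun w => f (window X 0%:Z (k0 + t).+1 w)); last first.
  apply/funext => w; rewrite /f; congr (cos (c * _ + y)); apply: eq_bigr => i _.
  by rewrite summand_ofE ?add0n//; have := ltn_ord i; lia.
rewrite (_ : (fun w => g _) = fun w => h (window X (k0 + s)%:Z (b + t).+1 w)).
  by apply: H => i; have := ltn_ord i; lia.
apply/funext => w; have := gM w; rewrite sum_shift_iota /h => gw.
rewrite [X in _ = Num.max _ (Num.min _ (g X))](_ : _ = \sum_(i < b) summand n (k0 + s + i) w); last first.
  by apply: eq_bigr => i _; rewrite summand_ofE//; have := ltn_ord i; lia.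
move: gw; rewrite ler_norml => /andP[g1 g2].
by rewrite (min_idPr g2) (max_idPr g1).
Qed.

End WindowMixing.

Section CombCLT.
Context {d d' : measure_display} {T : measurableType d} {T' : measurableType d'}.
Context {R : realType} {P : probability T R} {P' : probability T' R}.
Variables (X : int -> {RV P >-> R}) (Y : int -> {RV P' >-> R}) (alpha : R).
Hypothesis alpha_gt0 : 0 < alpha.
Hypothesis stat : strictly_stationary X.
Hypothesis tailY : is_tail_process X Y alpha.
Variable u : nat -> R.
Hypothesis X_M : condition_M X u.
Local Notation p n := (pr P (exceed X 0 (u n))).
Variables (t m : nat) (A : 'I_m -> set 'rV[R]_t.+2).
Hypothesis rA : forall j, in_extreme_region (A j).
Hypothesis cA : forall j, tail_continuity_set Y (A j).
Variable delta : R.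
Hypothesis delta_ge2 : 2 <= delta.
Hypothesis X_mixing : alpha_mixing X =O_\oo (fun n : nat => n%:R `^ (- delta)).
Hypothesis delta_gt2 : 2 < delta -> n%:R `^ (delta / (4 + delta)) * p n @[n --> \oo] --> +oo.
Hypothesis delta_eq2 : delta = 2 ->
  n%:R `^ (1 / 2) * (p n `^ (3 / 2) / `|ln (p n)|) @[n --> \oo] --> +oo.
Variable a : 'I_m -> R.
Local Notation summand := (summand X u A a).
Local Notation rho n := (Num.sqrt (n%:R * p n)).

Theorem comb_clt (x : R) :
  mean P (fun w => cos ((rho n)^-1 * \sum_(i < n - t) summand n i w + x)) @[n --> \oo] -->
    expR (- (limit_var Y A a / 2)) * cos x.
Proof.
have [r [[_ _ npoo _] [p0 _ _]]] := condition_M_bounds X_M.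
have [G G0 hG] := gamma_sum_le stat X_M rA cA a.
have w0 : 0 < 2 * weight a by rewrite mulr_gt0// weight_gt0.
have p_gt0 := gt0_of_infty npoo.
have p_le1 n : p n <= 1 by apply: pr_le1; exact: measurable_exceed.
have small c : 0 < c -> rho n / p n * gap_bound (alpha_mixing X) t (Num.truncn (c * rho n))
    @[n --> \oo] --> 0.
  have pge n : 0 <= p n by exact: pr_ge0.
  move=> c0; exact: (gap_bound_small pge p0 npoo delta_ge2 delta_gt2 delta_eq2 t (alpha_mixing_ge0 X) X_mixing c0).
exact: (array_clt t w0 (fun n i => (bmf_summand X u a rA cA n i).1)
  (fun n i => summand_le X u a rA cA n i) (fun n i => summand_mean stat u a rA cA n i)
  (fun n => summand_cov stat u a rA cA n) p_gt0 p_le1 npoo G0 hG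
  (partial_gamma_cvg alpha_gt0 stat tailY X_M rA cA a)
  (gap_bound_ge0 t (alpha_mixing_ge0 X)) small
  (fun n s b K k0 c y M' g cg M0 gM => summand_mixing stat rA cA K c y cg M0 gM)
  (limit_var_ge0 alpha_gt0 stat tailY X_M rA cA a)).
Qed.

Lemma sum_sqr_le : exists2 G : R, 0 < G & \forall n \near \oo,
  mean P (fun w => (\sum_(i < n - t) summand n i w) ^+ 2) <= G * (n%:R * p n).
Proof.
have [G G0 hG] := gamma_sum_le stat X_M rA cA a.
exists (2 * G); first by rewrite mulr_gt0.
apply: filterS hG => n hG.
have := mean_sqr_sum_le (fun i => (bmf_summand X u a rA cA n i).1)
  (summand_le X u a rA cA n) (summand_cov stat u a rA cA n) xpredT (n - t) hG.
move=> /le_trans; apply; rewrite sum1_card card_ord -!mulrA ler_wpM2l// ler_wpM2l ?(ltW G0)//.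
by rewrite mulrC ler_wpM2r ?pr_ge0// ler_nat leq_subr.
Qed.

End CombCLT.

Section Slutsky.
Context {d : measure_display} {T : measurableType d} {R : realType}.
Variable P : probability T R.

Lemma row_moment_tail N (V : T -> 'rV[R]_N) (B : R) : (forall i, bmf (fun w => V w 0 i)) ->
  0 < B -> pr P [set w | B < `|V w|] <= (\sum_i mean P (fun w => V w 0 i ^+ 2)) / B ^+ 2.
Proof.
move=> bV B0; have bV2 i : bmf (fun w => V w 0 i ^+ 2) by exact: bmfM.
have mE : measurable [set w | B < `|V w|].
  exact: (measurable_norm_gt (V := V) B (fun i => (bV i).1)).
rewrite ler_pdivlMr ?exprn_gt0// mulrC -mean_indic// -meanZ; last exact: bmf_indic.
rewrite -mean_sum//; apply: le_mean => [||w].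
- by apply: bmfZ; exact: bmf_indic.
- exact: bmf_sum.
rewrite indicE; case: (boolP (_ \in _)) => [/set_mem/= h|_]; last first.
  by rewrite mulr0 sumr_ge0// => i _; exact: sqr_ge0.
have [i Bi] : exists i, B < `|V w 0 i|.
  apply: contrapT => nB; move: h; rewrite ltNge => /negP; apply.
  apply: row_norm_le => [|i]; first exact: ltW.
  by rewrite leNgt; apply/negP => Bi; apply: nB; exists i.
rewrite mulr1 (bigD1 i)//= ler_wpDr//; first by rewrite sumr_ge0// => k _; exact: sqr_ge0.
by rewrite -[leRHS]real_normK ?num_real// ler_sqr ?nnegrE ?(ltW B0)// ltW.
Qed.

Lemma linform_le N (x : 'rV[R]_N) (c : 'cV[R]_N) :
  `|(x *m c) 0 0| <= `|x| * \sum_i `|c i 0|.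
Proof.
rewrite mxE (le_trans (ler_norm_sum _ _ _))// mulr_sumr; apply: ler_sum => i _.
by rewrite normrM ler_wpM2r// coord_le_norm.
Qed.

(** Row vectors that differ by a quantity vanishing in probability have the
    same Gaussian limit. *)
Theorem slutsky_gaussian N (V W : nat -> T -> 'rV[R]_N) (C : 'M[R]_N) :
  (forall n i, measurable_fun setT (fun w => V n w 0 i)) ->
  (forall n i, measurable_fun setT (fun w => W n w 0 i)) ->
  C^T = C -> (forall c : 'cV[R]_N, 0 <= (c^T *m C *m c) 0 0) ->
  (forall (c : 'cV[R]_N) b, mean P (fun w => cos ((W n w *m c) 0 0 + b)) @[n --> \oo]
     --> expR (- ((c^T *m C *m c) 0 0 / 2)) * cos b) ->
  (forall e : R, 0 < e -> exists B : R, \forall n \near \oo,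
     pr P [set w | B < `|W n w|] <= e) ->
  (forall e : R, 0 < e -> \forall n \near \oo,
     pr P [set w | e < `|V n w - W n w|] <= e) ->
  cvg_to_gaussian P V 0 C.
Proof.
move=> mV mW CT Cpos Wcos Wtight close.
have mVW n i : measurable_fun setT (fun w => (V n w - W n w) 0 i).
  rewrite (_ : (fun _ => _) = fun w => V n w 0 i - W n w 0 i).
    exact: measurable_funB.
  by apply/funext => w; rewrite !mxE.
have mE e n : measurable [set w | e < `|V n w - W n w|].
  exact: (measurable_norm_gt (V := fun w => V n w - W n w) e (mVW n)).
apply: cos_cvg_to_gaussian => //.
- move=> c b; pose K := \sum_i `|c i 0|.
  have K0 : 0 <= K by exact: sumr_ge0.
  have bc (U : nat -> T -> 'rV[R]_N) n : (forall n i, measurable_fun setT (fun w => U n w 0 i)) ->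
      bmf (fun w => cos ((U n w *m c) 0 0 + b)).
    move=> mU; apply: bmf_cos; apply: measurable_funD => //.
    exact: (measurable_linform (Z := U n) c (mU n)).
  apply/cvgrPdist_le => e e0; pose e' := e / 2 / (K + 2).
  have e'0 : 0 < e' by rewrite !divr_gt0// ltr_wpDl.
  have e20 : 0 < e / 2 by rewrite divr_gt0.
  have h1 := (cvgrPdist_le _ _).1 (Wcos c b) _ e20.
  have h2 := close _ e'0; near=> n.
  have n1 : `|expR (- ((c^T *m C *m c) 0 0 / 2)) * cos b
     - mean P (fun w => cos ((W n w *m c) 0 0 + b))| <= e / 2 by near: n; exact: h1.
  have n2 : pr P [set w | e' < `|V n w - W n w|] <= e' by near: n.
  have bW := bc W n mW; have bV := bc V n mV.
  have n3 : `|mean P (fun w => cos ((W n w *m c) 0 0 + b))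
      - mean P (fun w => cos ((V n w *m c) 0 0 + b))| <= e / 2.
    rewrite -meanB//; apply: (le_trans (mean_norm P (bmfB bW bV))).
    have bE : bmf (\1_[set w | e' < `|V n w - W n w|] : T -> R) by exact: bmf_indic.
    apply: (@le_trans _ _ (mean P (fun w => K * e' + 2 * \1_[set w | e' < `|V n w - W n w|] w))).
      apply: le_mean => [||w]; first exact/bmf_norm/bmfB.
        by apply: bmfD; [exact: bmf_cst|exact: bmfZ].
      rewrite indicE; case: (boolP (_ \in _)) => [_|/negP nw].
        rewrite mulr1; apply: ler_wpDl; first by rewrite mulr_ge0// ltW.
        by rewrite (le_trans (ler_normB _ _))// mulr2n lerD ?cos_max.
      rewrite mulr0 addr0 (le_trans (cos_lip _ _))//.
      rewrite (_ : _ - _ = - ((V n w - W n w) *m c) 0 0); last by rewrite mulmxBl !mxE; ring.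
      rewrite normrN (le_trans (linform_le _ _))// mulrC ler_wpM2l// leNgt.
      by apply/negP => hw; apply: nw; apply: mem_set.
    rewrite meanD; [|exact: bmf_cst|exact: bmfZ].
    rewrite mean_cst meanZ// mean_indic// (le_trans (lerD (lexx _) (ler_wpM2l _ n2)))//.
    by rewrite -mulrDl /e' mulrC divfK// gt_eqF// ltr_wpDl.
  rewrite [e]splitr (le_trans (ler_distD (mean P (fun w => cos ((W n w *m c) 0 0 + b))) _ _))//.
  by rewrite lerD.
- move=> e e0; have e20 : 0 < e / 2 by rewrite divr_gt0.
  have [B hB] := Wtight _ e20.
  pose e' := Num.min 1 (e / 2); have e'0 : 0 < e' by rewrite lt_min ltr01.
  have h2 := close _ e'0; exists (B + 1); near=> n.
  have n1 : pr P [set w | B < `|W n w|] <= e / 2 by near: n.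
  have n2 : pr P [set w | e' < `|V n w - W n w|] <= e' by near: n.
  have mWB := measurable_norm_gt (V := W n) B (mW n).
  rewrite [e]splitr; apply: (le_trans _ (lerD n1 (le_trans n2 _))); last by rewrite ge_min lexx orbT.
  apply: (le_trans _ (pr_setU P mWB (mE e' n))); apply: le_pr.
  + exact: (measurable_norm_gt (V := V n) _ (mV n)).
  + exact: measurableU.
  move=> w /= h; have [hW|hW] := ltP B `|W n w|; first by left.
  right; rewrite /= (@le_lt_trans _ _ 1)// ?ge_min ?lexx//.
  rewrite -(ltrD2l B) (lt_le_trans h)// -[in leLHS](subrK (W n w) (V n w)) addrC.
  by rewrite (le_trans (ler_normD _ _))// lerD2r.
Unshelve. all: by end_near. Qed.

End Slutsky.

Section RatioAlgebra.
Context {R : realType}.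

(** The exact linearization of the ratio: [s j] is the centred sum behind the
    numerator, and the only nonlinearity left is the division by the denominator. *)
Lemma ratio_linearized (rho n k sj s0 pj p0 : R) : rho != 0 -> n != 0 -> p0 != 0 ->
  n^-1 * (s0 + k * p0) != 0 ->
  rho * (n^-1 * (sj + k * pj) / (n^-1 * (s0 + k * p0)) - pj / p0) =
  (rho^-1 * sj - pj / p0 * (rho^-1 * s0)) / (n^-1 * (s0 + k * p0) / (rho ^+ 2 / n)).
Proof.
move=> r0 n0 p00 h; have h' : s0 + k * p0 != 0.
  by apply: contraNneq h => ->; rewrite mulr0.
by field; rewrite h' n0 p00 r0.
Qed.

Lemma denominator_split (rho n p z h k : R) : rho ^+ 2 = n * p -> rho != 0 -> n != 0 ->
  n^-1 * (rho * z + (n - k) * h) / p = z / rho + h / p - k / n * (h / p).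
Proof.
move=> rho2 r0 n0; have -> : p = rho ^+ 2 / n by rewrite rho2 mulrC mulKf.
by field; rewrite n0 r0.
Qed.

Lemma ratio_perturbation (mu dl D q m B z y : R) : 0 < mu -> 0 < dl -> dl <= 1 -> dl <= mu / 2 ->
  `|D - mu| <= dl -> `|q - m| <= dl -> `|z| <= B -> `|y| <= B ->
  `|(z - q * y) / D - (z - m * y) / mu| <= dl * (B * (2 + `|m|) * (2 / mu ^+ 2) + B / mu).
Proof.
move=> mu0 dl0 dl1 dl2 hD hq hz hy; have B0 : 0 <= B by exact: le_trans hz.
have D2 : mu / 2 <= D.
  by move: hD; rewrite ler_distl => /andP[h _]; move: h dl2; clear; lra.
have D0 : 0 < D by apply: lt_le_trans D2; rewrite divr_gt0.
rewrite (_ : _ - _ = (z - q * y) * ((mu - D) / (D * mu)) - y * (q - m) / mu); last first.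
  by field; rewrite !gt_eqF.
have hqm : `|q| <= 1 + `|m|.
  rewrite -[in leLHS](subrK m q) (le_trans (ler_normD _ _))//.
  by rewrite lerD// (le_trans hq).
have hqy : `|q * y| <= (1 + `|m|) * B by rewrite normrM ler_pM.
have hzq : `|z - q * y| <= B * (2 + `|m|).
  rewrite (le_trans (ler_normB _ _))// (_ : B * _ = B + (1 + `|m|) * B); last by ring.
  by rewrite lerD.
have hDi : `|(mu - D) / (D * mu)| <= dl * (2 / mu ^+ 2).
  rewrite normrM normfV distrC ler_pM// ger0_norm ?mulr_ge0 ?(ltW D0) ?(ltW mu0)//.
  rewrite -[2 / _]invf_div lef_pV2 ?posrE ?divr_gt0 ?mulr_gt0 ?exprn_gt0//.
  by rewrite expr2 mulrAC ler_wpM2r// ltW.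
rewrite [leRHS]mulrDr (le_trans (ler_normB _ _))// lerD//.
  by rewrite normrM [leRHS]mulrCA ler_pM.
rewrite normrM normfV (gtr0_norm mu0) mulrA ler_wpM2r ?invr_ge0 ?(ltW mu0)//.
by rewrite normrM mulrC ler_pM.
Qed.

End RatioAlgebra.

Section Estimators.
Context {d d' : measure_display} {T : measurableType d} {T' : measurableType d'}.
Context {R : realType} {P : probability T R} {P' : probability T' R}.
Variables (X : int -> {RV P >-> R}) (Y : int -> {RV P' >-> R}).
Variables (u : nat -> R) (t m : nat) (A : 'I_m -> set 'rV[R]_t.+2).
Hypothesis cA : forall j, tail_continuity_set Y (A j).
Local Notation p n := (pr P (exceed X 0 (u n))).
Local Notation rho n := (Num.sqrt (n%:R * p n)).

Lemma borel_scaled_set v (B : set 'rV[R]_t.+2) : borel_set B -> borel_set (scaled_set v B).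
Proof.
move=> bB; have [->|v0] := eqVneq v 0.
  have [->|/set0P[x Bx]] := eqVneq B set0.
    rewrite /scaled_set image_set0; exact: (@measurable0 _ (borel_rV R t.+2)).
  apply: closed_borel; rewrite (_ : scaled_set 0 B = [set 0]).
    exact/accessible_closed_set1/hausdorff_accessible/norm_hausdorff.
  apply/seteqP; split => [y [z _ <-]|y ->]; first by rewrite /= scale0r.
  by exists x => //; rewrite scale0r.
rewrite (_ : scaled_set v B = (fun x => v^-1 *: x) @^-1` B).
  apply: (@measurable_preimage_row _ _ _ (borel_rV R t.+2) (fun x : 'rV[R]_t.+2 => v^-1 *: x)) => // i.
  rewrite (_ : (fun _ => _) = fun x : borel_rV R t.+2 => v^-1 * (x : 'rV[R]_t.+2) 0 i).
    by apply: measurable_funM => //; exact: measurable_coord.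
  by apply/funext => x; rewrite mxE.
apply/seteqP; split => [y [z Bz <-]|y /= By].
  by rewrite /= scalerA mulVf// scale1r.
by exists (v^-1 *: y) => //; rewrite scalerA mulfV// scale1r.
Qed.

Lemma measurable_P_hat n v (B : set 'rV[R]_t.+2) : borel_set B -> measurable_fun setT (P_hat X n v B).
Proof.
move=> bB; apply: measurable_funM => //.
apply: measurable_sum => k.
have mS : measurable (scaled_set v B : set (borel_rV R t.+2)) by exact: borel_scaled_set.
have mi : measurable_fun setT (\1_(scaled_set v B) : borel_rV R t.+2 -> R) by exact: measurable_indic.
have i1 (x : 'rV[R]_t.+2) : `|\1_(scaled_set v B) x : R| <= 1.
  by case/andP: (@indic01 R _ (scaled_set v B) x) => h0 h1; rewrite ger0_norm.
exact: (@bmf_margin _ _ _ _ X _ (fun i : 'I_t.+2 => k%:Z - 1 + i%:Z) _ _ mi i1).1.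
Qed.

Lemma P_hat_ge0 n v (B : set 'rV[R]_t.+2) w : 0 <= P_hat X n v B w.
Proof. by rewrite mulr_ge0// sumr_ge0. Qed.

Lemma measurable_R_hat c n v (B B0 : set 'rV[R]_t.+2) : borel_set B -> borel_set B0 ->
  measurable_fun setT (R_hat X c n v B B0).
Proof.
move=> bB bB0; have m1 := measurable_P_hat n v bB; have m0 := measurable_P_hat n v bB0.
have mi : measurable_fun setT (\1_[set (0 : R)] : R -> R) by exact: measurable_indic.
have mi0 : measurable_fun setT (fun w => \1_[set (0 : R)] (P_hat X n v B0 w) : R).
  exact: (measurableT_comp mi m0).
have mV : measurable_fun setT (fun w => P_hat X n v B0 w `^ (-1)).
  exact: (measurableT_comp (measurable_powR (-1)) m0).
rewrite (_ : R_hat X c n v B B0 = fun w => P_hat X n v B w * P_hat X n v B0 w `^ (-1)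
    + c * \1_[set 0] (P_hat X n v B0 w)).
  by apply: measurable_funD; apply: measurable_funM.
apply/funext => w; rewrite /R_hat powR_inv1 ?P_hat_ge0// indicE.
case: eqP => [->|/eqP h]; first by rewrite invr0 mulr0 add0r mem_set// mulr1.
by rewrite memNset ?mulr0 ?addr0//; exact/eqP.
Qed.

Definition hit_mean n j : R := mean P (fun w => hit (u n) (A j) (window X (-1) t.+2 w)).

Definition hit_sum n j w : R :=
  \sum_(i < n - t) (hit (u n) (A j) (window X i%:Z t.+2 w) - hit_mean n j).

Definition scaled_sums n w : 'rV[R]_m := \row_j ((rho n)^-1 * hit_sum n j w).

Lemma bmf_hit n b j : bmf (fun w => hit (u n) (A j) (window X b t.+2 w)).
Proof.
exact: (@bmf_margin _ _ _ _ X _ _ _ _ (measurable_hit (u n) (cA j).1) (hit_norm (u n) (A j))).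
Qed.

Lemma bmf_scaled_sums n j : bmf (fun w => scaled_sums n w 0 j).
Proof.
rewrite (_ : (fun _ => _) = fun w => (rho n)^-1 * hit_sum n j w).
  apply: bmfZ; apply: bmf_sum => i _.
  by apply: bmfB; [exact: bmf_hit|exact: bmf_cst].
by apply/funext => w; rewrite mxE.
Qed.

Lemma comb_hit_sum (a : 'I_m -> R) n w :
  \sum_j a j * hit_sum n j w = \sum_(i < n - t) summand X u A a n i w.
Proof.
under eq_bigr => j _ do rewrite mulr_sumr.
rewrite exchange_big; apply: eq_bigr => i _ /=.
under eq_bigr => j _ do rewrite mulrBr.
rewrite sumrB /summand; congr (_ - _); rewrite /comb_mean /comb mean_sum.
  by apply: eq_bigr => j _; rewrite meanZ//; exact: bmf_hit.
by move=> j _; apply: bmfZ; exact: bmf_hit.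
Qed.

Lemma P_hatE n j w : 0 < u n ->
  P_hat X n (u n) (A j) w = n%:R^-1 * (hit_sum n j w + (n - t)%:R * hit_mean n j).
Proof.
move=> u0; congr (_ * _); rewrite big_add1 /= big_mkord /hit_sum sumrB sumr_const card_ord.
rewrite -[_ *+ (n - t)]mulr_natl subrK; apply: eq_bigr => i _.
by rewrite hit_scaled//; congr (hit _ _ (margin X _ w)); apply/funext => k; lia.
Qed.

Lemma block_prE n j : 0 < u n -> block_pr X (u n) (A j) = hit_mean n j.
Proof.
move=> u0; rewrite /block_pr -mean_indic; last first.
  by apply: measurable_margin_preimage; apply: borel_scaled_set; exact: (cA j).1.
by congr mean; apply/funext => w; rewrite -hit_scaled.
Qed.

End Estimators.

Lemma trmx_scale (R : comNzRingType) (m n : nat) (k : R) (M : 'M[R]_(m, n)) :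
  (k *: M)^T = k *: M^T.
Proof. by apply/matrixP => i j; rewrite !mxE. Qed.

Section RatioLimit.
Context {d d' : measure_display} {T : measurableType d} {T' : measurableType d'}.
Context {R : realType} {P : probability T R} {P' : probability T' R}.
Variables (X : int -> {RV P >-> R}) (Y : int -> {RV P' >-> R}) (alpha : R).
Hypothesis alpha_gt0 : 0 < alpha.
Hypothesis stat : strictly_stationary X.
Hypothesis tailY : is_tail_process X Y alpha.
Variable u : nat -> R.
Hypothesis X_M : condition_M X u.
Local Notation p n := (pr P (exceed X 0 (u n))).
Local Notation rho n := (Num.sqrt (n%:R * p n)).
Variables (t N : nat) (A : 'I_(1 + N) -> set 'rV[R]_t.+2).
Hypothesis rA : forall j, in_extreme_region (A j).
Hypothesis cA : forall j, tail_continuity_set Y (A j).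
Local Notation mu j := (tail_law Y (A j)).
Local Notation A_ j := (A (rshift 1 j)).
Local Notation A0 := (A ord0).
Hypothesis mu0_gt0 : 0 < mu ord0.
Local Notation Z := (scaled_sums X u A).
Local Notation F := (F_mx Y A).

Definition ratio_lin n w : 'rV[R]_N := (mu ord0) ^- 2 *: (Z n w *m F^T).

Lemma ratio_linE n w j : ratio_lin n w 0 j =
  (Z n w 0 (rshift 1 j) - mu (rshift 1 j) / mu ord0 * Z n w 0 ord0) / mu ord0.
Proof.
have m0 : mu ord0 != 0 by rewrite gt_eqF.
rewrite /ratio_lin; move: (Z n w) => z.
rewrite 2!mxE big_split_ord /= big_ord1 mxE /F_mx row_mxEl mxE.
rewrite (bigD1 j)//= big1 => [|i ij].
  rewrite mxE row_mxEr mxE eqxx mulr1n addr0.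
  rewrite (_ : lshift N ord0 = ord0); last exact: val_inj.
  by field.
by rewrite mxE row_mxEr mxE eq_sym (negbTE ij) mulr0n mulr0.
Qed.

Lemma lin_coef n w (c : 'cV[R]_N) :
  (ratio_lin n w *m c) 0 0 =
  (rho n)^-1 * \sum_(i < n - t)
    summand X u A (fun i => ((mu ord0) ^- 2 *: (F^T *m c)) i 0) n i w.
Proof.
rewrite -(comb_hit_sum X u cA) /ratio_lin -scalemxAl -mulmxA scalemxAr mxE mulr_sumr.
by apply: eq_bigr => i _; rewrite [Z n w _ _]mxE; ring.
Qed.

Lemma quad_formE (S : 'M[R]_(1 + N)) (v : 'cV[R]_(1 + N)) :
  (v^T *m S *m v) 0 0 = \sum_j \sum_l v j 0 * v l 0 * S j l.
Proof.
rewrite mxE exchange_big; apply: eq_bigr => l _; rewrite mxE mulr_suml; apply: eq_bigr => j _.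
by rewrite !mxE; ring.
Qed.

Definition ratio_cov : 'M[R]_N := (mu ord0) ^- 4 *: (F *m Sigma_mx Y A *m F^T).

Lemma ratio_cov_quad (c : 'cV[R]_N) :
  (c^T *m ratio_cov *m c) 0 0 = limit_var Y A (fun i => ((mu ord0) ^- 2 *: (F^T *m c)) i 0).
Proof.
transitivity ((((mu ord0) ^- 2 *: (F^T *m c))^T *m Sigma_mx Y A *m ((mu ord0) ^- 2 *: (F^T *m c))) 0 0).
  rewrite /ratio_cov trmx_scale trmx_mul trmxK -!scalemxAl -!scalemxAr -!scalemxAl scalerA !mulmxA.
  by rewrite -invfM -exprD.
rewrite quad_formE; apply: eq_bigr => j _; apply: eq_bigr => l _.
by congr (_ * _); rewrite mxE.
Qed.

Lemma ratio_cov_ge0 (c : 'cV[R]_N) : 0 <= (c^T *m ratio_cov *m c) 0 0.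
Proof. by rewrite ratio_cov_quad; exact: (limit_var_ge0 alpha_gt0 stat tailY X_M). Qed.

Lemma ratio_cov_sym : ratio_cov^T = ratio_cov.
Proof.
rewrite /ratio_cov trmx_scale !trmx_mul trmxK mulmxA; congr (_ *: (_ *m _ *m _)).
apply/matrixP => i j; rewrite !mxE.
exact: (sigma_entryC cA).
Qed.

Lemma measurable_ratio_lin n j : measurable_fun setT (fun w => ratio_lin n w 0 j).
Proof.
rewrite (_ : (fun _ => _) = fun w =>
    (Z n w 0 (rshift 1 j) - mu (rshift 1 j) / mu ord0 * Z n w 0 ord0) * (mu ord0)^-1).
  have b1 := bmf_scaled_sums X u cA n (rshift 1 j).
  have b0 := bmf_scaled_sums X u cA n ord0.
  by apply: measurable_funM => //; apply: (bmfB b1 (bmfZ _ b0)).1.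
by apply/funext => w; exact: ratio_linE.
Qed.

Lemma scaled_sums_tight e : 0 < e -> exists2 B : R, 0 < B &
  \forall n \near \oo, pr P [set w | B < `|Z n w|] <= e.
Proof.
move=> e0; have [r [[_ _ npoo _] _]] := condition_M_bounds X_M.
have G_ex (j : 'I_(1 + N)) : exists G : R, 0 < G /\ \forall n \near \oo,
    mean P (fun w => Z n w 0 j ^+ 2) <= G.
  have [G G0 hG] := sum_sqr_le stat X_M rA cA (fun i => (i == j)%:R).
  exists G; split => //; near=> n.
  have P0 : 0 < p n by near: n; exact: gt0_of_infty npoo.
  have n0 : (0 < n)%N by near: n; exact: nbhs_infty_gt.
  have np0 : 0 < n%:R * p n by rewrite mulr_gt0// ltr0n.
  have h : mean P (fun w => (\sum_(i < n - t) summand X u A (fun i => (i == j)%:R) n i w) ^+ 2)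
    <= G * (n%:R * p n) by near: n.
  have bS : bmf (fun w => hit_sum X u A n j w).
    by apply: bmf_sum => i _; apply: bmfB; [exact: (bmf_hit X u cA)|exact: bmf_cst].
  have -> : (fun w => Z n w 0 j ^+ 2) = fun w => (n%:R * p n)^-1 * hit_sum X u A n j w ^+ 2.
    by apply/funext => w; rewrite mxE exprMn exprVn sqr_sqrtr// ltW.
  rewrite meanZ; last by exact: bmfM.
  rewrite ler_pdivrMl// mulrC; apply: le_trans h; rewrite le_eqVlt; apply/orP; left; apply/eqP.
  congr mean; apply/funext => w; rewrite -(comb_hit_sum X u cA); congr (_ ^+ 2).
  rewrite (bigD1 j)//= eqxx mul1r big1 ?addr0// => i /negbTE ->; exact: mul0r.
have [G hG] := choice G_ex.
pose S := \sum_j G j; have S0 : 0 <= S by apply: sumr_ge0 => j _; exact: ltW (hG j).1.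
pose B := 1 + S / e; have B1 : 1 <= B by rewrite lerDl divr_ge0// ltW.
have B0 : 0 < B by exact: lt_le_trans B1.
exists B => //.
have hall : \forall n \near \oo, forall j, mean P (fun w => Z n w 0 j ^+ 2) <= G j.
  by apply: filter_forall => j; exact: (hG j).2.
apply: filterS hall => n hn.
apply: (le_trans (row_moment_tail P (V := Z n) (bmf_scaled_sums X u cA n) B0)).
rewrite ler_pdivrMr ?exprn_gt0//; apply: (@le_trans _ _ S); first by apply: ler_sum.
have SB : S <= e * B by rewrite /B mulrDr mulr1 mulrCA divff ?gt_eqF// mulr1 lerDr ltW.
by rewrite (le_trans SB)// ler_wpM2l ?(ltW e0)// expr2 ler_peMl// ltW.
Unshelve. all: by end_near. Qed.

Lemma ratio_lin_le n w : `|ratio_lin n w| <=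
  `|Z n w| * (`|mu ord0 ^- 2| * \sum_j \sum_i `|F j i|).
Proof.
have S0 : 0 <= \sum_j \sum_i `|F j i| by apply: sumr_ge0 => j _; exact: sumr_ge0.
apply: row_norm_le => [|j]; first by rewrite !mulr_ge0.
rewrite mxE normrM mulrCA ler_wpM2l//.
rewrite mxE (le_trans (ler_norm_sum _ _ _))// (bigD1 j)//= mulrDr ler_wpDr//.
  by rewrite mulr_ge0// sumr_ge0// => k _; exact: sumr_ge0.
rewrite mulr_sumr; apply: ler_sum => i _.
by rewrite normrM [F^T _ _]mxE ler_wpM2r// coord_le_norm.
Qed.

(** On the event that the scaled sums are bounded, the normalized ratio is
    uniformly close to its linearization. *)
Lemma ratio_close (c : R) (bias : nat -> 'I_N -> R) (B e : R) :
  (forall j, bias n j @[n --> \oo] --> 0) -> 0 < e ->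
  \forall n \near \oo, forall w, `|Z n w| <= B -> forall j,
    `|rho n * (R_hat X c n (u n) (A_ j) A0 w - block_pr X (u n) (A_ j) / block_pr X (u n) A0)
      + bias n j - ratio_lin n w 0 j| <= e.
Proof.
move=> bias0 e0; have [r [[uoo _ npoo _] _]] := condition_M_bounds X_M.
pose close n j := forall w, `|Z n w| <= B ->
  `|rho n * (R_hat X c n (u n) (A_ j) A0 w - block_pr X (u n) (A_ j) / block_pr X (u n) A0)
    + bias n j - ratio_lin n w 0 j| <= e.
suff close_j j : \forall n \near \oo, close n j.
  have close_all : \forall n \near \oo, forall j, close n j by apply: filter_forall.
  by apply: filterS close_all => n hn w ZB j; exact: hn.
rewrite {}/close.
have [B0|B0] := leP 0 B; last first.
  by apply: nearW => n w /(le_trans (normr_ge0 _)); rewrite leNgt B0.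
set k1 := rshift 1 j; pose mm := mu k1 / mu ord0.
pose K := B * (2 + `|mm|) * (2 / mu ord0 ^+ 2) + B / mu ord0.
have K0 : 0 <= K.
  by rewrite addr_ge0// ?mulr_ge0 ?invr_ge0 ?exprn_ge0 ?addr_ge0 ?(ltW mu0_gt0).
pose dl := Num.min (Num.min 1 (mu ord0 / 2)) (e / 2 / (K + 1)).
have dl0 : 0 < dl by rewrite !lt_min ltr01 !divr_gt0// ltr_wpDl.
have dl1 : dl <= 1 by rewrite !ge_min lexx.
have dl2 : dl <= mu ord0 / 2 by rewrite !ge_min lexx orbT.
have dlK : dl * K <= e / 2.
  apply: (@le_trans _ _ (dl * (K + 1))); first by rewrite ler_wpM2l ?lerDl ?(ltW dl0).
  by rewrite -ler_pdivlMr ?ltr_wpDl// ge_min lexx orbT.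
have pcv i : hit_mean X u A n i / p n @[n --> \oo] --> mu i.
  exact: (hit_cvg alpha_gt0 stat tailY uoo (@rA i) (cA i)).
have e20 : 0 < e / 2 by rewrite divr_gt0.
have d40 : 0 < dl / 4 by rewrite divr_gt0.
have qcv : hit_mean X u A n k1 / hit_mean X u A n ord0 @[n --> \oo] --> mm.
  have m0 : mu ord0 != 0 by rewrite gt_eqF.
  have H : (hit_mean X u A n k1 / p n) * (hit_mean X u A n ord0 / p n)^-1 @[n --> \oo] --> mm.
    by apply: cvgM (pcv k1) _; apply: cvgV (pcv ord0).
  apply: cvg_trans H; apply: near_eq_cvg; near=> n.
  have P0 : 0 < p n by near: n; exact: gt0_of_infty npoo.
  by rewrite /= invf_div mulrA divfK// gt_eqF.
have h1 := (cvgrPdist_le _ _).1 (pcv ord0) _ d40.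
have h2 := (cvgrPdist_le _ _).1 qcv _ dl0.
have h3 := (cvgrPdist_le _ _).1 (bias0 j) _ e20.
near=> n => w ZB.
have u0 : 0 < u n by near: n; exact: v_gt0.
have P0 : 0 < p n by near: n; exact: gt0_of_infty npoo.
have n1 : `|mu ord0 - hit_mean X u A n ord0 / p n| <= dl / 4 by near: n; exact: h1.
have n2 : `|mm - hit_mean X u A n k1 / hit_mean X u A n ord0| <= dl by near: n; exact: h2.
have n3 : `|bias n j| <= e / 2.
  have : `|0 - bias n j| <= e / 2 by near: n; exact: h3.
  by rewrite sub0r normrN.
have n4 : t%:R * (mu ord0 + 1) / (dl / 4) <= n%:R by near: n; exact: nbhs_infty_ger.
have n5 : (t < n)%N by near: n; exact: nbhs_infty_gt.
have n6 : 2 * B / dl <= rho n by near: n; exact: rho_infty.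
have n7 : 1 <= rho n by near: n; exact: rho_infty.
have nn0 : (0 : R) < n%:R by rewrite ltr0n; apply: leq_ltn_trans n5.
have rho0 : 0 < rho n by exact: lt_le_trans n7.
have rho2 : rho n ^+ 2 = n%:R * p n by rewrite sqr_sqrtr// mulr_ge0// ltW.
set h0 := hit_mean X u A n ord0 in n1 n2 *.
have h0p : mu ord0 / 2 <= h0 / p n.
  have : dl / 4 <= mu ord0 / 2 by rewrite (le_trans _ dl2)// ler_pdivrMr// ler_peMr ?(ltW dl0)// ler1n.
  by move: n1; rewrite ler_distl => /andP[n1 n1'] dd; move: n1 n1' dd mu0_gt0; clear; lra.
have h00 : 0 < h0.
  by rewrite -(pmulr_lgt0 _ (_ : 0 < (p n)^-1)) ?invr_gt0// (lt_le_trans _ h0p)// divr_gt0.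
have h0p1 : h0 / p n <= mu ord0 + 1.
  by move: n1 dl1; rewrite ler_distl => /andP[n1 _]; move: n1 dl0; clear; lra.
have Zc i : `|Z n w 0 i| <= B by exact: le_trans (coord_le_norm _ _) ZB.
have ZE i : hit_sum X u A n i w = rho n * Z n w 0 i.
  by rewrite mxE mulVKf// gt_eqF.
pose D := P_hat X n (u n) A0 w / p n.
have DE : D = Z n w 0 ord0 / rho n + h0 / p n - t%:R / n%:R * (h0 / p n).
  rewrite /D (P_hatE X A ord0 w u0) -/h0 ZE natrB; last exact: ltnW.
  by apply: denominator_split rho2 _ _; rewrite gt_eqF.
have Dmu : `|D - mu ord0| <= dl.
  have z1 : `|Z n w 0 ord0 / rho n| <= dl / 2.
    rewrite normrM normfV (gtr0_norm rho0) ler_pdivrMr// (le_trans (Zc _))//.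
    by move: n6; rewrite ler_pdivrMr// => n6; rewrite mulrAC ler_pdivlMr// mulrC (mulrC dl).
  have z2 : `|t%:R / n%:R * (h0 / p n)| <= dl / 4.
    rewrite ger0_norm; last by rewrite mulr_ge0 ?divr_ge0// ltW.
    apply: (@le_trans _ _ (t%:R / n%:R * (mu ord0 + 1))); first by rewrite ler_wpM2l// divr_ge0// ltW.
    by rewrite mulrAC ler_pdivrMr// [leRHS]mulrC -ler_pdivrMr ?divr_gt0.
  rewrite DE (_ : _ - mu ord0 = Z n w 0 ord0 / rho n + ((h0 / p n - mu ord0) - t%:R / n%:R * (h0 / p n)));
    last by ring.
  rewrite (_ : dl = dl / 2 + (dl / 4 + dl / 4)); last by field.
  apply: (le_trans (ler_normD _ _)); apply: lerD => //.
  by apply: (le_trans (ler_normB _ _)); apply: lerD => //; rewrite distrC.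
have D0 : 0 < D.
  have := mu0_gt0; move: Dmu; rewrite ler_distl => /andP[D1 _].
  by move: D1 dl2; clear; lra.
have Q0 : P_hat X n (u n) A0 w != 0.
  by apply: contraTneq D0 => Q0; rewrite /D Q0 mul0r ltxx.
have lin : rho n * (R_hat X c n (u n) (A_ j) A0 w - block_pr X (u n) (A_ j) / block_pr X (u n) A0) =
    (Z n w 0 k1 - hit_mean X u A n k1 / h0 * Z n w 0 ord0) / D.
  rewrite /R_hat (negbTE Q0) !(block_prE X cA _ u0) -/h0 /D.
  move: Q0; rewrite !(P_hatE X A _ w u0) -/h0 -/k1 => Q0.
  rewrite ratio_linearized; [|by rewrite gt_eqF|by rewrite gt_eqF|by rewrite gt_eqF|exact: Q0].
  rewrite [Z n w 0 k1]mxE [Z n w 0 ord0]mxE.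
  by rewrite rho2 [n%:R * p n]mulrC mulfK// gt_eqF.
rewrite lin ratio_linE -/k1 -/mm addrAC [e]splitr.
apply: (le_trans (ler_normD _ _)); apply: lerD => //; apply: le_trans dlK.
by apply: ratio_perturbation => //; rewrite distrC.
Unshelve. all: by end_near. Qed.

Variable delta : R.
Hypothesis delta_ge2 : 2 <= delta.
Hypothesis X_mixing : alpha_mixing X =O_\oo (fun n : nat => n%:R `^ (- delta)).
Hypothesis delta_gt2 : 2 < delta -> n%:R `^ (delta / (4 + delta)) * p n @[n --> \oo] --> +oo.
Hypothesis delta_eq2 : delta = 2 ->
  n%:R `^ (1 / 2) * (p n `^ (3 / 2) / `|ln (p n)|) @[n --> \oo] --> +oo.

Definition ratio_dev (c : R) (bias : nat -> 'I_N -> R) n w : 'rV[R]_N :=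
  \row_(j < N) (rho n * (R_hat X c n (u n) (A_ j) A0 w
    - block_pr X (u n) (A_ j) / block_pr X (u n) A0) + bias n j).

Theorem ratio_clt (c : R) (bias : nat -> 'I_N -> R) :
  (forall j, bias n j @[n --> \oo] --> 0) ->
  cvg_to_gaussian P (ratio_dev c bias) 0 ratio_cov.
Proof.
move=> bias0.
have mV n (i : 'I_N) : measurable_fun setT (fun w => ratio_dev c bias n w 0 i).
  under eq_fun do rewrite mxE.
  apply: measurable_funD => //; apply: measurable_funM => //; apply: measurable_funB => //.
  by apply: measurable_R_hat; exact: (cA _).1.
apply: (slutsky_gaussian mV measurable_ratio_lin ratio_cov_sym ratio_cov_ge0).
- move=> v b; rewrite ratio_cov_quad.
  under eq_fun do under eq_fun do rewrite lin_coef.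
  exact: (comb_clt alpha_gt0 stat tailY X_M rA cA delta_ge2 X_mixing delta_gt2 delta_eq2).
- move=> e e0; have [B B0 hB] := scaled_sums_tight e0.
  pose L := `|mu ord0 ^- 2| * \sum_j \sum_i `|F j i|.
  have L0 : 0 <= L by rewrite mulr_ge0// sumr_ge0// => j _; exact: sumr_ge0.
  exists (B * L); apply: filterS hB => n; apply: le_trans; apply: le_pr.
  + exact: (measurable_norm_gt (V := ratio_lin n) _ (measurable_ratio_lin n)).
  + exact: (measurable_norm_gt (V := Z n) _ (fun i => (bmf_scaled_sums X u cA n i).1)).
  move=> w /= h; rewrite ltNge; apply/negP => ZB.
  by move: h; rewrite ltNge (le_trans (ratio_lin_le n w))// ler_wpM2r.
- move=> e e0; have [B B0 hB] := scaled_sums_tight e0.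
  have hc := @ratio_close c bias B e bias0 e0.
  apply: filterS2 hB hc => n n1 hn.
  apply: le_trans n1; apply: le_pr.
  + apply: (measurable_norm_gt (V := fun w => ratio_dev c bias n w - ratio_lin n w)) => i.
    rewrite (_ : (fun _ => _) = fun w => ratio_dev c bias n w 0 i - ratio_lin n w 0 i).
      by apply: measurable_funB; [exact: mV|exact: measurable_ratio_lin].
    by apply/funext => w; rewrite !mxE.
  + exact: (measurable_norm_gt (V := Z n) _ (fun i => (bmf_scaled_sums X u cA n i).1)).
  move=> w /= h; rewrite ltNge; apply/negP => ZB.
  move: h; rewrite ltNge => /negP; apply; apply: row_norm_le; first exact: ltW.
  by move=> j; rewrite mxE [X in X + _]mxE [X in _ + X]mxE; exact: hn.
Qed.

End RatioLimit.

Theorem corollary4p6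
  (d d' : measure_display) (T : measurableType d) (T' : measurableType d')
  (R : realType) (P : probability T R) (P' : probability T' R)
  (X : int -> {RV P >-> R}) (Y : int -> {RV P' >-> R}) (alpha : R)
  (alpha_gt0 : 0 < alpha)
  (X_stationary : strictly_stationary X)
  (X_lower : finite_lower_endpoint X)
  (X_frechet : in_frechet_domain X alpha)
  (X_rv : regularly_varying X alpha)
  (Y_tail : is_tail_process X Y alpha)
  (t N : nat) (N_gt0 : (0 < N)%N)
  (A : 'I_(1 + N) -> set 'rV[R]_t.+2)
  (A_region : forall j, in_extreme_region (A j))
  (A_cont : forall j, tail_continuity_set Y (A j))
  (A0_gt0 : 0 < tail_law Y (A ord0))
  (u : nat -> R)
  (X_M : condition_M X u)
  (delta : R) (delta_ge2 : 2 <= delta)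
  (X_mixing : alpha_mixing X =O_\oo (fun n : nat => n%:R `^ (- delta)))
  (u_delta_gt2 : 2 < delta ->
    n%:R `^ (delta / (4 + delta)) * pr P (exceed X 0 (u n)) @[n --> \oo] --> +oo)
  (u_delta_eq2 : delta = 2 ->
    n%:R `^ (1 / 2) * (pr P (exceed X 0 (u n)) `^ (3 / 2)
                       / `|ln (pr P (exceed X 0 (u n)))|) @[n --> \oo] --> +oo)
  (c : R) :
  let rate n := Num.sqrt (n%:R * pr P (exceed X 0 (u n))) in
  let A_ (j : 'I_N) := A (rshift 1 j) in
  let A0 := A ord0 in
  let pre_ratio n j := block_pr X (u n) (A_ j) / block_pr X (u n) A0 in
  let lim_ratio j := tail_law Y (A_ j) / tail_law Y A0 in
  let cov := (tail_law Y A0) ^- 4 *: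
             (F_mx Y A *m Sigma_mx Y A *m (F_mx Y A)^T) in
  (forall j l, sigma_entry Y (A j) (A l) \is a fin_num) /\
  cvg_to_gaussian P
    (fun n w => \row_(j < N)
       (rate n * (R_hat X c n (u n) (A_ j) A0 w - pre_ratio n j)))
    0 cov /\
  ((forall j : 'I_N,
      rate n * (pre_ratio n j - lim_ratio j) @[n --> \oo] --> 0) ->
   cvg_to_gaussian P
     (fun n w => \row_(j < N)
        (rate n * (R_hat X c n (u n) (A_ j) A0 w - lim_ratio j)))
     0 cov).
Proof.
move=> rate A_ A0 pre_ratio lim_ratio cov; split; [|split].
- by move=> j l; exact: (sigma_entry_fin_num alpha_gt0 X_stationary Y_tail X_M A_region A_cont).
- have := ratio_clt alpha_gt0 X_stationary Y_tail X_M A_region A_cont A0_gt0 delta_ge2 X_mixing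
    u_delta_gt2 u_delta_eq2 c (bias := fun _ _ => 0) (fun j => cvg_cst 0).
  rewrite (_ : ratio_dev _ _ _ _ _ = fun n w => \row_(j < N)
    (rate n * (R_hat X c n (u n) (A_ j) A0 w - pre_ratio n j))); first exact.
  by apply/funext => n; apply/funext => w; apply/rowP => j; rewrite !mxE addr0.
- move=> bias0.
  have := ratio_clt alpha_gt0 X_stationary Y_tail X_M A_region A_cont A0_gt0 delta_ge2 X_mixing
    u_delta_gt2 u_delta_eq2 c bias0.
  rewrite (_ : ratio_dev _ _ _ _ _ = fun n w => \row_(j < N)
    (rate n * (R_hat X c n (u n) (A_ j) A0 w - lim_ratio j))); first exact.
  apply/funext => n; apply/funext => w; apply/rowP => j; rewrite !mxE -mulrDr.
  by congr (_ * _); rewrite addrA subrK.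
Qed.
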